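(* Let $m\ge1$ be an integer, $\mathbf p=(p_1,\dots,p_m)\in[1,+\infty]^m$, $\left|\frac1{\mathbf p}\right|:=\frac1{p_1}+\dots+\frac1{p_m}$, and let $1\le s\le q\le+\infty$ be such that \[ \left|\tfrac1{\mathbf p}\right|<\tfrac12+\tfrac1s-\tfrac1{\min\{q,2\}} . \] Define $\lambda>0$ by \[ \frac1\lambda:=\frac12+\frac1s-\frac1{\min\{q,2\}}-\left|\frac1{\mathbf p}\right| . \] For $t_1,\dots,t_m\in[1,+\infty)$ consider the condition \[ \frac1{t_1}+\dots+\frac1{t_m}\le\frac1\lambda+\frac{m-1}{\max\{\lambda,s,2\}}\qquad(\ast) \] and the property (HL) there exists $C>0$ such that, for every continuous $m$-linear map $A:X_{p_1}\times\dots\times X_{p_m}\to X_s$, \[ \left(\sum_{i_1=1}^{+\infty}\left(\dots\left(\sum_{i_m=1}^{+\infty}\|A(e_{i_1},\dots,e_{i_m})\|_{\ell_q}^{t_m}\right)^{\frac{t_{m-1}}{t_m}}\dots\right)^{\frac{t_1}{t_2}}\right)^{\frac1{t_1}}\le C\|A\| . \] (1) If $t_1,\dots,t_m\in[\lambda,\max\{\lambda,s,2\}]$ satisfy $(\ast)$, then (HL) holds. (2) (Optimality.) Suppose that it is not the case that both $q\le2$ and $\left|\frac1{\mathbf p}\right|>\frac12$. (a) If $\lambda<2$ and $t_1,\dots,t_m\in[1,+\infty)$ are such that (HL) holds, then $(\ast)$ holds. (b) If $\lambda\ge2$ and $t_1=\dots=t_m=t\in[1,+\infty)$ are such that (HL)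 holds, then $(\ast)$ holds (and consequently $t\ge\lambda$).
   Context: Scalars are $\mathbb K=\mathbb R$ or $\mathbb C$. For $1\le p<+\infty$, $X_p:=\ell_p$, and $X_\infty:=c_0$ (with the sup norm); $(e_i)_{i\ge1}$ denotes the canonical unit vectors. Convention: $1/\infty=0$. Since $s\le q$, elements of $X_s$ belong to $\ell_q$ and $\|\cdot\|_{\ell_q}$ is their $\ell_q$-norm. $\|A\|$ is the usual norm of a multilinear operator, i.e. the supremum of $\|A(x^{(1)},\dots,x^{(m)})\|_{X_s}$ over $x^{(j)}$ in the closed unit ball of $X_{p_j}$. In the nested sum, the innermost sum is over $i_m$ with exponent $t_m$ and the outermost over $i_1$ with exponent $t_1$ (an iterated mixed $\ell_{t_1}(\ell_{t_2}(\cdots(\ell_{t_m})))$ norm). *)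

(* Defs.v *)
From HB Require Import structures.
From mathcomp Require Import all_boot all_order all_algebra.
From mathcomp Require Import finmap complex.
From mathcomp Require Import all_classical all_reals all_analysis.
From mathcomp Require Import ess_sup_inf.

Set Implicit Arguments.
Unset Strict Implicit.
Unset Printing Implicit Defensive.
Import Order.TTheory GRing.Theory Num.Theory.
Import numFieldNormedType.Exports.

Local Open Scope classical_set_scope.
Local Open Scope ring_scope.

Variant scalar_kind := RealScalars | ComplexScalars.

Definition scalar_field (R : realType) (k : scalar_kind) : numFieldType :=
  match k with
  | RealScalars => R
  | ComplexScalars => R[i]
  end.

Definition modulus (R : realType) (k : scalar_kind) : scalar_field R k -> R :=
  match k return scalar_field R k -> R with
  | RealScalars => fun x : R => `|x|
  | ComplexScalars => fun z : R[i] => complex.Re `|z|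
  end.

Definition of_real (R : realType) (k : scalar_kind) : R -> scalar_field R k :=
  match k return R -> scalar_field R k with
  | RealScalars => fun r : R => r
  | ComplexScalars => fun r : R => (r%:C)%C
  end.

Section scalar_theory.
Context (R : realType) (k : scalar_kind).
Local Notation K := (scalar_field R k).
Implicit Types (x y : K) (r : R).

Lemma normr_modulus x : `|x| = of_real k (modulus x).
Proof.
case: k x => [//|z]; rewrite /modulus /of_real.
by have -> : `|z : R[i]| = (complex.Re `|z : R[i]|)%:C%C by rewrite normc_def.
Qed.

Lemma modulus_ge0 x : 0 <= modulus x.
Proof.
case: k x => [x|z]; rewrite /modulus; first exact: (@normr_ge0 R).
by rewrite (@normc_def R) sqrtr_ge0.
Qed.

Lemma modulus_eq0 x : modulus x = 0 -> x = 0.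
Proof.
move=> x0; apply/eqP; rewrite -normr_eq0 normr_modulus x0.
by case: k x x0.
Qed.

Lemma modulus_of_real r : 0 <= r -> modulus (of_real k r) = r.
Proof.
move=> r0; case: k; rewrite /modulus /of_real; first exact: (@ger0_norm R).
by rewrite (@normc_def R) /= expr0n /= addr0 sqrtr_sqr ger0_norm.
Qed.

Lemma of_real_inj : injective (@of_real R k).
Proof. by case: k => //= a b; case. Qed.

Lemma of_real0 : of_real k 0 = 0 :> K. Proof. by case: k. Qed.
Lemma of_real1 : of_real k 1 = 1 :> K. Proof. by case: k. Qed.

Lemma of_realD r r' : of_real k (r + r') = of_real k r + of_real k r'.
Proof. by case: k => //=; rewrite rmorphD. Qed.

Lemma of_realM r r' : of_real k (r * r') = of_real k r * of_real k r'.
Proof. by case: k => //=; rewrite rmorphM. Qed.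

Lemma ler_of_real r r' : (of_real k r <= of_real k r') = (r <= r').
Proof. by case: k => //=; rewrite lecR. Qed.

Lemma modulusM x y : modulus (x * y) = modulus x * modulus y.
Proof. by apply: of_real_inj; rewrite of_realM -!normr_modulus normrM. Qed.

Lemma modulus0 : modulus (0 : K) = 0.
Proof. by apply: of_real_inj; rewrite -normr_modulus normr0 of_real0. Qed.

Lemma modulusD x y : modulus (x + y) <= modulus x + modulus y.
Proof. by rewrite -ler_of_real of_realD -!normr_modulus ler_normD. Qed.

End scalar_theory.

Section sequence_norm.
Context (R : realType) (k : scalar_kind).
Local Notation K := (scalar_field R k).
Local Open Scope ereal_scope.
Implicit Types (p : \bar R) (x y : nat -> K).

Definition lp_norm p x : \bar R := 'N[counting]_p[EFin \o (@modulus R k \o x)].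

Lemma counting_nat_gt0 : 0 < (@counting nat R) [set: nat].
Proof.
rewrite /counting asboolF ?ltry// => finT.
exact: infinite_nat finT.
Qed.

Lemma lp_norm_ge0 p x : 0 <= lp_norm p x.
Proof. exact: Lnorm_ge0. Qed.

Lemma lp_normE (r : R) x : (0 < r)%R ->
  lp_norm r%:E x = (\sum_(n <oo) (modulus (x n))%:E `^ r) `^ r^-1.
Proof.
move=> r0; rewrite /lp_norm Lnorm_counting//; congr (_ `^ _).
by apply: eq_eseriesr => n _ /=; rewrite ger0_norm// modulus_ge0.
Qed.

Lemma lp_normyE x :
  lp_norm +oo x = ess_sup counting (EFin \o (@modulus R k \o x)).
Proof.
rewrite /lp_norm unlock /Lnorm counting_nat_gt0; congr ess_sup.
by apply/funext => n /=; rewrite ger0_norm// modulus_ge0.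
Qed.

Lemma gt0_ge1 (r : R) : 1 <= r%:E -> (0 < r)%R.
Proof. by rewrite lee_fin; exact: lt_le_trans. Qed.

Lemma le_Lnorm_counting p (f g : nat -> R) : 1 <= p ->
  (forall n, (0 <= f n <= g n)%R) ->
  'N[counting]_p[EFin \o f] <= 'N[counting]_p[EFin \o g].
Proof.
move=> p1 fg.
have f0 n : (0 <= f n)%R by case/andP: (fg n).
have g0 n : (0 <= g n)%R by case/andP: (fg n) => ? ?; exact: le_trans (_ : f n <= g n)%R.
case: p p1 => [r /gt0_ge1 r0| _|//].
  rewrite !Lnorm_counting//; apply: gt0_ler_poweR.
  - by rewrite invr_ge0 ltW.
  - by rewrite in_itv /= leey andbT; apply: nneseries_ge0 => *; rewrite lee_fin powR_ge0.
  - by rewrite in_itv /= leey andbT; apply: nneseries_ge0 => *; rewrite lee_fin powR_ge0.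
  apply: lee_nneseries => [n _ _|n _]; first exact: poweR_ge0.
  have /andP[_ fgn] := fg n.
  by rewrite /= lee_fin !ger0_norm// ge0_ler_powR ?nnegrE// ltW.
rewrite unlock /Lnorm counting_nat_gt0; apply: le_ess_sup; apply/nearW => n /=.
by rewrite lee_fin !ger0_norm//; case/andP: (fg n).
Qed.

Lemma lp_normD p x y : 1 <= p -> lp_norm p (x + y)%R <= lp_norm p x + lp_norm p y.
Proof.
move=> p1; apply: le_trans (eminkowski _ _ _ p1) => //.
apply: le_Lnorm_counting => // n /=.
by rewrite modulus_ge0 modulusD.
Qed.

Lemma lp_normZ p (a : K) x : 1 <= p ->
  lp_norm p (a *: x)%R = (modulus a)%:E * lp_norm p x.
Proof.
case: p => [r /gt0_ge1 r0| _|//]; last first.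
  rewrite !lp_normyE -ess_supZl ?counting_nat_gt0 ?modulus_ge0//.
  by congr ess_sup; apply/funext => n /=; rewrite modulusM.
rewrite !lp_normE//.
under eq_eseriesr => n _.
  rewrite [modulus _](_ : _ = (modulus a * modulus (x n))%R); last exact: modulusM.
  rewrite EFinM poweRM ?lee_fin ?modulus_ge0// poweR_EFin.
  over.
rewrite nneseriesZl; last by move=> *; exact: poweR_ge0.
rewrite poweRM; last 2 first.
- by rewrite lee_fin powR_ge0.
- by apply: nneseries_ge0 => *; exact: poweR_ge0.
by rewrite poweR_EFin -powRrM mulfV ?gt_eqF// powRr1 ?modulus_ge0.
Qed.

Lemma ae_counting (P : nat -> Prop) :
  (\forall n \ae (@counting nat R), P n) -> forall n, P n.
Proof.
move=> [A [_ A0 PA]] n; apply: contrapT => nP.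
have : A n by apply: PA.
move: A0; rewrite /counting; case: ifPn => // /asboolP finA /eqP.
rewrite eqe pnatr_eq0 cardfs_eq0 => /eqP/(congr1 (fun B => n \in B)).
rewrite in_fset_set// in_fset0 => /negbT.
by rewrite notin_setE.
Qed.

Lemma lp_norm_eq0 p x : 1 <= p -> lp_norm p x = 0 -> forall n, x n = 0%R.
Proof.
move=> p1 x0 n; apply: modulus_eq0.
suff: forall i, setT i -> (EFin \o (@modulus R k \o x)) i = 0.
  by move=> /(_ n I)[].
apply: ae_counting; apply: (Lnorm_eq0_eq0 _ (lt_le_trans lte01 p1) x0).
by [].
Qed.

Lemma cvg_lp_normy x (l : K) : x @ \oo --> l -> lp_norm +oo x < +oo.
Proof.
move=> xl; have : cvgn x by apply/cvg_ex; exists l.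
move=> /cvg_seq_bounded /pinfty_ex_gt0[M M0 Mx].
rewrite lp_normyE (@le_lt_trans _ _ (modulus M)%:E) ?ltry//.
apply: ess_sup_ler => n /=; rewrite lee_fin -(ler_of_real k) -!normr_modulus.
by rewrite (gtr0_norm M0); exact: Mx.
Qed.

End sequence_norm.

Section sequence_space.
Context (R : realType) (k : scalar_kind) (p : \bar R) (p1 : (1 <= p)%E).
Local Notation K := (scalar_field R k).

(* For p = +oo this is c_0, not l_infinity. The unused proof of 1 <= p is an
   argument so that the submodule instance below can be inferred. *)
Definition Xp_mem of (1 <= p)%E : {pred nat -> K} := fun x =>
  if p == +oo%E then `[< x @ \oo --> (0 : K) >] else (lp_norm p x < +oo)%E.

Lemma Xp_norm_lty x : x \in Xp_mem p1 -> (lp_norm p x < +oo)%E.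
Proof.
rewrite unfold_in /Xp_mem; case: ifPn => // /eqP -> /asboolP.
exact: cvg_lp_normy.
Qed.

Lemma Xp_submod_closed : submod_closed (Xp_mem p1).
Proof.
split=> [|a x y]; rewrite !unfold_in /Xp_mem; case: ifPn => // poo.
- by apply/asboolP; exact: cvg_cst.
- rewrite -[0](scale0r (0 : nat -> K)) lp_normZ// modulus0 mul0e.
  exact: ltry.
- move=> /asboolP x0 /asboolP y0; apply/asboolP.
  rewrite (_ : 0 = a *: 0 + 0); last by rewrite scaler0 addr0.
  by apply: cvgD => //; exact: cvgZr.
- move=> xoo yoo; apply: le_lt_trans (lp_normD _ _ p1) _.
  rewrite lp_normZ// lte_add_pinfty// lte_mul_pinfty// ?lee_fin ?modulus_ge0//.
Qed.

HB.instance Definition _ :=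
  GRing.isSubmodClosed.Build K (nat -> K) (Xp_mem p1) Xp_submod_closed.

Record Xp := MkXp { Xp_seq :> nat -> K ; _ : Xp_seq \in Xp_mem p1 }.

HB.instance Definition _ := [isSub for Xp_seq].
HB.instance Definition _ := [Choice of Xp by <:].
HB.instance Definition _ := [SubChoice_isSubLmodule of Xp by <:].

(* Norms in a normedModType K take their values in K, even when K = R[i]. *)
Definition Xp_norm (x : Xp) : K := of_real k (fine (lp_norm p x)).

Lemma Xp_norm_fin_num (x : Xp) : lp_norm p x \is a fin_num.
Proof. by rewrite ge0_fin_numE ?lp_norm_ge0 ?Xp_norm_lty// (valP x). Qed.

Lemma ler_Xp_normD (x y : Xp) : Xp_norm (x + y) <= Xp_norm x + Xp_norm y.
Proof.
rewrite /Xp_norm -of_realD ler_of_real -lee_fin EFinD !fineK ?Xp_norm_fin_num//.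
exact: lp_normD.
Qed.

Lemma Xp_normZ (a : K) (x : Xp) : Xp_norm (a *: x) = `|a| * Xp_norm x.
Proof.
rewrite /Xp_norm normr_modulus -of_realM; congr of_real.
by apply: EFin_inj; rewrite EFinM !fineK ?Xp_norm_fin_num// -lp_normZ.
Qed.

Lemma Xp_norm_eq0 (x : Xp) : Xp_norm x = 0 -> x = 0.
Proof.
rewrite /Xp_norm -(of_real0 R k) => /of_real_inj x0; apply: val_inj.
apply/funext => n; apply: (lp_norm_eq0 p1).
by rewrite -[LHS]fineK ?Xp_norm_fin_num// x0.
Qed.

HB.instance Definition _ :=
  Lmodule_isNormed.Build K Xp ler_Xp_normD Xp_normZ Xp_norm_eq0.

Definition unit_seq (i : nat) : nat -> K := fun n => (n == i)%:R.

Lemma unit_seq_mem i : unit_seq i \in Xp_mem p1.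
Proof.
rewrite unfold_in /Xp_mem; case: ifPn => [_|poo].
  apply/asboolP/cvgrPdist_lt => e e0; near=> n.
  rewrite /unit_seq gtn_eqF ?subr0 ?normr0//.
  by near: n; exact: nbhs_infty_gt.
case: p p1 poo => [r r1| //|//] _.
rewrite lp_normE ?(gt0_ge1 r1)// poweR_lty//.
rewrite (@nneseries_split _ _ 0 i.+1); last by move=> *; exact: poweR_ge0.
rewrite add0n eseries0 => [|n ni _]; last first.
  rewrite /unit_seq gtn_eqF// modulus0 poweR0r// gt_eqF//.
  exact: gt0_ge1.
by rewrite adde0; apply: lte_sum_pinfty => n _; rewrite poweR_lty ?ltry.
Unshelve. all: by end_near. Qed.

Definition unit_vector (i : nat) : Xp := MkXp (unit_seq_mem i).

End sequence_space.

Definition multilinear (K : numFieldType) (I : eqType) (E : I -> lmodType K)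
    (F : lmodType K) (A : (forall i, E i) -> F) :=
  forall (x : forall i, E i) (i : I), linear (fun u : E i => A (dfwith x i u)).

Section Hardy_Littlewood.
Context (R : realType) (k : scalar_kind).
Local Open Scope ereal_scope.

Definition operator_norm (I : Type)
    (E : I -> normedModType (scalar_field R k))
    (F : normedModType (scalar_field R k)) (A : (forall i, E i) -> F) : \bar R :=
  ereal_sup [set (modulus `|A x|%R)%:E | x in
    [set x : forall i, E i | forall i, (`|x i| <= 1)%R]].

(* The first exponent in t is that of the outermost sum. *)
Fixpoint mixed_norm (t : seq R) (a : seq nat -> \bar R) : \bar R :=
  if t is t1 :: t' then
    (\sum_(0 <= i <oo) mixed_norm t' (fun w => a (i :: w)) `^ t1) `^ t1^-1
  else a [::].

Definition HL m (p : 'I_m -> \bar R) (p1 : forall j, 1 <= p j)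
    (s : \bar R) (s1 : 1 <= s) (q : \bar R) (t : m.-tuple R) : Prop :=
  exists2 C : R, (0 < C)%R &
    forall A : (forall j, Xp k (p1 j)) -> Xp k s1,
      multilinear A ->
      continuous (A : prod_topology (fun j => Xp k (p1 j)) -> Xp k s1) ->
      mixed_norm t (fun i : seq nat =>
        lp_norm q (A (fun j => unit_vector k (p1 j) (nth 0%N i j))))
      <= C%:E * operator_norm A.

End Hardy_Littlewood.

Section exponents.
Context (R : realType) (m : nat).
Local Open Scope ereal_scope.
Implicit Types (p : 'I_m -> \bar R) (s q : \bar R).

Definition inv_sum p : \bar R := \sum_(j < m) (p j)^-1.

Definition lambda p s q : \bar R :=
  (2^-1%:E + s^-1 - (mine q 2%:E)^-1 - inv_sum p)^-1.

Definition lambda_max p s q : \bar R := maxe (lambda p s q) (maxe s 2%:E).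

Definition exponent_condition p s q (t : m.-tuple R) : Prop :=
  \sum_(j < m) (tnth t j)^-1%:E
    <= (lambda p s q)^-1 + (m.-1)%:R%:E / lambda_max p s q.

End exponents.

(* Main.v *)
(* Upper bounds.  Write a point of the unit ball of l_p as |x| <= h^(1/p) with h of mass 1,
   so that only finite families of weights occur.  Khintchine's inequality for Rademacher
   chaos gives the mixed (l_1, l_2) inequality for (m+1)-linear forms on c_0, the output index
   being the last variable; it also holds for every weighted form.  The weights are then
   removed one variable at a time: if N_v denotes the mass of the fibre over v, duality bounds
   sum N_v^a, and testing with h = N^a and applying Hoelder's inequality transfers the bound to
   the fibres of all other variables, the exponent improving according to 1/a = 1/a0 - b.
   General exponents t follow by multiplying by powers of the fibre masses and applying
   Hoelder's inequality for mixed norms.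

   Optimality.  The diagonal map x -> (x^1_j ... x^m_j)_j, and maps built from a tensor of
   signs which is random and therefore has injective norm n^(1/2 + o(1)) on Euclidean balls,
   turn (HL) into an inequality between powers of n. *)
Require Import Defs.
From mathcomp Require Import all_boot all_order all_algebra.
From mathcomp Require Import ring lra.
From mathcomp Require Import complex.
From mathcomp Require Import all_classical all_reals all_analysis.
From mathcomp Require Import ess_sup_inf.
Import Order.TTheory GRing.Theory Num.Theory.
Import numFieldNormedType.Exports.

Set Implicit Arguments.
Unset Strict Implicit.
Unset Printing Implicit Defensive.

Local Open Scope ring_scope.

(** * Powers and Hoelder inequalities *)

Section powers.
Context {R : realType}.
Implicit Types (x y a b c e t : R).

(** All masses are sums of [mu]-th powers of norms, with [mu = max(s, 2)]. Exponents thereby turn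
    into [lambda / mu], and the maximum in the exponent condition marks the threshold
    [lambda / mu = 1]: below it Hoelder can trade the mass of one fibre against that of another,
    above it [l_a] norms with [a > 1] swallow the fibres and only an unmixed sum is left. The
    obstacle is that removing a weight must give the bound for all variables at once, since the next
    weight sits on another variable; hence symmetric hypotheses, required of every weighted form.
    For the sign tensor no net of the Euclidean balls is used. The union bound runs over vectors
    with entries in {-1, 0, 1}, and a functional bounded on these is bounded on the ball up to the
    root of a harmonic sum. Such a loss is harmless, because powers of [n] are compared only up to
    an arbitrarily small exponent. *)

Lemma ler_powR2 x y e : 0 <= x -> x <= y -> 0 <= e -> x `^ e <= y `^ e.
Proof. by move=> x0 xy e0; apply: ge0_ler_powR; rewrite ?nnegrE// (le_trans x0). Qed.

Lemma powRDp x a b : 0 <= x -> 0 < a -> 0 <= b -> x `^ a * x `^ b = x `^ (a + b).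
Proof.
move=> x0 a0 b0; rewrite powRD//; apply/implyP => /eqP ab.
by exfalso; move: ab a0 b0 => ab; rewrite -[a](addrK b) ab sub0r oppr_gt0 ltNge => /negP.
Qed.

Lemma powRDgt0 x a b : 0 < x -> x `^ a * x `^ b = x `^ (a + b).
Proof. by move=> x0; rewrite powRD// (gt_eqF x0) implybT. Qed.

Lemma pow1R e : 1 `^ e = 1 :> R.
Proof. by rewrite powR1. Qed.

Lemma powR_gt1 x e : 1 < x -> 0 < e -> 1 < x `^ e.
Proof.
move=> x1 e0; rewrite -(pow1R e) gt0_ltr_powR ?nnegrE ?ler01//.
by rewrite (le_trans ler01)// ltW.
Qed.

Lemma powRV x e : 0 <= x -> (x^-1) `^ e = (x `^ e)^-1.
Proof. by move=> x0; rewrite -powR_inv1// -powRrM mulN1r powRN. Qed.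

Lemma powR_le1 x e : 0 <= x <= 1 -> 0 <= e -> x `^ e <= 1.
Proof. by move=> /andP[x0 x1] e0; by rewrite -(pow1R e) ler_powR2. Qed.

Lemma powR_prod (I : Type) (r : seq I) (F : I -> R) e :
  (forall i, 0 <= F i) -> (\prod_(i <- r) F i) `^ e = \prod_(i <- r) F i `^ e.
Proof.
move=> F0; elim: r => [|i r IH]; first by rewrite !big_nil pow1R.
by rewrite !big_cons powRM ?IH// prodr_ge0.
Qed.

(** The tangent inequality [ln y <= y - 1] at [y = x / a], raised to the power [e]. The base point
    [a] is free so that several such bounds can be multiplied at a common mean. *)
Lemma powR_expR x e a : 0 <= x -> 0 < a -> 0 <= e ->
  x `^ e <= a `^ e * expR (e * (x / a - 1)).
Proof.
move=> x0 a0 e0; have [->|en0] := eqVneq e 0.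
  by rewrite !powRr0 mul0r expR0 mulr1.
have [->|xn0] := eqVneq x 0.
  by rewrite powR0// mulr_ge0// ?powR_ge0// expR_ge0.
have xp : 0 < x by rewrite lt_def xn0.
have {1}-> : x = a * (x / a) by rewrite mulrC divfK// gt_eqF.
have xa0 : 0 < x / a by rewrite divr_gt0.
rewrite powRM ?(ltW a0) ?(ltW xa0)//; apply: ler_wpM2l; first exact: powR_ge0.
rewrite /powR gt_eqF ?divr_gt0// ler_expR ler_wpM2l//.
have := @le_ln1Dx R (x / a - 1).
rewrite addrCA subrr addr0; apply.
by rewrite ltrBrDl subrr divr_gt0.
Qed.

Lemma amgm (I : Type) (r : seq I) (e x : I -> R) :
  (forall i, 0 <= e i) -> (forall i, 0 <= x i) -> \sum_(i <- r) e i = 1 ->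
  \prod_(i <- r) x i `^ e i <= \sum_(i <- r) e i * x i.
Proof.
(* The slack [d] keeps the base point [A + d] positive when the mean [A] is 0. *)
move=> e0 x0 e1; apply/ler_addgt0Pr => d d0.
set A := \sum_(i <- r) e i * x i.
have A0 : 0 < A + d by rewrite ltr_wpDl// sumr_ge0// => i _; rewrite mulr_ge0.
apply: (@le_trans _ _ (\prod_(i <- r) ((A + d) `^ e i * expR (e i * (x i / (A + d) - 1))))).
  by apply: ler_prod => i _; rewrite powR_ge0 powR_expR.
rewrite big_split /= -expR_sum.
have -> : \prod_(i <- r) (A + d) `^ e i = A + d.
  rewrite /powR (gt_eqF A0) -expR_sum -mulr_suml e1 mul1r.
  by rewrite lnK.
rewrite ler_piMr ?(ltW A0)// -[leRHS]expR0 ler_expR.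
under eq_bigr do rewrite mulrBr mulr1 mulrA.
rewrite big_split /= -mulr_suml sumrN e1 subr_le0 ler_pdivrMr// mul1r.
by rewrite lerDl ltW.
Qed.

Lemma amgm2 x y e : 0 <= x -> 0 <= y -> 0 <= e <= 1 ->
  x `^ e * y `^ (1 - e) <= e * x + (1 - e) * y.
Proof.
move=> x0 y0 /andP[e0 e1].
have := @amgm bool [:: true; false] (fun z : bool => if z then e else 1 - e)
  (fun z : bool => if z then x else y).
rewrite !big_cons !big_nil /= !addr0 !mulr1; apply.
- by case; lra.
- by case.
- lra.
Qed.

Lemma sum_le0_eq0 (I : finType) (P : pred I) (a : I -> R) : (forall i, 0 <= a i) ->
  \sum_(i | P i) a i <= 0 -> forall i, P i -> a i = 0.
Proof.
move=> a0 s0 i Pi; have : \sum_(i | P i) a i == 0.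
  by rewrite eq_le s0 sumr_ge0.
by rewrite psumr_eq0// => /allP/(_ i (mem_index_enum _)); rewrite Pi => /eqP.
Qed.

Lemma holder (I : finType) (P : pred I) (a b : I -> R) e :
  (forall i, 0 <= a i) -> (forall i, 0 <= b i) -> 0 <= e <= 1 ->
  \sum_(i | P i) a i `^ e * b i `^ (1 - e) <=
  (\sum_(i | P i) a i) `^ e * (\sum_(i | P i) b i) `^ (1 - e).
Proof.
move=> a0 b0 /andP[e0 e1].
set A := \sum_(i | P i) a i; set B := \sum_(i | P i) b i.
have A0 : 0 <= A by rewrite sumr_ge0.
have B0 : 0 <= B by rewrite sumr_ge0.
have [->|en0] := eqVneq e 0.
  rewrite subr0 powRr0 mul1r (powRr1 B0).
  by under eq_bigr do rewrite powRr0 mul1r (powRr1 (b0 _)).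
have [->|en1] := eqVneq e 1.
  rewrite subrr powRr0 mulr1 (powRr1 A0).
  by under eq_bigr do rewrite powRr0 mulr1 (powRr1 (a0 _)).
have en1' : 1 - e != 0 by rewrite subr_eq0 eq_sym.
have [Ale|Ap] := leP A 0.
  rewrite big1 ?mulr_ge0 ?powR_ge0// => i Pi.
  by rewrite (sum_le0_eq0 a0 Ale)// powR0// mul0r.
have [Ble|Bp] := leP B 0.
  rewrite big1 ?mulr_ge0 ?powR_ge0// => i Pi.
  by rewrite (sum_le0_eq0 b0 Ble)// powR0// mulr0.
set C := A `^ e * B `^ (1 - e).
have Cp : 0 < C by rewrite mulr_gt0// powR_gt0.
suff : \sum_(i | P i) (a i / A) `^ e * (b i / B) `^ (1 - e) <= 1.
  have -> : \sum_(i | P i) (a i / A) `^ e * (b i / B) `^ (1 - e) =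
      (\sum_(i | P i) a i `^ e * b i `^ (1 - e)) / C.
    rewrite mulr_suml; apply: eq_bigr => i _.
    rewrite !powRM ?invr_ge0 ?(ltW Ap) ?(ltW Bp)// !powRV ?(ltW Ap) ?(ltW Bp)//.
    by rewrite /C invfM mulrACA.
  by rewrite ler_pdivrMr// mul1r.
apply: (@le_trans _ _ (\sum_(i | P i) (e * (a i / A) + (1 - e) * (b i / B)))).
  apply: ler_sum => i _; apply: amgm2; rewrite ?divr_ge0//.
  by rewrite e0 e1.
rewrite big_split /= -!mulr_sumr -!mulr_suml -/A -/B !divff ?gt_eqF//; lra.
Qed.

(* With exponents [e k = 1 / p k], every point of the unit ball of [l_p] is dominated by
   [h `^ e] for some [h] of mass at most 1; since [0 `^ 0 = 1] this covers [p = oo]. *)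
Lemma holder_prod (I J : finType) (e : J -> R) (h : J -> I -> R) :
  (forall k, 0 <= e k) -> \sum_k e k <= 1 ->
  (forall k i, 0 <= h k i) -> (forall k, \sum_i h k i <= 1) -> (0 < #|I|)%N ->
  \sum_i \prod_k h k i `^ e k <= #|I|%:R `^ (1 - \sum_k e k).
Proof.
move=> e0 e1 h0 h1 I0; set n : R := #|I|%:R; set E := \sum_k e k.
have n0 : 0 < n by rewrite ltr0n.
have E1 : 0 <= 1 - E by rewrite subr_ge0.
suff : \sum_i ((\prod_k h k i `^ e k) * n^-1 `^ (1 - E)) <= 1.
  rewrite -mulr_suml powRV ?(ltW n0)//.
  by rewrite ler_pdivrMr ?powR_gt0// mul1r.
apply: (@le_trans _ _ (\sum_i (\sum_k e k * h k i + (1 - E) * n^-1))).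
  apply: ler_sum => i _.
  (* An extra index with exponent [1 - E] and constant entry [1 / n], of mass 1 over [I], completes
     the exponents to total 1. *)
  have := @amgm (option J) (None :: map Some (index_enum J))
    (fun o => if o is Some k then e k else 1 - E)
    (fun o => if o is Some k then h k i else n^-1).
  rewrite !big_cons !big_map mulrC [leRHS]addrC; apply => [[?|]//|[?|]//|].
  - by rewrite invr_ge0 ltW.
  - by rewrite subrK.
rewrite big_split /= sumr_const -[_ *+ _]mulr_natr -/n divfK ?gt_eqF//.
rewrite exchange_big /= -lerBrDr opprB addrCA subrr addr0; apply: ler_sum => k _.
by rewrite -mulr_sumr ler_piMr.
Qed.

End powers.

(** * Removing weights *)

Section duality.
Context {R : realType}.
Implicit Types (a b : R).

Definition mass1 (V : finType) (h : V -> R) := (forall v, 0 <= h v) /\ \sum_v h v <= 1.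

(** With [c = a / a0] the exponent [a0 * b] equals [1 - 1 / c], so [h ^ (a0 * b)] runs through the
    positive part of the unit ball of the dual of [l_c]. The extremal test [h = N ^ c / T] gives
    [T ^ (1 / c) <= 1]. *)
Lemma dual_sum (V : finType) (N : V -> R) a0 a b : 0 < a0 -> 0 < a -> 0 <= b ->
  a^-1 = a0^-1 - b -> (forall v, 0 <= N v) ->
  (forall h, mass1 h -> \sum_v h v `^ (a0 * b) * N v <= 1) ->
  \sum_v N v `^ (a / a0) <= 1.
Proof.
move=> a00 ap b0 ab N0 H; set T := \sum_v _.
have [T0|T0] := leP T 0; first exact: le_trans T0 ler01.
have c0 : 0 < a / a0 by rewrite divr_gt0.
have cE : a / a0 * (a0 * b) + 1 = a / a0.
  have -> : b = a0^-1 - a^-1 by rewrite ab; ring.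
  by field; rewrite !gt_eqF.
have c0b : 0 <= a / a0 * (a0 * b) by rewrite (mulr_ge0 (ltW c0))// (mulr_ge0 (ltW a00)).
have := H (fun v => N v `^ (a / a0) / T) _.
have -> : \sum_v (N v `^ (a / a0) / T) `^ (a0 * b) * N v = T `^ (a0 / a).
  under eq_bigr => v _.
    rewrite powRM ?powR_ge0 ?invr_ge0 ?(ltW T0)// powRV ?(ltW T0)// mulrAC -powRrM.
    rewrite -[X in _ * X / _]powRr1// [X in X / _]mulrC powRDp//.
    rewrite [1 + _]addrC cE.
    over.
  rewrite -mulr_suml -/T -[X in X / _](powRr1 (ltW T0)) -powRN powRDgt0//.
  congr (_ `^ _); apply/eqP; rewrite subr_eq; apply/eqP.
  have -> : b = a0^-1 - a^-1 by rewrite ab; ring.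
  by field; rewrite !gt_eqF.
have hm : mass1 (fun v => N v `^ (a / a0) / T).
  split=> [v|]; first by rewrite divr_ge0 ?powR_ge0 ?ltW.
  by rewrite -mulr_suml divff// gt_eqF.
move=> /(_ hm); apply: contraTT; rewrite -!ltNge => T1.
by rewrite powR_gt1// divr_gt0.
Qed.

Definition fsum (I U : finType) (f : I -> U) (M : I -> R) (u : U) := \sum_(i | f i == u) M i.

Lemma fsum_ge0 (I U : finType) (f : I -> U) (M : I -> R) u :
  (forall i, 0 <= M i) -> 0 <= fsum f M u.
Proof. by move=> M0; apply: sumr_ge0. Qed.

Lemma sum_fsum (I U : finType) (f : I -> U) (M : I -> R) :
  \sum_u fsum f M u = \sum_i M i.
Proof. by rewrite [RHS](partition_big f predT). Qed.

Lemma fsum_comp (I U : finType) (f : I -> U) (M : I -> R) (w : U -> R) u :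
  fsum f (fun i => w (f i) * M i) u = w u * fsum f M u.
Proof. by rewrite /fsum mulr_sumr; apply: eq_bigr => i /eqP ->. Qed.

(* The fibres of [f] and [g] play symmetric roles in the hypotheses; the weights
   [h = N `^ a] extracted on the fibres of [g] are then fed to the fibres of [f]. *)
Lemma fiber_step (I U V : finType) (f : I -> U) (g : I -> V) (M : I -> R) a0 a b :
  0 < a0 -> 0 < a <= 1 -> 0 <= b -> a^-1 = a0^-1 - b -> (forall i, 0 <= M i) ->
  (forall h, mass1 h -> \sum_u fsum f (fun i => h (g i) `^ b * M i) u `^ a0 <= 1) ->
  (forall h, mass1 h -> \sum_v fsum g (fun i => h (g i) `^ b * M i) v `^ a0 <= 1) ->
  \sum_u fsum f M u `^ a <= 1.
Proof.
move=> a00 /andP[ap a1] b0 ab M0 Hf Hg.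
set N := fsum g M.
have N0 v : 0 <= N v by exact: fsum_ge0.
have N1 : \sum_v N v `^ a <= 1.
  have -> : \sum_v N v `^ a = \sum_v (N v `^ a0) `^ (a / a0).
    by apply: eq_bigr => v _; rewrite -powRrM mulrCA divff ?gt_eqF// mulr1.
  apply: (@dual_sum V _ a0 a b) => // [v|h hm]; first exact: powR_ge0.
  apply: le_trans (Hg h hm); apply: ler_sum => v _.
  rewrite (fsum_comp g M (fun v => h v `^ b)) powRM ?powR_ge0//.
  by rewrite -powRrM [b * _]mulrC.
have hm : mass1 (fun v => N v `^ a) by split => // v; exact: powR_ge0.
have P1 := Hf _ hm; set P := fsum _ _ in P1.
pose Q := fsum f (fun i => N (g i) `^ (a - 1) * M i).
have P0 u : 0 <= P u by apply: fsum_ge0 => i; rewrite mulr_ge0 ?powR_ge0.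
have Q0 u : 0 <= Q u by apply: fsum_ge0 => i; rewrite mulr_ge0 ?powR_ge0.
have Q1 : \sum_u Q u <= 1.
  rewrite sum_fsum -(sum_fsum g) (le_trans _ N1)//; apply: ler_sum => v _.
  rewrite (fsum_comp g M (fun v => N v `^ (a - 1))) -/N.
  by rewrite mulrC mulr_powRB1.
(* The weight [th = (1 - a) / D] makes the factors [N ^ (a b)] in [P] and [N ^ (a - 1)] in [Q]
   cancel. [D] vanishes only if [a = 1], and then [Q] is already the unweighted fibre sum. *)
set D := 1 - a + a * b.
have D0 : 0 <= D by rewrite addr_ge0 ?subr_ge0// mulr_ge0// ltW.
have aa0 : a = a0 * (1 + a * b).
  have -> : b = a0^-1 - a^-1 by rewrite ab; ring.
  by field; rewrite !gt_eqF.
have [D00|Dn0] := eqVneq D 0.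
  have a1E : a = 1.
    move: D00 => /eqP; rewrite paddr_eq0 ?subr_ge0// ?mulr_ge0 ?(ltW ap)//.
    by case/andP; rewrite subr_eq0 => /eqP.
  apply: le_trans Q1; apply: ler_sum => u _.
  rewrite /Q a1E subrr powRr1 ?fsum_ge0//.
  by apply: ler_sum => i _; rewrite powRr0 mul1r.
pose th := (1 - a) / D.
have th01 : 0 <= th <= 1.
  rewrite divr_ge0 ?subr_ge0//= ler_pdivrMr ?lt_def ?Dn0// mul1r.
  by rewrite lerDl mulr_ge0// ltW.
have Y u : fsum f M u <= P u `^ th * Q u `^ (1 - th).
  apply: le_trans (holder _ _ _ th01) => [|i|i]; last 2 first.
    by rewrite mulr_ge0 ?powR_ge0.
    by rewrite mulr_ge0 ?powR_ge0.
  apply: ler_sum => i _.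
  have [->|Mn0] := eqVneq (M i) 0; first by rewrite mulr_ge0 ?powR_ge0.
  have Mp : 0 < M i by rewrite lt_def Mn0 M0.
  have Np : 0 < N (g i).
    by apply: (lt_le_trans Mp); rewrite /N /fsum (bigD1 i)//= lerDl sumr_ge0.
  rewrite !powRM ?powR_ge0// mulrACA -!powRrM powRDgt0//.
  have -> : a * (b * th) + (a - 1) * (1 - th) = 0 by rewrite /th /D; field.
  by rewrite powRr0 mul1r powRDgt0// addrC subrK powRr1.
pose e := th * a / a0.
have aa : a / a0 = 1 + a * b by rewrite {1}aa0 mulrAC divff ?mul1r// gt_eqF.
have e01 : 0 <= e <= 1.
  have /andP[t0 t1] := th01.
  have -> : e = th * (1 + a * b) by rewrite /e -mulrA aa.
  have ab0 : 0 <= a * b by rewrite mulr_ge0// ltW.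
  apply/andP; split; first by apply: mulr_ge0 => //; lra.
  rewrite /th mulrAC ler_pdivrMr ?lt_def ?Dn0// mul1r /D.
  have : 0 <= a * a * b by rewrite mulr_ge0// mulr_ge0// ltW.
  nra.
have eE : (1 - th) * a = 1 - e by rewrite /e -mulrA aa /th /D; field.
have eE' : th * a = a0 * e by rewrite [RHS]mulrC /e divfK// gt_eqF.
clearbody e th P Q.
apply: (@le_trans _ _ (\sum_u (e * P u `^ a0 + (1 - e) * Q u))).
  apply: ler_sum => u _; apply: le_trans (ler_powR2 _ (Y u) (ltW ap)) _.
    exact: fsum_ge0.
  rewrite powRM ?powR_ge0// -!powRrM eE eE' powRrM.
  by apply: amgm2 => //; exact: powR_ge0.
rewrite big_split /= -!mulr_sumr.
by case/andP: e01 => e0 e1; nra.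
Qed.

Lemma sum_powR_ge1 (I : finType) (P : pred I) (M : I -> R) a : 1 <= a ->
  (forall i, 0 <= M i) -> \sum_(i | P i) M i `^ a <= (\sum_(i | P i) M i) `^ a.
Proof.
move=> a1 M0; have a0 : 0 < a by exact: lt_le_trans a1.
rewrite -[leRHS]mulr_powRB1 ?sumr_ge0// mulr_suml; apply: ler_sum => i Pi.
rewrite -mulr_powRB1// ler_wpM2l// ler_powR2 ?subr_ge0//.
by rewrite (bigD1 i)//= lerDl sumr_ge0.
Qed.

Section chain.
Variables (I V J : finType) (pr : J -> I -> V).

(* For [a <= 1] the sum over the fibres of any single coordinate is outermost; past the
   threshold [a = 1] only the unmixed sum survives. *)
Definition fiber_le1 a (M : I -> R) : Prop :=
  if a <= 1 then forall k, \sum_v fsum (pr k) M v `^ a <= 1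
  else \sum_i M i `^ a <= 1.

(** Three regimes. For [a <= 1] this is [fiber_step]. For [a0 > 1] duality applies to the fibre
    masses of [M ^ a0], because [l_(a / a0)] norms are below [l_1] norms on each fibre. When 1 lies
    between, the fibres of [pr j] are first collapsed to their masses, which for [a > 1] only
    increases the sum. *)
Lemma fiber_le1_step j (M : I -> R) a0 a b : 0 < a0 -> 0 < a -> 0 <= b ->
  a^-1 = a0^-1 - b -> (forall i, 0 <= M i) ->
  (forall h, mass1 h -> fiber_le1 a0 (fun i => h (pr j i) `^ b * M i)) ->
  fiber_le1 a M.
Proof.
move=> a00 ap b0 ab M0 H; rewrite /fiber_le1.
have a0a : a0 <= a by rewrite -lef_pV2 ?posrE// ab gerBl.
have [a1|a1] := leP a 1.
  have a01 : a0 <= 1 by exact: le_trans a1.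
  move=> k; apply: (fiber_step (g := pr j) a00 _ b0 ab M0); first by rewrite ap.
  - by move=> h /H; rewrite /fiber_le1 a01; apply.
  - by move=> h /H; rewrite /fiber_le1 a01; apply.
have c1 : 1 <= a / a0 by rewrite ler_pdivlMr// mul1r.
have [a01|a01] := leP a0 1; last first.
  have -> : \sum_i M i `^ a = \sum_i (M i `^ a0) `^ (a / a0).
    by apply: eq_bigr => i _; rewrite -powRrM mulrCA divff ?gt_eqF// mulr1.
  pose N := fsum (pr j) (fun i => M i `^ a0).
  apply: (@le_trans _ _ (\sum_v N v `^ (a / a0))).
    rewrite (partition_big (pr j) predT)//=; apply: ler_sum => v _.
    by apply: sum_powR_ge1 => // i; exact: powR_ge0.
  apply: (@dual_sum V N a0 a b) => // [v|h hm].
    by apply: fsum_ge0 => i; exact: powR_ge0.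
  have := H h hm; rewrite /fiber_le1 leNgt a01 /=; apply: le_trans.
  rewrite (partition_big (pr j) predT)//=; apply: ler_sum => v _.
  rewrite /N /fsum mulr_sumr; apply: ler_sum => i /eqP <-.
  by rewrite powRM ?powR_ge0// -powRrM mulrC [b * _]mulrC mulrC.
pose N := fsum (pr j) M.
apply: (@le_trans _ _ (\sum_v N v `^ a)).
  rewrite (partition_big (pr j) predT)//=; apply: ler_sum => v _.
  by apply: sum_powR_ge1 => //; exact: ltW.
have N0 v : 0 <= N v by exact: fsum_ge0.
have -> : \sum_v N v `^ a = \sum_v (N v `^ a0) `^ (a / a0).
  by apply: eq_bigr => v _; rewrite -powRrM mulrCA divff ?gt_eqF// mulr1.
apply: (@dual_sum V _ a0 a b) => // [v|h hm]; first exact: powR_ge0.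
have := H h hm; rewrite /fiber_le1 a01 => /(_ j); apply: le_trans.
apply: ler_sum => v _; rewrite (fsum_comp (pr j) M (fun v => h v `^ b)).
by rewrite powRM ?powR_ge0// -powRrM [b * _]mulrC.
Qed.

(** One quantifier per variable: the last variable of the list loses its weight first, while the
    weights of the earlier ones stay fixed. *)
Fixpoint weighted (b : J -> R) (l : seq J) a (M : I -> R) : Prop :=
  if l is j :: l' then
    forall h, mass1 h -> weighted b l' a (fun i => h (pr j i) `^ b j * M i)
  else fiber_le1 a M.

Lemma weighted_fiber_le1 (b : J -> R) l (M : I -> R) a0 a : 0 < a0 -> 0 < a ->
  (forall j, 0 <= b j) -> a^-1 = a0^-1 - \sum_(j <- l) b j -> (forall i, 0 <= M i) ->
  weighted b l a0 M -> fiber_le1 a M.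
Proof.
move=> a00 + b0; elim: l M a => [|j l IH] M a ap.
  by rewrite big_nil subr0 => /invr_inj ->.
rewrite big_cons => ab M0 /= H; pose a1 := (a^-1 + b j)^-1.
have a1p : 0 < a1 by rewrite invr_gt0 ltr_wpDr// invr_gt0.
apply: (@fiber_le1_step j M a1 a (b j)) => //; first by rewrite /a1 invrK addrK.
move=> h hm; apply: IH (H h hm) => //.
  by rewrite /a1 invrK ab; ring.
by move=> i; rewrite mulr_ge0 ?powR_ge0.
Qed.

Lemma weighted_of_family (b : J -> R) l (M : I -> R) a : uniq l -> V ->
  (forall h, (forall k, mass1 (h k)) ->
     fiber_le1 a (fun i => (\prod_(k <- l) h k (pr k i) `^ b k) * M i)) ->
  weighted b l a M.
Proof.
move=> + v0; elim: l M => [|j l IH] M /=.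
  (* The empty product does not see the family; point masses at [v0] merely provide one. *)
  move=> _ /(_ (fun _ v => (v == v0)%:R)).
  have -> : (fun i => (\prod_(k <- [::]) ((pr k i == v0)%:R : R) `^ b k) * M i) = M.
    by apply/funext => i; rewrite big_nil mul1r.
  apply=> _; split=> [v|]; first by case: eqP.
  by rewrite (bigD1 v0)//= eqxx big1 ?addr0// => v /negbTE ->.
move=> /andP[jl ul] H h hm; apply: IH => // h' hm'.
have := H (fun k => if k == j then h else h' k).
set X := fun _ => _ ; set Y := fun _ => _.
have -> : X = Y; last by apply=> k; case: ifP.
apply/funext => i; rewrite /X /Y big_cons eqxx mulrCA mulrA; congr (_ * _ * _).
rewrite [LHS]big_seq [RHS]big_seq; apply: eq_bigr => k kl.
by case: eqP kl jl => // -> ->.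
Qed.

End chain.

End duality.

(** * Rademacher chaos *)

Section finite_functions.
Variables (U : finType).

Definition fcons n (u : U) (g : {ffun 'I_n -> U}) : {ffun 'I_n.+1 -> U} :=
  [ffun i => oapp g u (unlift ord0 i)].

Lemma fcons0 n u (g : {ffun 'I_n -> U}) : fcons u g ord0 = u.
Proof. by rewrite ffunE unlift_none. Qed.

Lemma fconsS n u (g : {ffun 'I_n -> U}) i : fcons u g (lift ord0 i) = g i.
Proof. by rewrite ffunE liftK. Qed.

Lemma sum_ffun_ordS (V : nmodType) n (F : {ffun 'I_n.+1 -> U} -> V) :
  \sum_f F f = \sum_u \sum_g F (fcons u g).
Proof.
rewrite pair_big /= (reindex (fun p : U * {ffun 'I_n -> U} => fcons p.1 p.2))//=.
exists (fun f : {ffun 'I_n.+1 -> U} => (f ord0, [ffun i => f (lift ord0 i)])).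
- move=> [u g] _ /=; rewrite fcons0; congr (_, _).
  by apply/ffunP => i; rewrite ffunE fconsS.
- move=> f _ /=; apply/ffunP => i; rewrite ffunE.
  by case: unliftP => [j ->|->] //=; rewrite ffunE.
Qed.

Lemma sum_ffun_ord0 (V : nmodType) (F : {ffun 'I_0 -> U} -> V) f : \sum_g F g = F f.
Proof. by rewrite (big_pred1 f)// => g; apply/esym/eqP/ffunP => -[]. Qed.

End finite_functions.

Section khintchine.
Context {R : realType}.

Lemma cauchy_schwarz (T : finType) (x y : T -> R) :
  (\sum_t x t * y t) ^+ 2 <= (\sum_t x t ^+ 2) * (\sum_t y t ^+ 2).
Proof.
have : 0 <= \sum_i \sum_j (x i * y j - x j * y i) ^+ 2.
  by apply: sumr_ge0 => i _; apply: sumr_ge0 => j _; exact: sqr_ge0.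
have -> : \sum_i \sum_j (x i * y j - x j * y i) ^+ 2 =
    ((\sum_t x t ^+ 2) * (\sum_t y t ^+ 2) - (\sum_t x t * y t) ^+ 2) *+ 2.
  transitivity (\sum_i \sum_j (x i ^+ 2 * y j ^+ 2 + y i ^+ 2 * x j ^+ 2
      - ((x i * y i) * (x j * y j)) *+ 2)).
    by apply: eq_bigr => i _; apply: eq_bigr => j _; ring.
  under eq_bigr do rewrite !big_split /= sumrN sumrMnl -!mulr_sumr.
  rewrite !big_split /= sumrN sumrMnl -!mulr_suml; ring.
by rewrite pmulrn_lge0// subr_ge0.
Qed.

Definition rsign (b : bool) : R := if b then 1 else -1.

Lemma rsign_sqr b : rsign b ^+ 2 = 1.
Proof. by case: b; rewrite /rsign ?sqrrN expr1n. Qed.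

Lemma normr_rsign b : `|rsign b| = 1.
Proof. by case: b; rewrite /rsign ?normrN normr1. Qed.

(** The squared Euclidean norm of a Rademacher sum with coefficients in [R ^ T]. Vector coefficients
    are what the induction on the order of the chaos needs. *)
Definition sgsum n (T : finType) (a : 'I_n -> T -> R) (d : {ffun 'I_n -> bool}) : R :=
  \sum_t (\sum_i rsign (d i) * a i t) ^+ 2.

Lemma sgsum_ge0 n (T : finType) (a : 'I_n -> T -> R) d : 0 <= sgsum a d.
Proof. by apply: sumr_ge0 => t _; exact: sqr_ge0. Qed.

Lemma sgsumS n (T : finType) (a : 'I_n.+1 -> T -> R) b (d : {ffun 'I_n -> bool}) :
  let a' (i : 'I_n) := a (lift ord0 i) in
  sgsum a (fcons b d) = sgsum a' d + \sum_t a ord0 t ^+ 2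
    + 2 * rsign b * \sum_t a ord0 t * (\sum_i rsign (d i) * a' i t).
Proof.
rewrite /sgsum /=.
transitivity (\sum_t ((\sum_i rsign (d i) * a (lift ord0 i) t) ^+ 2 + a ord0 t ^+ 2 +
    2 * rsign b * (a ord0 t * \sum_i rsign (d i) * a (lift ord0 i) t))).
  apply: eq_bigr => t _; rewrite big_ord_recl fcons0.
  under eq_bigr do rewrite fconsS.
  rewrite sqrrD exprMn rsign_sqr mul1r; ring.
by rewrite !big_split /= -mulr_sumr.
Qed.

Lemma sgsum_cross n (T : finType) (a : 'I_n.+1 -> T -> R) (d : {ffun 'I_n -> bool}) :
  let a' (i : 'I_n) := a (lift ord0 i) in
  (\sum_t a ord0 t * (\sum_i rsign (d i) * a' i t)) ^+ 2 <=
  (\sum_t a ord0 t ^+ 2) * sgsum a' d.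
Proof. exact: cauchy_schwarz. Qed.

Lemma sgsum_moment1 n (T : finType) (a : 'I_n -> T -> R) :
  \sum_d sgsum a d = 2 ^+ n * \sum_i \sum_t a i t ^+ 2.
Proof.
elim: n a => [|n IH] a.
  rewrite (sum_ffun_ord0 _ [ffun _ => true]) big_ord0 mulr0 /sgsum big1// => t _.
  by rewrite big_ord0 expr0n.
rewrite sum_ffun_ordS big_bool -big_split /= [in RHS]big_ord_recl.
under eq_bigr do rewrite !sgsumS /=.
under eq_bigr => d _.
  rewrite (_ : _ + _ = 2 * (sgsum (fun i : 'I_n => a (lift ord0 i)) d + \sum_t a ord0 t ^+ 2)); last first.
    by rewrite /rsign; ring.
  over.
rewrite -mulr_sumr big_split /= IH sumr_const card_ffun card_bool card_ord.
rewrite -[_ *+ (2 ^ n)%N]mulr_natl natrX exprS; ring.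
Qed.

Lemma sgsum_moment2 n (T : finType) (a : 'I_n -> T -> R) :
  \sum_d sgsum a d ^+ 2 <= 3 * 2 ^+ n * (\sum_i \sum_t a i t ^+ 2) ^+ 2.
Proof.
elim: n a => [|n IH] a.
  rewrite (sum_ffun_ord0 _ [ffun _ => true]) big_ord0 expr0n mulr0 /sgsum big1 ?expr0n//.
  by move=> t _; rewrite big_ord0 expr0n.
rewrite sum_ffun_ordS big_bool -big_split /= [in leRHS]big_ord_recl.
set a' := fun i : 'I_n => a (lift ord0 i); set A := \sum_t a ord0 t ^+ 2.
have A0 : 0 <= A by apply: sumr_ge0 => t _; exact: sqr_ge0.
set S := \sum_i \sum_t a' i t ^+ 2.
have S0 : 0 <= S by apply: sumr_ge0 => i _; apply: sumr_ge0 => t _; exact: sqr_ge0.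
(* With [Y = sgsum a' d] and cross term [C], the two values of the first sign contribute
   [2 (Y + A) ^ 2 + 8 C ^ 2], and [C ^ 2 <= A Y] by Cauchy-Schwarz. *)
apply: (@le_trans _ _ (\sum_d (2 * sgsum a' d ^+ 2 + 12 * A * sgsum a' d + 2 * A ^+ 2))).
  apply: ler_sum => d _; rewrite !sgsumS /= -/A -/a'.
  have := sgsum_cross a d; rewrite /= -/a' -/A.
  set C := \sum_t _; set Y := sgsum a' d; rewrite /rsign => h.
  nra.
rewrite !big_split /= -!mulr_sumr sgsum_moment1 sumr_const card_ffun card_bool card_ord.
have := IH a'; rewrite -/S.
set W := \sum_d _; set N : R := 2 ^+ n.
have N0 : 0 <= N by rewrite exprn_ge0.
rewrite -[_ *+ (2 ^ n)%N]mulr_natl natrX -/N (exprS 2 n) -/N => h.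
have -> : 3 * (2 * N) * (A + S) ^+ 2 = 2 * (3 * N * S ^+ 2) + 12 * A * (N * S) + 6 * N * A ^+ 2 by ring.
rewrite [A * (N * A)]mulrCA -expr2.
have : 0 <= N * A ^+ 2 by rewrite mulr_ge0// sqr_ge0.
lra.
Qed.

(** A minorant of the square root, touching it at [z = 4], that only involves the moments at hand:
    for [z] of mean 1 and second moment at most 3 it averages to at least [3 / 4 - 3 / 16 = 9 / 16],
    the constant of [khintchine]. *)
Lemma sqrt_ge (z : R) : 0 <= z -> 3 / 4 * z - z ^+ 2 / 16 <= Num.sqrt z.
Proof.
move=> z0; rewrite -[in leLHS](sqr_sqrtr z0); set x := Num.sqrt z.
have x0 : 0 <= x by exact: sqrtr_ge0.
have : 0 <= x * ((x - 2) ^+ 2 * (x + 4)).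
  by rewrite mulr_ge0// mulr_ge0 ?sqr_ge0// addr_ge0.
by rewrite -exprM; nra.
Qed.

Lemma khintchine n (T : finType) (a : 'I_n -> T -> R) :
  9 / 16 * 2 ^+ n * Num.sqrt (\sum_t \sum_i a i t ^+ 2) <= \sum_d Num.sqrt (sgsum a d).
Proof.
rewrite exchange_big /=; set S := \sum_i _.
have S0 : 0 <= S by apply: sumr_ge0 => i _; apply: sumr_ge0 => t _; exact: sqr_ge0.
have [->|Sn0] := eqVneq S 0.
  by rewrite sqrtr0 mulr0 sumr_ge0// => d _; exact: sqrtr_ge0.
have Sp : 0 < S by rewrite lt_def Sn0.
apply: (@le_trans _ _ (\sum_d (Num.sqrt S *
    (3 / 4 / S * sgsum a d - (16 * S ^+ 2)^-1 * sgsum a d ^+ 2)))); last first.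
  apply: ler_sum => d _.
  have {3}-> : sgsum a d = S * (sgsum a d / S) by rewrite mulrC divfK.
  rewrite [leRHS]sqrtrM// ler_wpM2l ?sqrtr_ge0//.
  apply: le_trans (sqrt_ge _); last by rewrite divr_ge0// sgsum_ge0.
  by rewrite le_eqVlt; apply/orP; left; apply/eqP; field.
rewrite -mulr_sumr [leRHS]mulrC [leLHS]mulrC [leLHS]mulrC ler_wpM2r ?sqrtr_ge0//.
rewrite big_split /= sumrN -!mulr_sumr sgsum_moment1 -/S.
have := sgsum_moment2 a; rewrite -/S; set N : R := 2 ^+ n; set W := \sum_d _ => h.
have -> : 3 / 4 / S * (N * S) = 3 / 4 * N by field.
have : (16 * S ^+ 2)^-1 * W <= 3 / 16 * N.
  rewrite mulrC ler_pdivrMr ?mulr_gt0 ?exprn_gt0//.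
  by apply: le_trans h _; rewrite le_eqVlt; apply/orP; left; apply/eqP; field.
lra.
Qed.

Definition chaos_sign m n (d : {ffun 'I_m -> {ffun 'I_n -> bool}}) (i : {ffun 'I_m -> 'I_n}) : R :=
  \prod_k rsign (d k (i k)).

Lemma chaos_signS m n d0 (d : {ffun 'I_m -> {ffun 'I_n -> bool}}) v i :
  chaos_sign (fcons d0 d) (fcons v i) = rsign (d0 v) * chaos_sign d i.
Proof.
rewrite /chaos_sign big_ord_recl !fcons0; congr (_ * _).
by apply: eq_bigr => k _; rewrite !fconsS.
Qed.

(* Conditioning on all but one family of signs reduces to [khintchine] with values in a
   larger Euclidean space. *)
Lemma khintchine_chaos m n (T : finType) (a : {ffun 'I_m -> 'I_n} -> T -> R) :
  (9 / 16 * 2 ^+ n) ^+ m * Num.sqrt (\sum_t \sum_i a i t ^+ 2) <=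
  \sum_(d : {ffun 'I_m -> {ffun 'I_n -> bool}})
     Num.sqrt (\sum_t (\sum_i chaos_sign d i * a i t) ^+ 2).
Proof.
elim: m T a => [|m IH] T a.
  have d : {ffun 'I_0 -> {ffun 'I_n -> bool}} by exact: [ffun _ => [ffun _ => true]].
  have i : {ffun 'I_0 -> 'I_n} by apply: finfun => -[].
  rewrite (sum_ffun_ord0 _ d) expr0 mul1r.
  under [X in _ <= Num.sqrt X]eq_bigr do rewrite (sum_ffun_ord0 _ i) /chaos_sign big_ord0 mul1r.
  by rewrite (eq_bigr (fun t => a i t ^+ 2)) => // t _; rewrite (sum_ffun_ord0 _ i).
rewrite sum_ffun_ordS [leRHS]exchange_big /=.
pose a' (i : {ffun 'I_m -> 'I_n}) (p : 'I_n * T) := a (fcons p.1 i) p.2.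
pose B (d : {ffun 'I_m -> {ffun 'I_n -> bool}}) v t := \sum_i chaos_sign d i * a' i (v, t).
apply: (@le_trans _ _ (\sum_d 9 / 16 * 2 ^+ n * Num.sqrt (\sum_t \sum_v B d v t ^+ 2))).
  have c0 : 0 <= 9 / 16 * 2 ^+ n :> R by rewrite mulr_ge0 ?exprn_ge0// divr_ge0.
  rewrite -mulr_sumr exprS -mulrA ler_wpM2l//.
  have pairE (F : 'I_n * T -> R) : \sum_p F p = \sum_t \sum_v F (v, t).
    rewrite exchange_big (pair_big predT predT (fun v t => F (v, t))) /=.
    by apply: eq_bigr => -[].
  have := IH _ a'; rewrite pairE.
  rewrite (eq_bigr (fun t => \sum_i a i t ^+ 2)); last first.
    by move=> t _; rewrite sum_ffun_ordS.
  by move/le_trans; apply; apply: ler_sum => d _; rewrite pairE.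
apply: ler_sum => d _; apply: le_trans (khintchine _) _; apply: ler_sum => d0 _.
rewrite le_eqVlt; apply/orP; left; apply/eqP; congr Num.sqrt.
apply: eq_bigr => t _; rewrite sum_ffun_ordS; congr (_ ^+ 2).
apply: eq_bigr => v _; rewrite mulr_sumr; apply: eq_bigr => i _.
by rewrite chaos_signS mulrA.
Qed.

End khintchine.

(** * Norms of the values *)

Section mixed.
Context {R : realType}.

(** Minkowski's inequality between [l_1] and [l_g], normalised. The weights [B j ^ (g - 1)] bring
    the total mass of [Q] below 1, and Hoelder with exponents [g] and [1 - g] removes them again
    inside each row. *)
Lemma minkowski_sum (I V : finType) (M : I -> V -> R) (g : R) : 0 < g <= 1 ->
  (forall i j, 0 <= M i j) ->
  \sum_j (\sum_i M i j) `^ g <= 1 -> \sum_i (\sum_j M i j `^ g) `^ g^-1 <= 1.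
Proof.
move=> /andP[g0 g1] M0; set B := fun j => \sum_i M i j => B1.
have B0 j : 0 <= B j by exact: sumr_ge0.
pose Q i j := B j `^ (g - 1) * M i j.
have Q0 i j : 0 <= Q i j by rewrite mulr_ge0 ?powR_ge0.
have Qle : \sum_i \sum_j Q i j <= 1.
  rewrite exchange_big /= (le_trans _ B1)//; apply: ler_sum => j _.
  by rewrite -mulr_sumr -/(B j) mulrC mulr_powRB1.
apply: le_trans Qle; apply: ler_sum => i _.
suff Hi : \sum_j M i j `^ g <= (\sum_j Q i j) `^ g.
  rewrite -[leRHS]powRr1 ?sumr_ge0// -(divff (lt0r_neq0 g0)) powRrM.
  by rewrite ler_powR2 ?invr_ge0 ?(ltW g0)// sumr_ge0// => j _; exact: powR_ge0.
have g01 : 0 <= g <= 1 by rewrite (ltW g0).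
apply: (@le_trans _ _ (\sum_j Q i j `^ g * (B j `^ g) `^ (1 - g))).
  apply: ler_sum => j _.
  have [->|Mn0] := eqVneq (M i j) 0.
    by rewrite powR0 ?gt_eqF// mulr_ge0// powR_ge0.
  have Bp : 0 < B j.
    apply: (@lt_le_trans _ _ (M i j)); first by rewrite lt_def Mn0 M0.
    by rewrite /B (bigD1 i)//= lerDl sumr_ge0.
  rewrite /Q powRM ?powR_ge0// mulrAC -!powRrM powRDgt0//.
  by rewrite (_ : _ + _ = 0) ?powRr0 ?mul1r//; ring.
apply: le_trans (holder _ _ _ g01) _ => [|j|]; [by []|exact: powR_ge0|].
rewrite -[leRHS]mulr1 ler_wpM2l ?powR_ge0// powR_le1 ?subr_ge0//.
by rewrite B1 sumr_ge0// => j _; exact: powR_ge0.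
Qed.

(** Squared norms are used because the fibre masses are sums of squares; the right-hand side is then
    a product that Hoelder can sum over a fibre. *)
Lemma lyapunov (V : finType) (x : V -> R) (s q th : R) : 0 < s -> 0 < q ->
  0 <= th <= 1 -> q^-1 = (1 - th) / s + th / 2 -> (forall j, 0 <= x j) ->
  (\sum_j x j `^ q) `^ (2 / q) <=
  ((\sum_j x j `^ s) `^ (2 / s)) `^ (1 - th) * (\sum_j x j `^ 2) `^ th.
Proof.
move=> s0 q0 /andP[t0 t1] qE x0.
pose e := q * (1 - th) / s.
have eE : 1 - e = q * th / 2.
  have : q * q^-1 = 1 by rewrite divff ?gt_eqF.
  by rewrite {1}qE /e => qq; lra.
have e0 : 0 <= e by rewrite divr_ge0 ?(ltW s0)// mulr_ge0 ?subr_ge0// ltW.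
have e1 : e <= 1 by rewrite -subr_ge0 eE divr_ge0// mulr_ge0// ltW.
have H : \sum_j x j `^ q <= (\sum_j x j `^ s) `^ e * (\sum_j x j `^ 2) `^ (1 - e).
  have e01 : 0 <= e <= 1 by rewrite e0.
  apply: le_trans (holder _ (fun j => powR_ge0 _ _) (fun j => powR_ge0 _ _) e01).
  apply: ler_sum => j _; have [->|xn0] := eqVneq (x j) 0.
    by rewrite powR0 ?gt_eqF// mulr_ge0 ?powR_ge0.
  rewrite -!powRrM powRDgt0; last by rewrite lt_def xn0 x0.
  rewrite eE /e (_ : _ + _ = q)//.
  by field; rewrite gt_eqF.
have S0 a : 0 <= \sum_j x j `^ a by apply: sumr_ge0 => j _; exact: powR_ge0.
move: H (S0 q); set X := \sum_j x j `^ s; set Y := \sum_j x j `^ 2.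
move: (\sum_j _) => Z; clearbody X Y => H Z0.
apply: le_trans (ler_powR2 Z0 H _) _ => //; first by rewrite divr_ge0// ltW.
rewrite powRM ?powR_ge0// -!powRrM eE.
by rewrite le_eqVlt; apply/orP; left; apply/eqP; congr (_ `^ _ * _ `^ _);
  rewrite /e; field; rewrite !gt_eqF.
Qed.

Section output.
Variables (I V J : finType) (pr : J -> I -> V).

Definition pr_out (k : option J) (p : I * V) : V :=
  if k is Some j then pr j p.1 else p.2.

Lemma fsum_pr_out (M : I -> V -> R) k v :
  fsum (pr_out (Some k)) (fun p => M p.1 p.2) v = fsum (pr k) (fun i => \sum_j M i j) v.
Proof.
rewrite /fsum (eq_bigl (fun p : I * V => (pr k p.1 == v) && true)); last first.
  by move=> p; rewrite andbT.
by rewrite -(pair_big (fun i => pr k i == v) predT M).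
Qed.

Lemma fsum_pr_outN (M : I -> V -> R) v :
  fsum (pr_out None) (fun p => M p.1 p.2) v = \sum_i M i v.
Proof.
rewrite /fsum (eq_bigl (fun p : I * V => true && (p.2 == v))); last by [].
rewrite -(pair_big predT (fun j => j == v) M) /=.
by apply: eq_bigr => i _; rewrite big_pred1_eq.
Qed.

(* Interpolation between [q = s], which is Minkowski's inequality, and [q = 2]. *)
Lemma fiber_le1_qnorm (A : I -> V -> R) (s q l : R) : 1 <= s -> s <= q -> q <= 2 ->
  (forall i j, 0 <= A i j) -> 0 < l -> l^-1 = 2^-1 + s^-1 - q^-1 ->
  fiber_le1 pr_out (s / 2) (fun p => A p.1 p.2 `^ 2) ->
  fiber_le1 pr (l / 2) (fun i => ((\sum_j A i j `^ q) `^ q^-1) `^ 2).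
Proof.
move=> s1 sq q2 A0 l0 lE.
have s0 : 0 < s by exact: lt_le_trans s1.
have q0 : 0 < q by exact: lt_le_trans sq.
have s2 : s <= 2 by exact: le_trans q2.
have g01 : 0 < s / 2 <= 1 by rewrite divr_gt0//= ler_pdivrMr// mul1r.
have l2 : l / 2 <= 1.
  rewrite ler_pdivrMr// mul1r -lef_pV2 ?posrE// lE.
  by rewrite lerBrDr lerD2l lef_pV2 ?posrE.
have /andP[g0 g1] := g01.
rewrite /fiber_le1 g1 => H.
rewrite l2 => k.
pose Us i := (\sum_j A i j `^ s) `^ (2 / s).
pose Vs i := \sum_j A i j `^ 2.
have Us0 i : 0 <= Us i by exact: powR_ge0.
have Vs0 i : 0 <= Vs i by apply: sumr_ge0 => j _; exact: powR_ge0.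
have HU : \sum_i Us i <= 1.
  rewrite (eq_bigr (fun i => (\sum_j (A i j `^ 2) `^ (s / 2)) `^ (s / 2)^-1)); last first.
    move=> i _; rewrite /Us invf_div; congr (_ `^ _); apply: eq_bigr => j _.
    by rewrite -powRrM; congr (_ `^ _); field.
  apply: minkowski_sum => // [i j|]; first exact: powR_ge0.
  apply: le_trans (H None); apply: ler_sum => v _.
  by rewrite (fsum_pr_outN (fun i j => A i j `^ 2)).
have HV : \sum_v fsum (pr k) Vs v `^ (s / 2) <= 1.
  apply: le_trans (H (Some k)); apply: ler_sum => v _.
  by rewrite (fsum_pr_out (fun i j => A i j `^ 2)).
(* The interpolation parameter. For [s = 2] the quotient is [0 / 0 = 0], which is correct since
   [q = 2] as well. *)
pose th := (s^-1 - q^-1) / (s^-1 - 2^-1).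
have s2V : 0 <= s^-1 - 2^-1 by rewrite subr_ge0 lef_pV2 ?posrE.
have th01 : 0 <= th <= 1.
  rewrite divr_ge0 ?subr_ge0 ?lef_pV2 ?posrE//=.
  have [e0|en0] := eqVneq (s^-1 - 2^-1) 0; first by rewrite /th e0 invr0 mulr0 ler01.
  by rewrite ler_pdivrMr ?lt_def ?en0// mul1r lerD2l lerN2 lef_pV2 ?posrE.
have qE : q^-1 = (1 - th) / s + th / 2.
  have [e0|en0] := eqVneq (s^-1 - 2^-1) 0; last first.
    have : th * (s^-1 - 2^-1) = s^-1 - q^-1 by rewrite divfK.
    lra.
  rewrite /th e0 invr0 mulr0; have sE : s^-1 = 2^-1 by lra.
  have : q^-1 <= s^-1 by rewrite lef_pV2 ?posrE.
  have : 2^-1 <= q^-1 by rewrite lef_pV2 ?posrE.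
  lra.
have [t0 t1] := andP th01.
have eE : (1 - th) * (l / 2) + th * l / s = 1.
  have : l * l^-1 = 1 by rewrite divff ?gt_eqF.
  rewrite lE; have -> : 2^-1 + s^-1 - q^-1 = (1 - th) / 2 + th / s by rewrite qE; ring.
  by move=> {3}<-; ring.
clearbody th.
pose M i := ((\sum_j A i j `^ q) `^ q^-1) `^ 2.
change (\sum_v fsum (pr k) M v `^ (l / 2) <= 1).
have M0 i : 0 <= M i by exact: powR_ge0.
have HM v : fsum (pr k) M v <= fsum (pr k) Us v `^ (1 - th) * fsum (pr k) Vs v `^ th.
  have t01' : 0 <= 1 - th <= 1 by rewrite subr_ge0 t1 gerBl t0.
  have := holder (fun i => pr k i == v) Us0 Vs0 t01'.
  rewrite subKr; apply: le_trans.
  apply: ler_sum => i _.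
  have -> : M i = (\sum_j A i j `^ q) `^ (2 / q) by rewrite /M -powRrM mulrC.
  exact: lyapunov.
pose U := fsum (pr k) Us; pose W := fsum (pr k) Vs.
have U0 v : 0 <= U v by exact: fsum_ge0.
have W0 v : 0 <= W v by exact: fsum_ge0.
(* Raising [U ^ (1 - th) * W ^ th] to the power [l / 2] gives [U ^ e * (W ^ (s / 2)) ^ (1 - e)]; the
   formula for [1 / l] is exactly what makes these exponents complementary. *)
pose e := (1 - th) * (l / 2).
have e0 : 0 <= e by rewrite mulr_ge0 ?subr_ge0// divr_ge0// ltW.
have e1 : 1 - e = th * l / s by rewrite -{1}eE /e; ring.
have e1' : e <= 1.
  by rewrite -subr_ge0 e1 divr_ge0 ?(ltW s0)// mulr_ge0// ltW.
apply: (@le_trans _ _ (\sum_v (e * U v + (1 - e) * W v `^ (s / 2)))).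
  apply: ler_sum => v _; apply: le_trans (ler_powR2 _ (HM v) _) _.
  - exact: fsum_ge0.
  - by rewrite divr_ge0// ltW.
  rewrite -/(U v) -/(W v) powRM ?powR_ge0//.
  rewrite -(powRrM (U v)) -(powRrM (W v)).
  have -> : th * (l / 2) = s / 2 * (1 - e) by rewrite e1; field; rewrite gt_eqF.
  rewrite (powRrM (W v)); apply: amgm2 => //; first exact: powR_ge0.
  by rewrite e0.
rewrite big_split /= -!mulr_sumr sum_fsum.
have := HV; rewrite -/W => HV'; nra.
Qed.

(** Past [s = 2] the hypothesis is already the unmixed sum of [A ^ s], and at exponent 1 the fibre
    sums add up to that same total. *)
Lemma fiber_le1_snorm (A : I -> V -> R) (s : R) : 2 < s -> (forall i j, 0 <= A i j) ->
  fiber_le1 pr_out (s / 2) (fun p => A p.1 p.2 `^ 2) ->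
  fiber_le1 pr 1 (fun i => ((\sum_j A i j `^ s) `^ s^-1) `^ s).
Proof.
move=> s2 A0; rewrite /fiber_le1 lexx leNgt.
have -> : 1 < s / 2 by rewrite ltr_pdivlMr// mul1r.
move=> /= H k.
have s0 : s != 0 by rewrite gt_eqF// (lt_trans _ s2).
pose M i := ((\sum_j A i j `^ s) `^ s^-1) `^ s.
change (\sum_v fsum (pr k) M v `^ 1 <= 1).
have M0 i : 0 <= M i by exact: powR_ge0.
rewrite (eq_bigr (fsum (pr k) M)) => [|v _]; last by rewrite powRr1// fsum_ge0.
rewrite sum_fsum; apply: le_trans H.
rewrite -(pair_big predT predT (fun i j => (A i j `^ 2) `^ (s / 2))) /=.
apply: ler_sum => i _; rewrite /M -powRrM mulVf// powRr1; last first.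
  by apply: sumr_ge0 => j _; exact: powR_ge0.
by apply: ler_sum => j _; rewrite -powRrM (_ : 2 * (s / 2) = s)//; field.
Qed.

End output.
End mixed.

(** * Scalars and Littlewood inequalities *)

Section scalars.
Context {R : realType} {k : scalar_kind}.
Local Notation K := (scalar_field R k).
Local Notation mo := (@modulus R k).
Local Notation rk := (@of_real R k).
Implicit Types (x y z : K) (r : R).

(** Real and imaginary parts, the latter being 0 over the reals, so that both kinds of scalars are
    vectors indexed by [bool] with real coordinates, as Khintchine's inequality requires. *)
Definition part (b : bool) : K -> R :=
  match k return scalar_field R k -> R with
  | RealScalars => fun x : R => if b then x else 0
  | ComplexScalars => fun z : R[i] => if b then complex.Re z else complex.Im z
  end.

Lemma partD b x y : part b (x + y) = part b x + part b y.
Proof.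
rewrite /part; case: k x y => [x y|[x1 x2] [y1 y2]]; case: b => //=.
by rewrite addr0.
Qed.

Lemma part0 b : part b 0 = 0.
Proof. by have := partD b 0 0; rewrite addr0 -[LHS]addr0 => /addrI ->. Qed.

Lemma partZ b r x : part b (rk r * x) = r * part b x.
Proof.
rewrite /part /of_real; case: k x => [x|[x1 x2]]; case: b => //=.
- by rewrite mulr0.
- by rewrite mul0r subr0.
- by rewrite mul0r addr0.
Qed.

Lemma part_sum (I : Type) (r : seq I) (P : pred I) (F : I -> K) b :
  part b (\sum_(i <- r | P i) F i) = \sum_(i <- r | P i) part b (F i).
Proof. exact: (big_morph (part b) (partD b) (part0 b)). Qed.

Lemma modulus_sqr x : mo x ^+ 2 = \sum_b part b x ^+ 2.
Proof.
rewrite big_bool /part /modulus; case: k x => [x|[x1 x2]] /=.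
  by rewrite expr0n addr0 real_normK ?num_real.
by rewrite sqr_sqrtr// addr_ge0 ?sqr_ge0.
Qed.

Lemma modulus1 : mo 1 = 1.
Proof. by rewrite -(of_real1 R k) modulus_of_real. Qed.

Lemma modulusN x : mo (- x) = mo x.
Proof. by apply: (@of_real_inj R k); rewrite -!normr_modulus normrN. Qed.

Lemma modulus_rk r : mo (rk r) = `|r|.
Proof.
have [r0|r0] := leP 0 r; first by rewrite modulus_of_real// ger0_norm.
rewrite ltr0_norm// -[LHS]modulusN -(@modulus_of_real R k (- r)) ?oppr_ge0 ?ltW//.
by congr mo; apply/esym/eqP; rewrite -subr_eq0 opprK -of_realD addNr of_real0.
Qed.

Lemma modulus_prod (I : Type) (s : seq I) (F : I -> K) :
  mo (\prod_(i <- s) F i) = \prod_(i <- s) mo (F i).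
Proof. exact: (big_morph mo (@modulusM R k) modulus1). Qed.

Lemma modulus_sum (I : Type) (s : seq I) (P : pred I) (F : I -> K) :
  mo (\sum_(i <- s | P i) F i) <= \sum_(i <- s | P i) mo (F i).
Proof.
elim/big_ind2 : _ => //; first by rewrite modulus0.
by move=> a b c d h1 h2; apply: le_trans (modulusD _ _) _; exact: lerD.
Qed.

Lemma rk_prod (I : Type) (s : seq I) (F : I -> R) :
  rk (\prod_(i <- s) F i) = \prod_(i <- s) rk (F i).
Proof. exact: (big_morph rk (@of_realM R k) (of_real1 R k)). Qed.

Lemma rk_sum (I : Type) (s : seq I) (P : pred I) (F : I -> R) :
  rk (\sum_(i <- s | P i) F i) = \sum_(i <- s | P i) rk (F i).
Proof. exact: (big_morph rk (@of_realD R k) (of_real0 R k)). Qed.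

Definition phase x : K := if x == 0 then 1 else rk (mo x) / x.

Lemma phaseM x : phase x * x = rk (mo x).
Proof.
rewrite /phase; case: eqP => [->|/eqP x0]; last by rewrite divfK.
by rewrite modulus0 of_real0 mulr0.
Qed.

Lemma modulus_gt0 x : x != 0 -> 0 < mo x.
Proof.
move=> x0; rewrite lt_def modulus_ge0 andbT.
by apply: contra x0 => /eqP/modulus_eq0 ->.
Qed.

Lemma modulus_phase x : mo (phase x) = 1.
Proof.
have [x0|x0] := eqVneq x 0; first by rewrite /phase x0 eqxx modulus1.
have := congr1 mo (phaseM x); rewrite modulusM modulus_rk ger0_norm ?modulus_ge0//.
by rewrite -[RHS]mul1r => /mulIf; apply; rewrite gt_eqF// modulus_gt0.
Qed.

Section littlewood.
Variables (M n : nat) (b : {ffun 'I_M -> 'I_n} -> K).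
Hypothesis bform : forall x : 'I_M -> 'I_n -> K, (forall l v, mo (x l v) <= 1) ->
  mo (\sum_(i : {ffun 'I_M -> 'I_n}) (\prod_l x l (i l)) * b i) <= 1.

(** All variables carry the signs of the chaos, and variable [l] also the phases of the fibre sums;
    evaluating the form at this point of the unit ball adds up their moduli. *)
Lemma signed_fibers_le1 (d : {ffun 'I_M -> {ffun 'I_n -> bool}}) (l : 'I_M) :
  \sum_v mo (\sum_(i : {ffun 'I_M -> 'I_n} | i l == v) rk (chaos_sign d i) * b i) <= 1.
Proof.
pose S v := \sum_(i : {ffun 'I_M -> 'I_n} | i l == v) rk (chaos_sign d i) * b i.
pose x j v : K := rk (rsign (d j v)) * (if j == l then phase (S v) else 1).
have x1 j v : mo (x j v) <= 1.
  rewrite /x modulusM modulus_rk normr_rsign mul1r; case: ifP; rewrite ?modulus1//.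
  by rewrite modulus_phase.
have := bform x1.
have -> : \sum_(i : {ffun 'I_M -> 'I_n}) (\prod_j x j (i j)) * b i = rk (\sum_v mo (S v)).
  rewrite (partition_big (fun i : {ffun 'I_M -> 'I_n} => i l) predT)//= rk_sum.
  apply: eq_bigr => v _; rewrite -phaseM [in RHS]/S mulr_sumr.
  apply: eq_bigr => i /eqP il; rewrite mulrA; congr (_ * _).
  rewrite big_split /= /chaos_sign rk_prod mulrC; congr (_ * _).
  by rewrite (bigD1 l)//= eqxx il big1 ?mulr1// => j /negbTE ->.
by rewrite modulus_rk ger0_norm// sumr_ge0// => v _; exact: modulus_ge0.
Qed.

Lemma littlewood (l : 'I_M) :
  \sum_v fsum (fun i : {ffun 'I_M -> 'I_n} => i l) (fun i => mo (b i) ^+ 2) v `^ 2^-1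
    <= (16 / 9) ^+ M.
Proof.
pose c : R := (9 / 16 * 2 ^+ n) ^+ M.
have c0 : 0 < c by rewrite exprn_gt0// mulr_gt0// exprn_gt0.
rewrite -(ler_pM2l c0).
have -> : c * (16 / 9) ^+ M = \sum_(d : {ffun 'I_M -> {ffun 'I_n -> bool}}) 1.
  rewrite sumr_const !card_ffun card_bool !card_ord -mulr_natr mul1r !natrX.
  rewrite /c -exprMn; congr (_ ^+ _).
  by rewrite mulrAC mulrA; field.
rewrite mulr_sumr.
apply: (@le_trans _ _ (\sum_v \sum_(d : {ffun 'I_M -> {ffun 'I_n -> bool}})
    mo (\sum_(i : {ffun 'I_M -> 'I_n} | i l == v) rk (chaos_sign d i) * b i))).
  apply: ler_sum => v _.
  (* Khintchine runs over all multi-indices, so the coefficients are extended by 0 off the fibre. *)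
  pose a (i : {ffun 'I_M -> 'I_n}) (t : bool) := if i l == v then part t (b i) else 0.
  have := khintchine_chaos a.
  have -> : \sum_t \sum_i a i t ^+ 2 =
      fsum (fun i : {ffun 'I_M -> 'I_n} => i l) (fun i => mo (b i) ^+ 2) v.
    rewrite exchange_big /= /fsum [RHS]big_mkcond /=; apply: eq_bigr => i _.
    rewrite modulus_sqr /a; case: ifP => // _.
    by rewrite big1// => t _; rewrite expr0n.
  rewrite powR12_sqrt; last by apply: fsum_ge0 => i; exact: sqr_ge0.
  move=> /le_trans; apply; apply: ler_sum => d _.
  rewrite -[leRHS](ger0_norm (modulus_ge0 _)) -sqrtr_sqr modulus_sqr.
  rewrite le_eqVlt; apply/orP; left; apply/eqP; congr Num.sqrt; apply: eq_bigr => t _.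
  rewrite part_sum [in RHS]big_mkcond /=; congr (_ ^+ 2); apply: eq_bigr => i _.
  by rewrite /a; case: ifP => _; rewrite ?mulr0// partZ.
rewrite exchange_big /=; apply: ler_sum => d _; exact: signed_fibers_le1.
Qed.

End littlewood.

(** The output index becomes variable [ord0] of a scalar form in [m + 1] variables, so [None]
    corresponds to [ord0] and [Some l] to [lift ord0 l]. *)
Lemma littlewood_out (m n : nat) (a : {ffun 'I_m -> 'I_n} -> 'I_n -> K) :
  (forall (x : 'I_m -> 'I_n -> K) (y : 'I_n -> K),
     (forall l v, mo (x l v) <= 1) -> (forall v, mo (y v) <= 1) ->
     mo (\sum_j y j * \sum_(i : {ffun 'I_m -> 'I_n}) (\prod_l x l (i l)) * a i j) <= 1) ->
  forall l, \sum_v fsum (pr_out (fun (l : 'I_m) (i : {ffun 'I_m -> 'I_n}) => i l) l)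
     (fun p => mo (a p.1 p.2) ^+ 2) v `^ 2^-1 <= (16 / 9) ^+ m.+1.
Proof.
move=> H l.
pose rest (f : {ffun 'I_m.+1 -> 'I_n}) : {ffun 'I_m -> 'I_n} := [ffun i => f (lift ord0 i)].
have restK u (g : {ffun 'I_m -> 'I_n}) : rest (fcons u g) = g.
  by apply/ffunP => i; rewrite ffunE fconsS.
pose b (f : {ffun 'I_m.+1 -> 'I_n}) := a (rest f) (f ord0).
have bform (x : 'I_m.+1 -> 'I_n -> K) : (forall l v, mo (x l v) <= 1) ->
    mo (\sum_(i : {ffun 'I_m.+1 -> 'I_n}) (\prod_l x l (i l)) * b i) <= 1.
  move=> x1; have := H (fun i => x (lift ord0 i)) (x ord0) (fun i => x1 _) (x1 _).
  rewrite sum_ffun_ordS; congr (mo _ <= 1); apply: eq_bigr => j _.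
  rewrite mulr_sumr; apply: eq_bigr => g _.
  rewrite big_ord_recl /b restK !fcons0 mulrA; congr (_ * _ * _).
  by apply: eq_bigr => i _; rewrite fconsS.
apply: le_trans (littlewood bform (oapp (lift ord0) ord0 l)).
rewrite le_eqVlt; apply/orP; left; apply/eqP; apply: eq_bigr => v _; congr (_ `^ _).
rewrite /fsum (reindex (fun f : {ffun 'I_m.+1 -> 'I_n} => (rest f, f ord0))) /=.
  apply: eq_big => [f|f _]; last by rewrite /b.
  by case: l => [l|] //=; rewrite ffunE.
exists (fun p => fcons p.2 p.1) => [f _|[g u] _] /=; last by rewrite restK fcons0.
by apply/ffunP => i; rewrite ffunE; case: unliftP => [j ->|->] //=; rewrite ffunE.
Qed.

End scalars.

(** * Weighted Littlewood inequality for coefficient arrays *)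

Section arrays.
Context {R : realType} {k : scalar_kind}.
Local Notation K := (scalar_field R k).
Local Notation mo := (@modulus R k).
Local Notation rk := (@of_real R k).

Definition coord m n (l : 'I_m) (i : {ffun 'I_m -> 'I_n}) : 'I_n := i l.

Definition qnorm (V : finType) (q : R) (x : V -> K) : R :=
  (\sum_j mo (x j) `^ q) `^ q^-1.

Lemma qnorm_ge0 (V : finType) q (x : V -> K) : 0 <= qnorm q x.
Proof. exact: powR_ge0. Qed.

Lemma qnormZ (V : finType) q (c : R) (x : V -> K) : 0 < q -> 0 <= c ->
  qnorm q (fun j => rk c * x j) = c * qnorm q x.
Proof.
move=> q0 c0; rewrite /qnorm.
under eq_bigr do rewrite modulusM modulus_rk (ger0_norm c0) powRM ?modulus_ge0//.
rewrite -mulr_sumr powRM ?powR_ge0//; last by apply: sumr_ge0 => j _; exact: powR_ge0.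
by rewrite -powRrM divff ?gt_eqF// powRr1.
Qed.

Section bounded.
Variables (m n : nat) (a : {ffun 'I_m -> 'I_n} -> 'I_n -> K) (pV : 'I_m -> R) (s : R).
Hypotheses (s1 : 1 <= s) (pV0 : forall l, 0 <= pV l).
(* [a] are the coordinates of a form of norm at most 1 on [l_p1 x ... x l_pm] with values
   in [l_s]; [pV l] is [1 / p l]. *)
Hypothesis abound : forall (h : 'I_m -> 'I_n -> R) (x : 'I_m -> 'I_n -> K),
  (forall l, mass1 (h l)) -> (forall l v, mo (x l v) <= h l v `^ pV l) ->
  \sum_j mo (\sum_(i : {ffun 'I_m -> 'I_n}) (\prod_l x l (i l)) * a i j) `^ s <= 1.

Let s0 : 0 < s := lt_le_trans ltr01 s1.
Let D : R := (16 / 9) ^+ m.+1.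

Let D0 : 0 < D.
Proof. by rewrite exprn_gt0// divr_gt0. Qed.

Definition wt (h : 'I_m -> 'I_n -> R) (i : {ffun 'I_m -> 'I_n}) : R :=
  \prod_l h l (i l) `^ pV l.

Lemma wt_ge0 h i : 0 <= wt h i.
Proof. by apply: prodr_ge0 => l _; exact: powR_ge0. Qed.

(** The input weights are absorbed into the arguments, where [abound] admits them; the output weight
    costs nothing by Hoelder, as [g ^ (1 - 1 / s)] lies in the unit ball of the dual of [l_s]. *)
Lemma weighted_form (h : 'I_m -> 'I_n -> R) (g : 'I_n -> R) (x : 'I_m -> 'I_n -> K)
    (y : 'I_n -> K) :
  (forall l, mass1 (h l)) -> mass1 g ->
  (forall l v, mo (x l v) <= 1) -> (forall v, mo (y v) <= 1) ->
  mo (\sum_j y j * \sum_(i : {ffun 'I_m -> 'I_n}) (\prod_l x l (i l)) *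
    (rk (g j `^ (1 - s^-1)) * (rk (wt h i) * a i j))) <= 1.
Proof.
move=> hm [g0 g1] x1 y1.
pose x' l v := rk (h l v `^ pV l) * x l v.
have x'1 l v : mo (x' l v) <= h l v `^ pV l.
  rewrite /x' modulusM modulus_rk ger0_norm ?powR_ge0//.
  by rewrite ler_piMr ?powR_ge0.
have := abound hm x'1.
set B := fun j => \sum_(i : {ffun 'I_m -> 'I_n}) (\prod_l x' l (i l)) * a i j.
rewrite -/(B _) => HB.
have -> : \sum_j y j * \sum_(i : {ffun 'I_m -> 'I_n}) (\prod_l x l (i l)) *
    (rk (g j `^ (1 - s^-1)) * (rk (wt h i) * a i j)) =
    \sum_j y j * (rk (g j `^ (1 - s^-1)) * B j).
  apply: eq_bigr => j _; congr (_ * _); rewrite /B mulr_sumr; apply: eq_bigr => i _.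
  rewrite mulrCA; congr (_ * _); rewrite /x' big_split /= -rk_prod -/(wt h i).
  by rewrite mulrA [_ * rk _]mulrC.
apply: le_trans (modulus_sum _ _ _) _.
have sV : 0 <= s^-1 <= 1 by rewrite invr_ge0 (ltW s0)/= invf_le1.
have sV' : 0 <= 1 - s^-1 by rewrite subr_ge0; case/andP: sV.
apply: (@le_trans _ _ (\sum_j (mo (B j) `^ s) `^ s^-1 * g j `^ (1 - s^-1))).
  apply: ler_sum => j _; rewrite !modulusM modulus_rk (ger0_norm (powR_ge0 _ _)).
  rewrite -powRrM divff ?gt_eqF// powRr1 ?modulus_ge0// [leRHS]mulrC.
  by rewrite ler_piMl ?mulr_ge0 ?powR_ge0 ?modulus_ge0.
apply: le_trans (holder _ (fun j => powR_ge0 _ _) g0 sV) _.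
rewrite -[leRHS]mulr1 ler_pM ?powR_ge0// powR_le1//.
- by rewrite HB sumr_ge0// => j _; exact: powR_ge0.
- by case/andP: sV.
- by rewrite g1 sumr_ge0.
Qed.

(* The output index acts as one more variable, ranging over the unit ball of the dual of
   [l_s]; removing its weight with [fiber_le1_step] is what replaces the Bennett--Carl
   inequalities. *)
Lemma weighted_littlewood (h : 'I_m -> 'I_n -> R) : (forall l, mass1 (h l)) ->
  fiber_le1 (pr_out (@coord m n)) (s / 2)
    (fun p => (wt h p.1 / D * mo (a p.1 p.2)) `^ 2).
Proof.
(* Twice the exponent of the output weight, because the entries are squared. The mixed [(l_1, l_2)]
   bound is exponent [1 / 2] for squares, and [2 - b = 2 / s] leads to [s / 2]. *)
move=> hm; pose b : R := 2 * (1 - s^-1).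
have sV' : 0 <= 1 - s^-1 by rewrite subr_ge0 invf_le1.
apply: (@fiber_le1_step _ _ _ _ (pr_out (@coord m n)) None _ 2^-1 (s / 2) b).
- by rewrite invr_gt0.
- by rewrite divr_gt0.
- by rewrite mulr_ge0.
- by rewrite /b invrK invf_div; field; rewrite gt_eqF.
- by move=> p; exact: powR_ge0.
move=> g gm; rewrite /fiber_le1 ifT; last by rewrite invf_le1// ler1n.
move=> l.
have := littlewood_out (fun x y => @weighted_form h g x y hm gm) l.
have DV0 : 0 <= D^-1 by rewrite invr_ge0 ltW.
move=> /(ler_wpM2l DV0); rewrite mulVf ?gt_eqF// => H; apply: le_trans H.
rewrite mulr_sumr; apply: ler_sum => v _.
have DE : D^-1 = (D^-1 ^+ 2) `^ 2^-1.
  by rewrite powR12_sqrt ?sqr_ge0// sqrtr_sqr ger0_norm ?invr_ge0 ?(ltW D0).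
have F0 (F : {ffun 'I_m -> 'I_n} * 'I_n -> R) :
    (forall p, 0 <= F p) -> 0 <= fsum (pr_out (@coord m n) l) F v.
  exact: fsum_ge0.
rewrite [X in _ <= X * _]DE -powRM ?sqr_ge0//; last by apply: F0 => p; exact: sqr_ge0.
apply: ler_powR2; last by rewrite invr_ge0.
  by apply: F0 => p; rewrite mulr_ge0 ?powR_ge0.
rewrite /fsum mulr_sumr; apply: ler_sum => -[i j] _ /=.
rewrite !modulusM !modulus_rk !ger0_norm ?powR_ge0 ?wt_ge0//.
rewrite powR_mulrn; last by rewrite mulr_ge0 ?modulus_ge0// divr_ge0 ?wt_ge0 ?(ltW D0).
rewrite /b mulrC [2 * _]mulrC powRrM powR_mulrn ?powR_ge0// -!exprMn.
by rewrite le_eqVlt; apply/orP; left; apply/eqP; congr (_ ^+ 2); ring.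
Qed.

(** [l0] is the exponent before the weights of the variables are removed. Working with [mu]-th
    powers divides every exponent by [mu] and turns the weight exponents into [mu * pV j], so that
    the threshold of [fiber_le1] becomes [l = mu]. *)
Lemma array_fiber_le1 (q mu l0 l : R) :
  s <= q /\ (s <= 2 /\ q <= 2 /\ mu = 2 \/ 2 < s /\ q = s /\ mu = s) ->
  0 < l0 -> 0 < l ->
  l0^-1 = (if s <= 2 then 2^-1 + s^-1 - q^-1 else s^-1) ->
  l^-1 = l0^-1 - \sum_j pV j -> (0 < n)%N ->
  fiber_le1 (@coord m n) (l / mu) (fun i => (qnorm q (a i) / D) `^ mu).
Proof.
move=> [sq cases] l00 lp l0E lE n0.
have q0 : 0 < q := lt_le_trans s0 sq.
have mu0 : 0 < mu.
  by case: cases => [[_ [_ ->]]|[_ [_ ->]]].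
apply: (@weighted_fiber_le1 _ _ _ _ (@coord m n) (fun j => mu * pV j)
    (index_enum 'I_m) _ (l0 / mu) (l / mu)).
- by rewrite divr_gt0.
- by rewrite divr_gt0.
- by move=> j; rewrite mulr_ge0// ltW.
- by rewrite -mulr_sumr !invf_div -[mu / l]/(mu * l^-1) lE mulrBr.
- by move=> i; exact: powR_ge0.
apply: weighted_of_family; [exact: index_enum_uniq|exact: (Ordinal n0)|].
move=> h hm; have H := weighted_littlewood hm.
pose A i j := wt h i / D * mo (a i j).
have A0 i j : 0 <= A i j by rewrite mulr_ge0 ?modulus_ge0// divr_ge0 ?wt_ge0 ?(ltW D0).
have AE i : (\sum_j A i j `^ q) `^ q^-1 = wt h i / D * qnorm q (a i).
  have c0 : 0 <= wt h i / D by rewrite divr_ge0 ?wt_ge0 ?(ltW D0).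
  rewrite -(qnormZ _ q0 c0); congr (_ `^ _); apply: eq_bigr => j _.
  by rewrite modulusM modulus_rk ger0_norm.
have -> : (fun i => (\prod_(j <- index_enum 'I_m) h j (coord j i) `^ (mu * pV j)) *
    (qnorm q (a i) / D) `^ mu) = (fun i => ((\sum_j A i j `^ q) `^ q^-1) `^ mu).
  apply/funext => i; rewrite AE mulrAC -mulrA [in RHS]powRM ?wt_ge0//; last first.
    by rewrite divr_ge0 ?qnorm_ge0 ?(ltW D0).
  congr (_ * _); rewrite /wt.
  rewrite powR_prod; last by move=> j; exact: powR_ge0.
  by apply: eq_bigr => j _; rewrite -powRrM mulrC.
case: cases => [[s2 [q2 muE]]|[s2 [qE muE]]]; rewrite muE.
  by apply: (fiber_le1_qnorm s1 sq q2 A0 l00 _ H); rewrite l0E s2.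
have -> : l0 / s = 1.
  by rewrite -[l0]invrK l0E leNgt s2 /= invrK divff// gt_eqF.
rewrite qE; exact: (fiber_le1_snorm s2 A0 H).
Qed.

End bounded.
End arrays.

(** * Mixed norms *)

Section fmixed.
Context {R : realType}.

Fixpoint fmixed (n : nat) (t : seq R) (b : seq nat -> R) : R :=
  if t is t1 :: t' then
    (\sum_(i < n) fmixed n t' (fun w => b (val i :: w)) `^ t1) `^ t1^-1
  else b [::].

Fixpoint msum (n m : nat) (z : seq nat -> R) : R :=
  if m is m'.+1 then \sum_(i < n) msum n m' (fun w => z (val i :: w)) else z [::].

Lemma fmixed_ge0 n t b : (forall w, 0 <= b w) -> 0 <= fmixed n t b.
Proof. by case: t => [|t1 t] b0 //=; exact: powR_ge0. Qed.

Lemma msum_ge0 n m z : (forall w, 0 <= z w) -> 0 <= msum n m z.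
Proof.
by elim: m z => [|m IH] z z0 //=; apply: sumr_ge0 => i _; exact: IH.
Qed.

Lemma msumZ n m c z : msum n m (fun w => c * z w) = c * msum n m z.
Proof.
elim: m z => [|m IH] z //=; rewrite mulr_sumr.
by apply: eq_bigr => i _; rewrite -IH.
Qed.

Lemma eq_msum n m z z' : z =1 z' -> msum n m z = msum n m z'.
Proof.
by elim: m z z' => [|m IH] z z' zz //=; apply: eq_bigr => i _; apply: IH => w.
Qed.

(** A factor depending on the [j]-th index alone is spent on the passage from [l_mu] to [l_(t_j)] at
    level [j]. In the induction the outermost factor is frozen and moved into [z], since it is a
    constant for the inner sums. *)
Lemma fmixed_holder n (t : seq R) mu (h : nat -> nat -> R) (b z : seq nat -> R) :
  0 < mu -> (forall j, (j < size t)%N -> 0 < nth 0 t j <= mu) ->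
  (forall j v, 0 <= h j v) -> (forall j, (j < size t)%N -> \sum_(v < n) h j v <= 1) ->
  (forall w, 0 <= b w) -> (forall w, 0 <= z w) ->
  (forall w, size w = size t -> all (fun i => (i < n)%N) w ->
     b w <= z w * \prod_(j < size t) h j (nth 0%N w j) `^ ((nth 0 t j)^-1 - mu^-1)) ->
  fmixed n t b <= (msum n (size t) (fun w => z w `^ mu)) `^ mu^-1.
Proof.
move=> mu0; elim: t h b z => [|t1 t IH] h b z tP h0 h1 b0 z0 H /=.
  have := H [::] erefl erefl; rewrite big_ord0 mulr1.
  by rewrite -powRrM divff ?gt_eqF// powRr1.
have /andP[t10 t1mu] : 0 < t1 <= mu by exact: (tP 0%N).
set e1 := t1^-1 - mu^-1.
have Z0 (i : 'I_n) : 0 <= msum n (size t) (fun w => z (val i :: w) `^ mu).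
  by apply: msum_ge0 => w; exact: powR_ge0.
have IHi (i : 'I_n) : fmixed n t (fun w => b (val i :: w)) <=
    h 0%N i `^ e1 * msum n (size t) (fun w => z (val i :: w) `^ mu) `^ mu^-1.
  have := IH (fun j => h j.+1) (fun w => b (val i :: w))
    (fun w => h 0%N i `^ e1 * z (val i :: w)).
  rewrite (@eq_msum _ _ _ (fun w => (h 0%N i `^ e1) `^ mu * z (val i :: w) `^ mu)); last first.
    by move=> w; rewrite powRM ?powR_ge0.
  rewrite msumZ powRM ?powR_ge0// -[_ `^ mu `^ _]powRrM divff ?gt_eqF// powRr1 ?powR_ge0//.
  apply=> //.
  - by move=> j jt; exact: (tP j.+1).
  - by move=> j jt; exact: (h1 j.+1).
  - by move=> w; rewrite mulr_ge0 ?powR_ge0.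
  - move=> w sw wn; have := H (val i :: w) _ _; rewrite /= sw ltn_ord wn.
    move=> /(_ erefl erefl); rewrite big_ord_recl /= mulrA.
    by rewrite [_ * z _]mulrC.
have r01 : 0 <= t1 / mu <= 1.
  by rewrite divr_ge0 ?(ltW t10) ?(ltW mu0)//= ler_pdivrMr// mul1r.
set Z := \sum_(i < n) msum n (size t) (fun w => z (val i :: w) `^ mu).
have ZZ0 : 0 <= Z by apply: sumr_ge0.
have S1 : \sum_(i < n) fmixed n t (fun w => b (val i :: w)) `^ t1 <= Z `^ (t1 / mu).
  apply: (@le_trans _ _ (\sum_(i < n)
     msum n (size t) (fun w => z (val i :: w) `^ mu) `^ (t1 / mu) *
     h 0%N i `^ (1 - t1 / mu))).
    apply: ler_sum => i _; apply: le_trans (ler_powR2 _ (IHi i) (ltW t10)) _.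
      by apply: fmixed_ge0.
    move: (msum _ _ _) (Z0 i) => X X0.
    rewrite powRM ?powR_ge0// -!powRrM mulrC.
    rewrite le_eqVlt; apply/orP; left; apply/eqP; congr (_ `^ _ * _ `^ _).
      by rewrite mulrC.
    by rewrite /e1; field; rewrite !gt_eqF.
  apply: le_trans (holder _ Z0 (fun i => h0 0%N (val i)) r01) _.
  rewrite ler_piMr ?powR_ge0// powR_le1 ?subr_ge0//; last by case/andP: r01.
  by rewrite h1// sumr_ge0.
apply: le_trans (ler_powR2 _ S1 _) _.
- by apply: sumr_ge0 => i _; exact: powR_ge0.
- by rewrite invr_ge0 ltW.
- rewrite -powRrM (_ : t1 / mu / t1 = mu^-1)//.
  by field; rewrite !gt_eqF.
Qed.

Definition fseq m n (f : {ffun 'I_m -> 'I_n}) : seq nat := [seq val (f j) | j <- enum 'I_m].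

Lemma size_fseq m n (f : {ffun 'I_m -> 'I_n}) : size (fseq f) = m.
Proof. by rewrite size_map size_enum_ord. Qed.

Lemma nth_fseq m n (f : {ffun 'I_m -> 'I_n}) (j : 'I_m) : nth 0%N (fseq f) j = f j.
Proof. by rewrite (nth_map j) ?size_enum_ord// nth_ord_enum. Qed.

Lemma fseq_cons m n u (g : {ffun 'I_m -> 'I_n}) : fseq (fcons u g) = val u :: fseq g.
Proof.
rewrite /fseq enum_ordSl /= fcons0 -map_comp; congr (_ :: _).
by apply: eq_map => j /=; rewrite fconsS.
Qed.

Lemma msumE n m (z : seq nat -> R) :
  msum n m z = \sum_(f : {ffun 'I_m -> 'I_n}) z (fseq f).
Proof.
elim: m z => [|m IH] z /=.
  have f : {ffun 'I_0 -> 'I_n} by apply: finfun => -[].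
  by rewrite (sum_ffun_ord0 _ f) /fseq (size0nil (_ : size (enum 'I_0) = 0%N)) ?size_enum_ord.
rewrite sum_ffun_ordS; apply: eq_bigr => u _; rewrite IH.
by apply: eq_bigr => g _; rewrite fseq_cons.
Qed.

Lemma fseq_surj m n w : size w = m -> all (fun i => (i < n)%N) w ->
  exists f : {ffun 'I_m -> 'I_n}, fseq f = w.
Proof.
elim: m w => [|m IH] [|i w]//=.
  move=> _ _; have f : {ffun 'I_0 -> 'I_n} by apply: finfun => -[].
  by exists f; apply: size0nil; rewrite size_fseq.
move=> [sw] /andP[ilt /(IH w sw)[g gw]].
by exists (fcons (Ordinal ilt) g); rewrite fseq_cons gw.
Qed.

(* The exponents [e k] only have to satisfy [\sum e <= 1 - a], so the product is controlled
   by the coordinate with the smallest fibre mass. *)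
Lemma fiber_prod_le (I V J : finType) (pr : J -> I -> V) (M : I -> R) (a : R)
    (e : J -> R) (j0 : J) :
  0 < a <= 1 -> (forall i, 0 <= M i) -> (forall j, 0 <= e j) -> \sum_j e j <= 1 - a ->
  (forall j, \sum_v fsum (pr j) M v `^ a <= 1) ->
  \sum_i M i * \prod_j fsum (pr j) M (pr j i) `^ (- e j) <= #|J|%:R.
Proof.
move=> /andP[a0 a1] M0 e0 e1 HM.
have N0 j v : 0 <= fsum (pr j) M v by exact: fsum_ge0.
have N1 j v : fsum (pr j) M v <= 1.
  rewrite leNgt; apply/negP => N1.
  have := HM j; rewrite (bigD1 v)//= leNgt => /negP; apply.
  rewrite ltr_wpDr ?powR_gt1// sumr_ge0// => u _; exact: powR_ge0.
apply: (@le_trans _ _ (\sum_i \sum_j fsum (pr j) M (pr j i) `^ (a - 1) * M i)); last first.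
  rewrite exchange_big /= -[leRHS]mulr1 mulr_natl -sumr_const; apply: ler_sum => j _.
  apply: le_trans (HM j).
  rewrite (partition_big (pr j) predT)//=; apply: ler_sum => v _.
  pose w v := fsum (pr j) M v `^ (a - 1).
  rewrite -[leLHS]/(fsum (pr j) (fun i => w (pr j i) * M i) v) fsum_comp mulrC.
  by rewrite mulr_powRB1.
apply: ler_sum => i _; have [->|Mn0] := eqVneq (M i) 0.
  by rewrite mul0r big1// => j _; rewrite mulr0.
rewrite -mulr_suml mulrC ler_wpM2r//.
have Np j : 0 < fsum (pr j) M (pr j i).
  apply: (@lt_le_trans _ _ (M i)); first by rewrite lt_def Mn0 M0.
  by rewrite /fsum (bigD1 i)//= lerDl sumr_ge0.
pose F j := fsum (pr j) M (pr j i).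
have [k _ kmin] : exists2 k, true & forall j, F k <= F j.
  case: (@Order.TotalTheory.arg_minP _ R J j0 predT F) => // k _ kmin.
  by exists k => // j; exact: kmin.
apply: (@le_trans _ _ (F k `^ (a - 1))); last first.
  by rewrite (bigD1 k)//= lerDl sumr_ge0// => j _; exact: powR_ge0.
apply: (@le_trans _ _ (\prod_j F k `^ (- e j))).
  apply: ler_prod => j _; rewrite powR_ge0/= !powRN lef_pV2 ?posrE ?powR_gt0//; last exact: Np.
  by apply: ler_powR2 => //; [exact: N0|exact: kmin].
have -> : \prod_j F k `^ (- e j) = F k `^ (- \sum_j e j).
  rewrite -sumrN; elim/big_rec2 : _ => [|j y1 y2 _ ->]; first by rewrite powRr0.
  by rewrite powRDgt0//; exact: Np.
by apply: ger_powR; [rewrite (Np k) N1|rewrite lerNr opprB].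
Qed.

(** For [l <= mu], [b] is divided by powers of its fibre masses to form [z], whose unmixed [mu]-norm
    is controlled by [fiber_prod_le]; [fmixed_holder] then pays the same powers back. For [mu < l]
    all exponents coincide and the sum is unmixed from the start. *)
Lemma fmixed_le m n (t : m.-tuple R) (l mu : R) (b : seq nat -> R) : (0 < m)%N ->
  0 < l -> 0 < mu -> (forall w, 0 <= b w) ->
  (forall j, l <= tnth t j <= Num.max l mu) ->
  \sum_j (tnth t j)^-1 <= l^-1 + m.-1%:R / Num.max l mu ->
  fiber_le1 (fun (j : 'I_m) (f : {ffun 'I_m -> 'I_n}) => f j) (l / mu)
    (fun f => b (fseq f) `^ mu) ->
  fmixed n t b <= m%:R `^ (Num.max l mu)^-1.
Proof.
move=> m0 l0 mu0 b0 tP tS; rewrite /fiber_le1 ler_pdivrMr// mul1r.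
have tnthE j (jm : (j < m)%N) : nth 0 t j = tnth t (Ordinal jm) by rewrite (tnth_nth 0).
case: leP => [lmu HM|mul HM]; last first.
  rewrite max_l ?(ltW mul)// in tP *.
  apply: (@le_trans _ _ (msum n m (fun w => b w `^ l) `^ l^-1)).
    rewrite -[in X in msum _ X _](size_tuple t).
    (* Every entry of [t] equals [l], so the weights have exponent 0 and [0 ^ 0 = 1] makes the zero
       weight neutral. *)
    apply: (@fmixed_holder _ _ l (fun _ _ => 0)) => // [j|j _|w sw wn].
    - rewrite size_tuple => jm; rewrite tnthE; have /andP[h1 h2] := tP (Ordinal jm).
      by rewrite (lt_le_trans l0 h1).
    - by rewrite big1.
    - rewrite big1 ?mulr1// => j _.
      have jm : (j < m)%N by rewrite -[X in (_ < X)%N](size_tuple t).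
      rewrite tnthE; have /le_anti -> := tP (Ordinal jm).
      by rewrite subrr powRr0.
  apply: ler_powR2; last by rewrite invr_ge0 ltW.
    by apply: msum_ge0 => w; exact: powR_ge0.
  rewrite msumE (le_trans _ (_ : 1 <= m%:R))// ?ler1n//.
  apply: le_trans HM; apply: ler_sum => f _.
  by rewrite -powRrM mulrCA divff ?mulr1// gt_eqF.
rewrite max_r// in tP tS *.
pose a := l / mu; have a0 : 0 < a by rewrite divr_gt0.
have a1 : a <= 1 by rewrite ler_pdivrMr// mul1r.
pose N (j : 'I_m) := fsum (fun f : {ffun 'I_m -> 'I_n} => f j) (fun f => b (fseq f) `^ mu).
have N0 j v : 0 <= N j v by apply: fsum_ge0 => f; exact: powR_ge0.
pose h (j v : nat) : R :=
  if insub j is Some j' then if insub v is Some v' then N j' v' `^ a else 0 else 0.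
have hE (j : 'I_m) (v : 'I_n) : h j v = N j v `^ a by rewrite /h !valK.
pose ee (j : 'I_m) : R := (tnth t j)^-1 - mu^-1.
have tj0 j : 0 < tnth t j by have /andP[h1 _] := tP j; exact: lt_le_trans h1.
have ee0 j : 0 <= ee j.
  by rewrite subr_ge0 lef_pV2 ?posrE//; case/andP: (tP j).
(* A vanishing fibre mass does no harm: it forces [b] to vanish on the whole fibre. *)
pose z (w : seq nat) : R := b w * \prod_(j < m) h j (nth 0%N w j) `^ (- ee j).
have z0 w : 0 <= z w by rewrite mulr_ge0// prodr_ge0// => j _; exact: powR_ge0.
have Npos (f : {ffun 'I_m -> 'I_n}) j : b (fseq f) != 0 -> 0 < N j (f j).
  move=> bf; apply: (@lt_le_trans _ _ (b (fseq f) `^ mu)).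
    by rewrite powR_gt0// lt_def bf b0.
  by rewrite /N /fsum (bigD1 f)//= lerDl sumr_ge0// => g _; exact: powR_ge0.
apply: (@le_trans _ _ (msum n m (fun w => z w `^ mu) `^ mu^-1)).
  rewrite -[in X in msum _ X _](size_tuple t).
  apply: (@fmixed_holder _ _ mu h) => // [j|j v|j|w].
  - rewrite size_tuple => jm; rewrite tnthE tj0; by case/andP: (tP (Ordinal jm)).
  - by rewrite /h; case: insub => // j'; case: insub => // v'; exact: powR_ge0.
  - rewrite size_tuple => jm; apply: le_trans (HM (Ordinal jm)).
    by apply: ler_sum => v _; rewrite (hE (Ordinal jm)).
  rewrite [in X in X -> _]size_tuple => sw wn; have [f fw] := fseq_surj sw wn.
  rewrite -fw; have [->|bn0] := eqVneq (b (fseq f)) 0.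
    by rewrite mulr_ge0// prodr_ge0// => j _; exact: powR_ge0.
  rewrite /z size_tuple -mulrA -big_split /= big1 ?mulr1// => j _.
  rewrite nth_fseq hE.
  rewrite (tnthE j (ltn_ord j)) (_ : Ordinal _ = j); last exact: val_inj.
  by rewrite powRDgt0 ?powR_gt0 ?Npos// addNr powRr0.
apply: ler_powR2; last by rewrite invr_ge0 ltW.
  by apply: msum_ge0 => w; exact: powR_ge0.
rewrite msumE -[m in leRHS]card_ord.
(* The powers of the fibre masses in [z ^ mu]. The condition on the sum of the [1 / t_j] says
   precisely that they sum to at most [1 - a]. *)
pose e j := a * mu * ee j.
have e1 : \sum_j e j <= 1 - a.
  rewrite -mulr_sumr big_split /= sumr_const card_ord -[_ *+ m]mulr_natl.
  have -> : a * mu = l by rewrite divfK// gt_eqF.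
  apply: (@le_trans _ _ (l * (l^-1 + m.-1%:R / mu - m%:R * mu^-1))).
    by rewrite ler_wpM2l ?(ltW l0)// mulrN lerD2r.
  rewrite /a -{2}(prednK m0) -natr1 mulrDr mulrDr divff ?gt_eqF//.
  by rewrite le_eqVlt; apply/orP; left; apply/eqP; ring.
apply: le_trans (fiber_prod_le (Ordinal m0) _ _ _ e1 HM).
- apply: ler_sum => f _; rewrite /z.
  rewrite powRM ?prodr_ge0// => [|j _]; last exact: powR_ge0.
  rewrite ler_wpM2l ?powR_ge0//.
  rewrite powR_prod => [|j]; last exact: powR_ge0.
  rewrite le_eqVlt; apply/orP; left; apply/eqP; apply: eq_bigr => j _.
  by rewrite nth_fseq hE -!powRrM /e; congr (_ `^ _); ring.
- by rewrite a0.
- by move=> f; exact: powR_ge0.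
- by move=> j; rewrite /e mulr_ge0 ?ee0 // mulr_ge0 ?(ltW a0) ?(ltW mu0).
Qed.

End fmixed.

(** * Truncation of series and mixed norms *)

Section exhaustion.
Context {R : realType}.
Local Open Scope ereal_scope.

(* A one-sided form of [f n --> F] that is stable under powers and series without any
   continuity argument at [+oo]. *)
Definition exhausts (f : nat -> R) (F : \bar R) :=
  forall r : R, r%:E < F -> exists n0, forall n, (n0 <= n)%N -> (r < f n)%R.

Lemma exhausts_cst (r : R) : exhausts (fun=> r) r%:E.
Proof. by move=> r'; rewrite lte_fin => rr; exists 0%N. Qed.

Lemma exhausts_le f F (C : R) : exhausts f F -> (forall n, (0 < n)%N -> (f n <= C)%R) ->
  F <= C%:E.
Proof.
move=> fF fC; rewrite leNgt; apply/negP => /fF[n0 /(_ n0.+1 (leqnSn _))].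
by rewrite ltNge fC.
Qed.

Lemma exhausts_powR f F (e : R) : (0 < e)%R -> 0 <= F -> (forall n, 0 <= f n)%R ->
  exhausts f F -> exhausts (fun n => f n `^ e)%R (F `^ e).
Proof.
move=> e0 F0 f0 fF r rF; have [r0|r0] := ltP r 0%R.
  by exists 0%N => n _; rewrite (lt_le_trans r0)// powR_ge0.
have reE : (r `^ e^-1 `^ e = r)%R by rewrite -powRrM mulVf ?gt_eqF// powRr1.
have /fF[n0 H] : (r `^ e^-1)%:E < F.
  rewrite ltNge; apply: contraTN rF => Fr; rewrite -leNgt.
  have := @gt0_ler_poweR R e (ltW e0) F (r `^ e^-1)%:E.
  rewrite !in_itv /= !leey F0 lee_fin powR_ge0 => /(_ erefl erefl Fr).
  by rewrite /= reE.
exists n0 => n /H; rewrite -[in X in _ -> X]reE => h.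
by rewrite gt0_ltr_powR// nnegrE ?powR_ge0.
Qed.

Lemma exhausts_add f F g G : 0 <= F -> 0 <= G -> (forall n, 0 <= f n)%R ->
  (forall n, 0 <= g n)%R -> exhausts f F -> exhausts g G ->
  exhausts (fun n => f n + g n)%R (F + G).
Proof.
move=> F0 G0 f0 g0 fF gG r rFG.
suff [r1 [r2 [r1F r2G rr]]] : exists r1 r2 : R,
    [/\ (r1%:E < F), (r2%:E < G) & (r <= r1 + r2)%R].
  have [n1 H1] := fF _ r1F; have [n2 H2] := gG _ r2G.
  exists (maxn n1 n2) => n; rewrite geq_max => /andP[/H1 h1 /H2 h2].
  by apply: le_lt_trans rr _; exact: ltrD.
case: F F0 {fF} rFG => [x|_ _|//]; last first.
  exists (r + 1)%R, (-1)%R; rewrite ltry; split=> //; last by rewrite addrK.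
  by rewrite (lt_le_trans _ G0)// lte_fin ltrN10.
case: G G0 {gG} => [y _|_ x0 _|//]; last first.
  exists (-1)%R, (r + 1)%R; rewrite ltry; split=> //; last by rewrite addrCA addNr addr0.
  by rewrite (lt_le_trans _ x0)// lte_fin ltrN10.
rewrite -EFinD !lte_fin => x0 h; exists (x - (x + y - r) / 2)%R, (y - (x + y - r) / 2)%R.
by rewrite !lte_fin; split; lra.
Qed.

Lemma exhausts_sum (f : nat -> nat -> R) (F : nat -> \bar R) N :
  (forall i, 0 <= F i) -> (forall n i, 0 <= f n i)%R ->
  (forall i, exhausts (f^~ i) (F i)) ->
  exhausts (fun n => \sum_(i < N) f n i)%R (\sum_(i < N) F i).
Proof.
move=> F0 f0 fF; elim: N => [|N IH].
  rewrite big_ord0 => r r0; exists 0%N => n _; by rewrite big_ord0.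
rewrite big_ord_recr /=.
have := exhausts_add _ _ _ _ IH (fF N).
move=> /(_ (sume_ge0 _ _) (F0 N) _ (f0^~ N)) H r rS.
have [|n|n0 Hn] := H _ _ r rS; [by []|by apply: sumr_ge0|].
by exists n0 => n /Hn; rewrite big_ord_recr.
Qed.

Lemma exhausts_series (f : nat -> nat -> R) (F : nat -> \bar R) :
  (forall i, 0 <= F i) -> (forall n i, 0 <= f n i)%R ->
  (forall i, exhausts (f^~ i) (F i)) ->
  exhausts (fun n => \sum_(i < n) f n i)%R (\sum_(0 <= i <oo) F i).
Proof.
move=> F0 f0 fF r rS.
have [N rN] : exists N, r%:E < \sum_(i < N) F i.
  apply: contrapT => /forallNP H; move: rS; rewrite ltNge => /negP; apply.
  apply: lime_le; first exact: is_cvg_nneseries.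
  by apply: nearW => n; rewrite big_mkord leNgt; apply/negP.
have [n0 H] := exhausts_sum F0 f0 fF rN.
exists (maxn n0 N) => n; rewrite geq_max => /andP[/H rlt Nn].
apply: lt_le_trans rlt _.
rewrite -(big_mkord predT (f n)) -(big_mkord predT (f n)) (big_cat_nat (leq0n N) Nn)/=.
by rewrite lerDl sumr_ge0.
Qed.

Lemma mixed_norm_ge0 (t : seq R) (a : seq nat -> \bar R) :
  (forall w, 0 <= a w) -> 0 <= mixed_norm t a.
Proof. by case: t => [|t1 t] a0 //=; exact: poweR_ge0. Qed.

(** A single level [n] truncates all the nested sums and the entries together, so a bound uniform in
    [n] for finite arrays passes to the infinite norm through [exhausts_le]. *)
Lemma exhausts_mixed (t : seq R) (b : nat -> seq nat -> R) (a : seq nat -> \bar R) :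
  all (fun x => 0 < x)%R t -> (forall w, 0 <= a w) -> (forall n w, 0 <= b n w)%R ->
  (forall w, exhausts (b^~ w) (a w)) ->
  exhausts (fun n => fmixed n t (b n)) (mixed_norm t a).
Proof.
elim: t b a => [|t1 t IH] b a /= => [_ a0 b0 ba|/andP[t10 tp] a0 b0 ba]; first exact: ba.
apply: exhausts_powR.
- by rewrite invr_gt0.
- by apply: nneseries_ge0 => n _ _; exact: poweR_ge0.
- by move=> n; apply: sumr_ge0 => i _; exact: powR_ge0.
apply: (@exhausts_series (fun n i => fmixed n t (fun w => b n (i :: w)) `^ t1)%R).
- by move=> i; exact: poweR_ge0.
- by move=> n i; exact: powR_ge0.
move=> i; apply: exhausts_powR => //.
- by apply: mixed_norm_ge0 => w.
- by move=> n; apply: fmixed_ge0 => w.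
- exact: IH.
Qed.

End exhaustion.

Section lp.
Context {R : realType} {k : scalar_kind}.
Local Notation K := (scalar_field R k).
Local Notation mo := (@modulus R k).

Lemma exhausts_lp_norm (q : R) (x : nat -> K) : 0 < q ->
  exhausts (fun n => qnorm q (fun j : 'I_n => x j)) (lp_norm q%:E x).
Proof.
move=> q0; rewrite lp_normE//; apply: exhausts_powR.
- by rewrite invr_gt0.
- by apply: nneseries_ge0 => n _ _; exact: poweR_ge0.
- by move=> n; apply: sumr_ge0 => j _; exact: powR_ge0.
apply: (@exhausts_series _ (fun n i => mo (x i) `^ q)).
- by move=> i; exact: poweR_ge0.
- by move=> n i; exact: powR_ge0.
- by move=> i; rewrite poweR_EFin; exact: exhausts_cst.
Qed.

Lemma qnorm_le_lp_norm (q : R) (x : nat -> K) n : 0 < q ->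
  ((qnorm q (fun j : 'I_n => x j))%:E <= lp_norm q%:E x)%E.
Proof.
move=> q0; rewrite lp_normE// /qnorm -poweR_EFin.
have S0 : (0 <= \sum_(0 <= i <oo) (mo (x i))%:E `^ q)%E.
  by apply: nneseries_ge0 => i _ _; exact: poweR_ge0.
apply: gt0_ler_poweR.
- by rewrite invr_ge0 ltW.
- by rewrite in_itv /= leey lee_fin sumr_ge0// => j _; exact: powR_ge0.
- by rewrite in_itv /= leey S0.
apply: le_trans (nneseries_lim_ge n (fun i _ _ => poweR_ge0 _ _)).
by rewrite big_mkord -sumEFin.
Qed.

End lp.

(** * Finitely supported vectors and multilinear expansion *)

Lemma ge1_cases {R : realType} (p : \bar R) : (1 <= p)%E ->
  (exists r : R, 1 <= r /\ p = r%:E) \/ p = +oo%E.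
Proof. by case: p => // [r r1|_]; [left; exists r|right]. Qed.

Section vectors.
Context {R : realType} {k : scalar_kind}.
Local Notation K := (scalar_field R k).
Local Notation mo := (@modulus R k).
Local Notation rk := (@of_real R k).

Section one_space.
Variables (p : \bar R) (p1 : (1 <= p)%E).
Local Notation X := (Xp k p1).

Lemma Xp_seqD (x y : X) j : (x + y) j = x j + y j.
Proof. by []. Qed.

Lemma Xp_seqZ (c : K) (x : X) j : (c *: x) j = c * x j.
Proof. by []. Qed.

Lemma Xp_seq_sum (I : Type) (r : seq I) (P : pred I) (F : I -> X) j :
  (\sum_(i <- r | P i) F i) j = \sum_(i <- r | P i) F i j.
Proof. by elim/big_rec2 : _ => // i y1 y2 _ <-; rewrite Xp_seqD. Qed.

Definition fvec n (x : 'I_n -> K) : X := \sum_v x v *: unit_vector k p1 v.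

Lemma fvecE n (x : 'I_n -> K) j : fvec x j = \sum_v x v * (j == val v)%:R.
Proof. by rewrite /fvec Xp_seq_sum; apply: eq_bigr => v _; rewrite Xp_seqZ. Qed.

Lemma fvec_ord n (x : 'I_n -> K) (v : 'I_n) : fvec x v = x v.
Proof.
rewrite fvecE (bigD1 v)//= eqxx mulr1 big1 ?addr0// => u uv.
by rewrite val_eqE eq_sym (negbTE uv) mulr0.
Qed.

Lemma fvec_out n (x : 'I_n -> K) j : (n <= j)%N -> fvec x j = 0.
Proof.
move=> nj; rewrite fvecE big1// => v _.
by rewrite gtn_eqF ?mulr0// (leq_trans (ltn_ord v)).
Qed.

Lemma modulus_Xp_norm (x : X) : mo `|x| = fine (lp_norm p x).
Proof. by rewrite modulus_of_real// fine_ge0// lp_norm_ge0. Qed.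

Lemma Xp_norm_le1 (x : X) : (`|x| <= 1) = (lp_norm p x <= 1)%E.
Proof.
rewrite -(of_real1 R k) ler_of_real -lee_fin fineK// Xp_norm_fin_num//.
Qed.

Lemma lp_norm_fvec (r : R) n (x : 'I_n -> K) : p = r%:E ->
  lp_norm p (fvec x) = (qnorm r x)%:E.
Proof.
move=> pr; have r0 : 0 < r by move: p1; rewrite pr; exact: gt0_ge1.
rewrite [X in lp_norm X]pr lp_normE// (@nneseries_split _ _ 0 n); last by move=> *; exact: poweR_ge0.
rewrite add0n eseries0 => [|j nj _]; last first.
  by rewrite fvec_out// modulus0 poweR0r// gt_eqF.
rewrite adde0 big_mkord /qnorm -poweR_EFin -sumEFin; congr (_ `^ _)%E.
by apply: eq_bigr => v _; rewrite fvec_ord.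
Qed.

Lemma lp_normy_le (x : nat -> K) (C : R) : (forall j, mo (x j) <= C) ->
  (lp_norm +oo x <= C%:E)%E.
Proof. by move=> H; rewrite lp_normyE; apply: ess_sup_ler => j /=; rewrite lee_fin. Qed.

(* [fine p^-1] is 0 for [p = +oo]. *)
Lemma fvec_ball n (h : 'I_n -> R) (x : 'I_n -> K) : mass1 h ->
  (forall v, mo (x v) <= h v `^ fine p^-1) -> `|fvec x| <= 1.
Proof.
move=> [h0 h1] xh; rewrite Xp_norm_le1.
have [[r [r1 pr]]|py] := ge1_cases p1.
  rewrite (lp_norm_fvec _ pr) lee_fin; have r0 : 0 < r := lt_le_trans ltr01 r1.
  rewrite pr inver gt_eqF//= in xh.
  rewrite /qnorm powR_le1 ?invr_ge0 ?(ltW r0)// sumr_ge0/= => [|v _]; last exact: powR_ge0.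
  apply: le_trans h1; apply: ler_sum => v _.
  apply: le_trans (ler_powR2 (modulus_ge0 _) (xh v) (ltW r0)) _.
  by rewrite -powRrM mulVf ?gt_eqF// powRr1.
rewrite [X in lp_norm X]py; apply: lp_normy_le => j.
have [jn|nj] := ltnP j n; last by rewrite fvec_out// modulus0.
rewrite -[j]/(val (Ordinal jn)) fvec_ord (le_trans (xh _))// py invey /=.
by rewrite powRr0.
Qed.

Lemma lp_norm_mono (q0 q : R) (x : nat -> K) : 1 <= q0 -> (q0%:E <= q%:E)%E ->
  (lp_norm q%:E x <= lp_norm q0%:E x)%E.
Proof.
rewrite lee_fin => q01 q0q; have q00 : 0 < q0 := lt_le_trans ltr01 q01.
have qp : 0 < q := lt_le_trans q00 q0q.
case: (lp_norm q0%:E x) (lp_norm_ge0 q0%:E x) (fun n => @qnorm_le_lp_norm R k q0 x n q00)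
  => [L|_ _|//]; last by rewrite leey.
rewrite lee_fin => L0 H.
apply: (exhausts_le (exhausts_lp_norm qp)) => n _.
have := H n; rewrite lee_fin => {}H.
have HS : \sum_(j < n) mo (x j) `^ q0 <= L `^ q0.
  have := ler_powR2 (qnorm_ge0 _ _) H (ltW q00).
  rewrite /qnorm -powRrM mulVf ?gt_eqF// powRr1// sumr_ge0// => j _.
  exact: powR_ge0.
have xL (j : 'I_n) : mo (x j) <= L.
  have := le_trans _ HS; rewrite (bigD1 j)//= => /(_ (mo (x j) `^ q0)).
  rewrite lerDl sumr_ge0 => [/(_ erefl)|i _]; last exact: powR_ge0.
  move=> h; rewrite -[leRHS]powRr1// -[leLHS]powRr1 ?modulus_ge0//.
  by rewrite -(divff (lt0r_neq0 q00)) !powRrM ler_powR2 ?powR_ge0 ?invr_ge0 ?(ltW q00).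
suff : \sum_(j < n) mo (x j) `^ q <= L `^ q.
  move=> HS'; rewrite -[leRHS]powRr1// -(divff (lt0r_neq0 qp)) powRrM.
  by apply: ler_powR2 => //; rewrite ?invr_ge0 ?(ltW qp)// sumr_ge0// => i _; exact: powR_ge0.
apply: (@le_trans _ _ (\sum_(j < n) L `^ (q - q0) * mo (x j) `^ q0)).
  apply: ler_sum => j _; rewrite -{1}(subrK q0 q) addrC.
  have [->|q0n] := eqVneq (mo (x j)) 0.
    by rewrite powR0 ?mulr_ge0 ?powR_ge0// addrC subrK gt_eqF.
  have xp : 0 < mo (x j) by rewrite lt_def q0n modulus_ge0.
  rewrite -(powRDgt0 _ _ xp) mulrC ler_wpM2r ?powR_ge0//.
  by rewrite ler_powR2 ?modulus_ge0 ?subr_ge0.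
rewrite -mulr_sumr; apply: (@le_trans _ _ (L `^ (q - q0) * L `^ q0)).
  by rewrite ler_wpM2l ?powR_ge0.
have [->|Ln] := eqVneq L 0.
  by rewrite [X in _ * X]powR0 ?mulr0 ?powR_ge0// gt_eqF.
by rewrite powRDgt0 ?lt_def ?Ln// subrK.
Qed.

Lemma lp_normy_mono (q0 : R) (x : nat -> K) : 1 <= q0 ->
  (lp_norm +oo x <= lp_norm q0%:E x)%E.
Proof.
move=> q01; have q00 : 0 < q0 := lt_le_trans ltr01 q01.
case: (lp_norm q0%:E x) (lp_norm_ge0 q0%:E x) (fun n => @qnorm_le_lp_norm R k q0 x n q00)
  => [L|_ _|//]; last by rewrite leey.
rewrite lee_fin => L0 H; apply: lp_normy_le => j.
have := H j.+1; rewrite lee_fin; apply: le_trans.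
rewrite /qnorm big_ord_recr /= -[leLHS]powRr1 ?modulus_ge0// -(divff (lt0r_neq0 q00)) powRrM.
rewrite ler_powR2 ?invr_ge0 ?(ltW q00) ?powR_ge0// lerDr sumr_ge0// => i _.
exact: powR_ge0.
Qed.

End one_space.

Section expansion.
Variables (m n : nat) (E : 'I_m -> lmodType K) (F : lmodType K) (A : (forall i, E i) -> F).
Hypothesis Alin : multilinear A.

Lemma multilinear_sum (y : forall i, E i) l (I : Type) (r : seq I) (c : I -> K) (e : I -> E l) :
  A (dfwith y l (\sum_(v <- r) c v *: e v)) =
  \sum_(v <- r) c v *: A (dfwith y l (e v)).
Proof.
have lin := @Alin y l.
have A0 : A (dfwith y l 0) = 0.
  have := lin (-1) 0 0; rewrite scaler0 addr0 scaleN1r => h.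
  by rewrite h addNr.
elim: r => [|v r IH]; first by rewrite !big_nil.
by rewrite !big_cons lin IH.
Qed.

Variable (v0 : 'I_n).

Definition upd (f : {ffun 'I_m -> 'I_n}) l v : {ffun 'I_m -> 'I_n} :=
  [ffun j => if j == l then v else f j].

(** Multi-indices on the variables of [s], represented by total ones with default [v0] elsewhere;
    the index type then stays fixed while the expansion treats one variable at a time. *)
Definition supp_in (s : seq 'I_m) (f : {ffun 'I_m -> 'I_n}) :=
  [forall l, (l \notin s) ==> (f l == v0)].

Lemma sum_supp_in (V : nmodType) l (s : seq 'I_m) (G : {ffun 'I_m -> 'I_n} -> V) : l \notin s ->
  \sum_(f | supp_in (l :: s) f) G f = \sum_v \sum_(f | supp_in s f) G (upd f l v).
Proof.
move=> ls; rewrite (pair_big predT (supp_in s) (fun v f => G (upd f l v))) /=.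
rewrite (reindex_onto (fun p : 'I_n * {ffun 'I_m -> 'I_n} => upd p.2 l p.1)
    (fun f => (f l, upd f l v0))) /=; last first.
  by move=> f _; apply/ffunP => j; rewrite !ffunE; case: eqP => [->|].
apply: eq_bigl => -[v f] /=; apply/andP/forallP => [[/forallP H /eqP[e1 e2]] j|H].
  apply/implyP => js; have [->|jl] := eqVneq j l.
    by rewrite -e2 !ffunE eqxx.
  have := H j; rewrite inE negb_or jl js /= ffunE (negbTE jl); exact.
split; first apply/forallP => j.
  apply/implyP; rewrite inE negb_or => /andP[jl js]; rewrite ffunE (negbTE jl).
  by have := H j; rewrite js.
apply/eqP; congr (_, _); first by rewrite ffunE eqxx.
apply/ffunP => j; rewrite !ffunE; case: eqP => // ->.
by have := H l; rewrite ls => /eqP.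
Qed.

Lemma multilinear_expand_in (x : 'I_m -> 'I_n -> K) (e : forall l, 'I_n -> E l) s
    (y : forall l, E l) : uniq s ->
  A (fun l => if l \in s then \sum_v x l v *: e l v else y l) =
  \sum_(f | supp_in s f) (\prod_(l <- s) x l (f l)) *:
     A (fun l => if l \in s then e l (f l) else y l).
Proof.
elim: s y => [|l s IH] y /=.
  move=> _; rewrite (big_pred1 [ffun _ => v0]) ?big_nil ?scale1r// => f.
  apply/forallP/eqP => [H|-> l]; last by rewrite ffunE eqxx.
  by apply/ffunP => l; have /eqP := H l; rewrite ffunE.
move=> /andP[ls us]; rewrite sum_supp_in//.
have -> : (fun l0 => if l0 \in l :: s then \sum_v x l0 v *: e l0 v else y l0) =
    dfwith (fun l0 => if l0 \in s then \sum_v x l0 v *: e l0 v else y l0) l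
      (\sum_v x l v *: e l v).
  apply/functional_extensionality_dep => j; rewrite inE; case: dfwithP => [|j' jl].
    by rewrite eqxx.
  by rewrite eq_sym (negbTE jl).
rewrite multilinear_sum; apply: eq_bigr => v _.
have -> : dfwith (fun l0 => if l0 \in s then \sum_v x l0 v *: e l0 v else y l0) l (e l v) =
    (fun l0 => if l0 \in s then \sum_v x l0 v *: e l0 v else dfwith y l (e l v) l0).
  apply/functional_extensionality_dep => j; case: dfwithP => [|j' jl].
    by rewrite (negbTE ls) dfwithin.
  by rewrite dfwithout.
rewrite IH// scaler_sumr; apply: eq_bigr => f _.
rewrite scalerA big_cons ffunE eqxx; congr (_ *: A _).
  congr (_ * _); rewrite [LHS]big_seq [RHS]big_seq; apply: eq_bigr => j js.
  by rewrite ffunE; case: eqP js ls => // -> ->.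
apply/functional_extensionality_dep => j; rewrite inE ffunE.
have [->|jl] := eqVneq j l; first by rewrite (negbTE ls) dfwithin.
by case: ifP => // _; rewrite dfwithout// eq_sym.
Qed.

Lemma multilinear_expand (x : 'I_m -> 'I_n -> K) (e : forall l, 'I_n -> E l) :
  A (fun l => \sum_v x l v *: e l v) =
  \sum_(f : {ffun 'I_m -> 'I_n}) (\prod_l x l (f l)) *: A (fun l => e l (f l)).
Proof.
have y : forall l, E l by move=> l; exact: 0.
have := multilinear_expand_in x e y (index_enum_uniq 'I_m).
rewrite (_ : (fun l => if _ then _ else _) = fun l => \sum_v x l v *: e l v); last first.
  by apply/functional_extensionality_dep => l; rewrite mem_index_enum.
move=> ->; apply: eq_big => [f|f _].
  by apply/forallP => l; rewrite mem_index_enum.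
congr (_ *: A _).
by apply/functional_extensionality_dep => l; rewrite mem_index_enum.
Qed.

End expansion.

End vectors.

(** * The inequality (HL) *)

Lemma fmixedZ {R : realType} n (t : seq R) (c : R) (b : seq nat -> R) :
  all (fun x => 0 < x) t -> 0 <= c -> (forall w, 0 <= b w) ->
  fmixed n t (fun w => c * b w) = c * fmixed n t b.
Proof.
move=> + c0; elim: t b => [|t1 t IH] b //= /andP[t10 tp] b0.
under eq_bigr => i _ do rewrite (IH (fun w => b (val i :: w)))// powRM ?fmixed_ge0//.
rewrite -mulr_sumr powRM ?powR_ge0//; last by apply: sumr_ge0 => i _; exact: powR_ge0.
by rewrite -powRrM divff ?gt_eqF// powRr1.
Qed.

Lemma le_mixed_norm {R : realType} (t : seq R) (a b : seq nat -> \bar R) :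
  all (fun x => 0 < x) t -> (forall w, 0 <= a w <= b w)%E ->
  (mixed_norm t a <= mixed_norm t b)%E.
Proof.
move=> + ab; have a0 w : (0 <= a w)%E by case/andP: (ab w).
have b0 w : (0 <= b w)%E by case/andP: (ab w) => ? ?; exact: le_trans (_ : a w <= b w)%E.
elim: t a b ab a0 b0 => [|t1 t IH] a b ab a0 b0 /=; first by case/andP: (ab [::]).
move=> /andP[t10 tp]; apply: gt0_ler_poweR.
- by rewrite invr_ge0 ltW.
- by rewrite in_itv /= leey andbT; apply: nneseries_ge0 => *; exact: poweR_ge0.
- by rewrite in_itv /= leey andbT; apply: nneseries_ge0 => *; exact: poweR_ge0.
apply: lee_nneseries => [i _ _|i _]; first exact: poweR_ge0.
apply: gt0_ler_poweR; first exact: ltW.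
- by rewrite in_itv /= leey andbT mixed_norm_ge0.
- by rewrite in_itv /= leey andbT mixed_norm_ge0.
- exact: IH.
Qed.

Section upper.
Context {R : realType} {k : scalar_kind}.
Local Notation K := (scalar_field R k).
Local Notation mo := (@modulus R k).
Local Notation rk := (@of_real R k).
Variables (m : nat) (p : 'I_m -> \bar R) (p1 : forall j, (1 <= p j)%E).
Variables (s : \bar R) (s1 : (1 <= s)%E) (r : R) (sr : s = r%:E).
Variables (A : (forall j, Xp k (p1 j)) -> Xp k s1) (V : R).
Hypotheses (Alin : multilinear A) (V0 : 0 < V) (AV : (operator_norm A <= V%:E)%E).

Definition coef n (f : {ffun 'I_m -> 'I_n}) (j : 'I_n) : K :=
  A (fun l => unit_vector k (p1 l) (f l)) j.

Lemma lp_norm_image (x : forall l, Xp k (p1 l)) : (forall l, `|x l| <= 1) ->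
  (lp_norm s (A x) <= V%:E)%E.
Proof.
move=> x1; apply: le_trans AV; apply: ereal_sup_ubound => /=; exists x => //.
by rewrite modulus_Xp_norm fineK// Xp_norm_fin_num.
Qed.

Let r1 : 1 <= r. Proof. by rewrite -lee_fin -sr. Qed.
Let r0 : 0 < r := lt_le_trans ltr01 r1.

(** Dominated arguments are finitely supported points of the unit balls, so expanding [A] at them
    shows that the coefficients divided by [V] satisfy [abound]. *)
Lemma coef_bound n (v0 : 'I_n) (h : 'I_m -> 'I_n -> R) (x : 'I_m -> 'I_n -> K) :
  (forall l, mass1 (h l)) ->
  (forall l v, mo (x l v) <= h l v `^ fine (p l)^-1) ->
  \sum_j mo (\sum_(i : {ffun 'I_m -> 'I_n}) (\prod_l x l (i l)) * (rk V^-1 * coef i j)) `^ r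
    <= 1.
Proof.
move=> hm xh; pose u l := fvec (p1 l) (x l).
have u1 l : `|u l| <= 1 by exact: fvec_ball (hm l) (xh l).
have AuE j : (A u) j = \sum_(i : {ffun 'I_m -> 'I_n}) (\prod_l x l (i l)) *
    (A (fun l => unit_vector k (p1 l) (i l))) j.
  by rewrite /u (multilinear_expand Alin v0) Xp_seq_sum; apply: eq_bigr.
have := qnorm_le_lp_norm (A u) n r0.
rewrite -sr => /le_trans/(_ (lp_norm_image u1)); rewrite lee_fin => H.
have -> : \sum_j mo (\sum_(i : {ffun 'I_m -> 'I_n}) (\prod_l x l (i l)) *
    (rk V^-1 * coef i j)) `^ r = (qnorm r (fun j : 'I_n => rk V^-1 * A u j)) `^ r.
  rewrite /qnorm -powRrM mulVf ?gt_eqF// powRr1; last first.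
    by apply: sumr_ge0 => j _; exact: powR_ge0.
  apply: eq_bigr => j _; congr (mo _ `^ _); rewrite AuE mulr_sumr.
  by apply: eq_bigr => i _; rewrite mulrCA.
rewrite qnormZ ?invr_ge0 ?(ltW V0)//.
have -> : 1 = (V^-1 * V) `^ r by rewrite mulVf ?gt_eqF// pow1R.
apply: ler_powR2; last exact: ltW.
- by rewrite mulr_ge0 ?qnorm_ge0// invr_ge0 ltW.
- by rewrite ler_wpM2l// invr_ge0 ltW.
Qed.

Lemma mixed_norm_le (q mu l0 l : R) (t : m.-tuple R) : (0 < m)%N ->
  r <= q /\ (r <= 2 /\ q <= 2 /\ mu = 2 \/ 2 < r /\ q = r /\ mu = r) ->
  0 < l0 -> 0 < l ->
  l0^-1 = (if r <= 2 then 2^-1 + r^-1 - q^-1 else r^-1) ->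
  l^-1 = l0^-1 - \sum_j fine (p j)^-1 ->
  (forall j, l <= tnth t j <= Num.max l mu) ->
  \sum_j (tnth t j)^-1 <= l^-1 + m.-1%:R / Num.max l mu ->
  (mixed_norm t (fun i : seq nat =>
     lp_norm q%:E (A (fun j => unit_vector k (p1 j) (nth 0%N i j))))
   <= (V * ((16 / 9) ^+ m.+1 * m%:R `^ (Num.max l mu)^-1))%:E)%E.
Proof.
move=> m0 qmu l00 lp l0E lE tP tS; pose D : R := (16 / 9) ^+ m.+1.
have D0 : 0 < D by rewrite exprn_gt0// divr_gt0.
have [rq cases] := qmu; have q0 : 0 < q := lt_le_trans r0 rq.
have mu0 : 0 < mu by case: cases => [[_ [_ ->]]|[_ [_ ->]]].
have tp : all (fun x => 0 < x) t.
  apply/allP => x /tnthP[j ->]; have /andP[h _] := tP j; exact: lt_le_trans h.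
pose b n (w : seq nat) : R :=
  qnorm q (fun j : 'I_n => A (fun l => unit_vector k (p1 l) (nth 0%N w l)) j).
apply: (@exhausts_le _ (fun n => fmixed n t (b n))).
  apply: exhausts_mixed => //.
  - by move=> w; exact: lp_norm_ge0.
  - by move=> n w; exact: qnorm_ge0.
  - by move=> w; exact: exhausts_lp_norm.
move=> n n0; pose b' w := (V * D)^-1 * b n w.
have VD0 : 0 < V * D by rewrite mulr_gt0.
have -> : fmixed n t (b n) = V * D * fmixed n t b'.
  rewrite -(fmixedZ _ tp (ltW VD0)); last first.
    by move=> w; rewrite mulr_ge0 ?qnorm_ge0// invr_ge0 ltW.
  by congr fmixed; apply/funext => w; rewrite /b' mulVKf// gt_eqF.
rewrite -mulrA ler_wpM2l ?(ltW V0)// ler_wpM2l ?(ltW D0)//.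
apply: (@fmixed_le _ m n t l mu) => //.
  by move=> w; rewrite mulr_ge0 ?qnorm_ge0// invr_ge0 ltW.
have pV0 j : 0 <= fine (p j)^-1.
  by rewrite fine_ge0// inve_ge0 (le_trans lee01).
have := array_fiber_le1 r1 pV0 (@coef_bound n (Ordinal n0)) qmu l00 lp l0E lE n0.
congr fiber_le1; apply/funext => f; congr (_ `^ _).
have bE : b n (fseq f) = qnorm q (@coef n f).
  rewrite /b; congr (qnorm q _); apply/funext => j; rewrite /coef; congr (Xp_seq (A _) _).
  by apply/functional_extensionality_dep => i; rewrite nth_fseq.
have Vinv0 : 0 <= V^-1 by rewrite invr_ge0 ltW.
have -> : qnorm q (fun j => rk V^-1 * coef f j) = V^-1 * b n (fseq f).
  by rewrite bE; exact: (qnormZ (@coef n f) q0 Vinv0).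
by rewrite -/D /b' invfM; ring.
Qed.

End upper.

(** * From extended to real exponents *)

Section parameters.
Context {R : realType} {m : nat}.
Variables (p : 'I_m -> \bar R) (p1 : forall j, (1 <= p j)%E) (s q : \bar R).
Hypotheses (s1 : (1 <= s)%E) (sq : (s <= q)%E).
Hypothesis hp : (inv_sum p < 2^-1%:E + s^-1 - (mine q 2%:E)^-1)%E.

Lemma fine_inv_ge0 j : 0 <= fine (p j)^-1.
Proof. by rewrite fine_ge0// inve_ge0 (le_trans lee01). Qed.

Lemma inv_sumE : inv_sum p = (\sum_j fine (p j)^-1)%:E.
Proof.
rewrite /inv_sum -sumEFin; apply: eq_bigr => j _; rewrite fineK//.
have [[r [r1 ->]]|->] := ge1_cases (p1 j); last by rewrite invey.
by rewrite inver gt_eqF// (lt_le_trans ltr01).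
Qed.

(** The strict inequality [hp] excludes [s = +oo]: then [q = +oo] too and its right-hand side is
    [1 / 2 + 0 - 1 / 2 = 0]. So [lambda] and the maximum are positive reals, with
    [qm = min(q, 2)]. *)
Lemma exponents_real : exists r qm l : R,
  [/\ s = r%:E, 1 <= r, qm = (if q is q'%:E then Num.min q' 2 else 2) & 0 < l] /\
  [/\ lambda p s q = l%:E, l^-1 = 2^-1 + r^-1 - qm^-1 - \sum_j fine (p j)^-1,
      lambda_max p s q = (Num.max l (Num.max r 2))%:E & 1 <= qm <= 2].
Proof.
have P0 : 0 <= \sum_j fine (p j)^-1 by apply: sumr_ge0 => j _; exact: fine_inv_ge0.
have [[r [r1 sr]]|soo] := ge1_cases s1; last first.
  exfalso; move: hp; rewrite inv_sumE.
  move: sq; rewrite soo leye_eq => /eqP ->; rewrite invey adde0.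
  have -> : mine +oo%E 2%:E = 2%:E :> \bar R by [].
  by rewrite inver gt_eqF// -EFinB subrr lte_fin ltNge P0.
have r0 : 0 < r := lt_le_trans ltr01 r1.
pose qm : R := if q is q'%:E then Num.min q' 2 else 2.
have qmE : mine q 2%:E = qm%:E.
  move: sq; rewrite /qm sr; case: (q) => [q'|_|//]; last by [].
  by rewrite -EFin_min.
have qm12 : 1 <= qm <= 2.
  move: sq; rewrite /qm sr; case: (q) => [q'|_|//]; last by rewrite lexx ler1n.
  by rewrite lee_fin => rq; rewrite le_min ge_min lexx orbT ler1n (le_trans r1 rq).
have qm0 : 0 < qm by case/andP: qm12 => h _; exact: lt_le_trans h.
pose L := 2^-1 + r^-1 - qm^-1 - \sum_j fine (p j)^-1.
have LE : (2^-1%:E + s^-1 - (mine q 2%:E)^-1 - inv_sum p)%E = L%:E.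
  by rewrite qmE sr !inver !gt_eqF// inv_sumE.
have L0 : 0 < L.
  move: hp; rewrite qmE sr !inver !gt_eqF// inv_sumE lte_fin.
  by rewrite /L subr_gt0.
have lE : lambda p s q = L^-1%:E by rewrite /lambda LE inver gt_eqF.
exists r, qm, L^-1; split; split=> //; rewrite ?invr_gt0 ?invrK//.
by rewrite /lambda_max lE sr -!EFin_max.
Qed.

Lemma lambda_inv (l : R) : lambda p s q = l%:E -> 0 < l -> (lambda p s q)^-1%E = l^-1%:E.
Proof. by move=> -> l0; rewrite inver gt_eqF. Qed.

Lemma exponent_conditionE (t : m.-tuple R) (l M : R) : lambda p s q = l%:E -> 0 < l ->
  lambda_max p s q = M%:E -> 0 < M ->
  exponent_condition p s q t <->
  \sum_j (tnth t j)^-1 <= l^-1 + m.-1%:R / M.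
Proof.
move=> lE l0 ME M0; rewrite /exponent_condition (lambda_inv lE l0) ME inver gt_eqF//.
by rewrite sumEFin -EFinM -EFinD lee_fin.
Qed.

End parameters.

Section upper_bound.
Context {R : realType} (k : scalar_kind).
Variables (m : nat) (m1 : (1 <= m)%N).
Variables (p : 'I_m -> \bar R) (p1 : forall j, (1 <= p j)%E) (s q : \bar R).
Hypotheses (s1 : (1 <= s)%E) (sq : (s <= q)%E).
Hypothesis hp : (inv_sum p < 2^-1%:E + s^-1 - (mine q 2%:E)^-1)%E.

Lemma HL_of_exponents (t : m.-tuple R) :
  (forall j, lambda p s q <= (tnth t j)%:E <= lambda_max p s q)%E ->
  exponent_condition p s q t -> HL k p1 s1 q t.
Proof.
have [r [qm [l [[sr r1 qmE l0] [lE lV ME /andP[qm1 qm2]]]]]] := exponents_real p1 s1 sq hp.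
rewrite lE ME => tP.
have r0 : 0 < r := lt_le_trans ltr01 r1.
pose mu := Num.max r 2.
have mu0 : 0 < mu by rewrite lt_max r0.
rewrite (@exponent_conditionE _ _ p s q t l (Num.max l mu))//; last by rewrite lt_max l0.
move=> tS.
have P0 : 0 <= \sum_j fine (p j)^-1.
  by apply: sumr_ge0 => j _; exact: (fine_inv_ge0 p1).
(* The [l_q] norm decreases in [q], so [q] may be lowered to the least value not below [s] that has
   the same minimum with 2, hence the same [lambda]. *)
pose q0 : R := if r <= 2 then qm else r.
pose l0V : R := if r <= 2 then 2^-1 + r^-1 - qm^-1 else r^-1.
have tP' j : l <= tnth t j <= Num.max l mu by have := tP j; rewrite !lee_fin.
have q0q : (q0%:E <= q)%E.
  move: sq; rewrite sr /q0 qmE; case: (q) => [q'| |]; rewrite ?lee_fin ?leey//.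
  by case: ifP => // _ _; rewrite ge_min lexx.
have lqm : l^-1 = l0V - \sum_j fine (p j)^-1.
  rewrite lV /l0V; case: leP => // r2; suff -> : qm = 2 by lra.
  move: sq; rewrite sr qmE; case: (q) => // q'; rewrite lee_fin => rq'.
  by rewrite min_r// ltW// (lt_le_trans r2).
have l0VE : l0V = if r <= 2 then 2^-1 + r^-1 - q0^-1 else r^-1.
  by rewrite /l0V /q0; case: ifP.
have l0V0 : 0 < l0V.
  rewrite -(subrK (\sum_j fine (p j)^-1) l0V) -lqm ltr_wpDr ?invr_gt0//.
have qmu : r <= q0 /\ (r <= 2 /\ q0 <= 2 /\ mu = 2 \/ 2 < r /\ q0 = r /\ mu = r).
  rewrite /q0 /mu; case: leP => r2; split => //.
  - move: sq; rewrite sr qmE; case: (q) => // q'; rewrite lee_fin => rq'.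
    by rewrite le_min rq'.
  - by left; split => //; split.
  - by right; split=> //; split.
have q00 : 1 <= q0 by rewrite /q0; case: ifP.
pose C : R := (16 / 9) ^+ m.+1 * m%:R `^ (Num.max l mu)^-1.
have C0 : 0 < C by rewrite mulr_gt0 ?exprn_gt0 ?divr_gt0// powR_gt0// ltr0n.
exists C => // A Alin _.
set N := mixed_norm _ _.
have tp : all (fun x => 0 < x) t.
  by apply/allP => x /tnthP[j ->]; have /andP[h _] := tP' j; exact: lt_le_trans h.
(* Stated for every positive [V] above the norm, so that an operator of norm 0 is reached by letting
   [V] tend to 0. *)
have NV (V : R) : 0 < V -> (operator_norm A <= V%:E)%E -> (N <= (V * C)%:E)%E.
  move=> V0 AV.
  have l0Vp : 0 < l0V^-1 by rewrite invr_gt0.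
  have := mixed_norm_le sr Alin V0 AV m1 qmu l0Vp l0.
  rewrite invrK => /(_ _ l0VE lqm tP' tS); apply: le_trans.
  apply: le_mixed_norm => // w; rewrite lp_norm_ge0/=.
  move: q0q; case: (q) => [q'|_|//]; first exact: lp_norm_mono.
  exact: lp_normy_mono.
have A0 : (0 <= operator_norm A)%E.
  apply: (@le_trans _ _ (modulus `|A (fun _ => 0)|)%:E); first by rewrite lee_fin modulus_ge0.
  by apply: ereal_sup_ubound => /=; exists (fun=> 0) => // j; rewrite normr0.
case: (operator_norm A) A0 NV => [V|_ _|//]; last by rewrite gt0_muley ?leey ?lte_fin.
rewrite lee_fin le_eqVlt => /predU1P[<- NV|V0 /(_ V V0 (lexx _))]; last first.
  by rewrite mulrC EFinM.
rewrite mule0; apply/lee_addgt0Pr => e e0; rewrite add0e.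
have eC : 0 < e / C by rewrite divr_gt0.
have := NV _ eC; rewrite divfK ?gt_eqF//; apply.
by rewrite lee_fin ltW.
Qed.

End upper_bound.

(** * Tensors of random signs *)

Section random_signs.
Context {R : realType}.

(** The subgaussian bound for one sign, with 2 instead of the sharp [1 / 2], which makes it
    elementary: [|y| <= 2 y ^ 2] for [|y| >= 1 / 2], and [exp y <= 1 / (1 - y) <= 1 + y + 2 y ^ 2]
    below. *)
Lemma expR_add_le (y : R) : expR y + expR (- y) <= 2 * expR (2 * y ^+ 2).
Proof.
have big (z : R) : 2^-1 <= `|z| -> expR z <= expR (2 * z ^+ 2).
  move=> z2; rewrite ler_expR (le_trans (ler_norm z))// -(real_normK (num_real z)).
  by have := normr_ge0 z; nra.
have small (z : R) : `|z| < 2^-1 -> expR z <= 1 + z + 2 * z ^+ 2.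
  rewrite ltr_norml => /andP[z1 z2].
  have h : 1 - z <= expR (- z) by exact: expR_ge1Dx.
  have zp : 0 < 1 - z by lra.
  rewrite -[z in leLHS]opprK expRN.
  apply: (@le_trans _ _ (1 - z)^-1); first by rewrite lef_pV2 ?posrE ?expR_gt0.
  rewrite -[leLHS]mul1r ler_pdivrMr//.
  have : 0 <= z ^+ 2 * (1 - 2 * z) by rewrite mulr_ge0 ?sqr_ge0//; lra.
  by move=> ?; lra.
have [y2|y2] := leP 2^-1 `|y|.
  have := big y y2; have := big (- y); rewrite normrN sqrrN => /(_ y2); lra.
have := small y y2; have := small (- y); rewrite normrN sqrrN => /(_ y2).
have := expR_ge1Dx (2 * y ^+ 2); lra.
Qed.

Lemma sum_expR_signs (T : finType) (kp : R) (c : T -> R) :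
  \sum_(d : {ffun T -> bool}) expR (kp * \sum_i rsign (d i) * c i) <=
  2 ^+ #|T| * expR (2 * kp ^+ 2 * \sum_i c i ^+ 2).
Proof.
apply: (@le_trans _ _ (\prod_i \sum_(b : bool) expR (kp * (rsign b * c i)))).
  rewrite bigA_distr_bigA /=; apply: ler_sum => d _.
  by rewrite mulr_sumr expR_sum.
rewrite mulr_sumr expR_sum -(prodr_const (pred_of_simpl (pred_of_argType T))) -big_split /=.
apply: ler_prod => i _; rewrite big_bool /rsign mul1r mulN1r mulrN.
rewrite addr_ge0 ?expR_ge0//= (le_trans (expR_add_le _))//.
by rewrite exprMn mulrA.
Qed.

Definition tsign (o : option bool) : R := if o is Some b then rsign b else 0.

(* Union bound over the [3 ^ (n * M)] families [z] of vectors with entries in {-1, 0, 1}. *)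
Lemma signed_tensor_exists M n : exists d : {ffun {ffun 'I_M -> 'I_n} -> bool},
  forall z : {ffun 'I_M -> {ffun 'I_n -> option bool}},
  `|\sum_i rsign (d i) * \prod_l tsign (z l (i l))| <=
    4 * Num.sqrt (n * M).+1%:R * \prod_l Num.sqrt (\sum_v tsign (z l v) ^+ 2).
Proof.
apply: contrapT => /forallNP H.
pose X (d : {ffun {ffun 'I_M -> 'I_n} -> bool}) (z : {ffun 'I_M -> {ffun 'I_n -> option bool}}) : R :=
  \sum_(i : {ffun 'I_M -> 'I_n}) rsign (d i) * \prod_l tsign (z l (i l)).
pose nu (z : {ffun 'I_M -> {ffun 'I_n -> option bool}}) : R := \prod_l (\sum_v tsign (z l v) ^+ 2).
pose tau : R := 4 * Num.sqrt (n * M).+1%:R.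
have nuE z : nu z = \sum_(i : {ffun 'I_M -> 'I_n}) (\prod_l tsign (z l (i l))) ^+ 2.
  rewrite /nu bigA_distr_bigA /=; apply: eq_bigr => i _.
  by rewrite prodrXl.
have nu0 z : 0 <= nu z by rewrite nuE sumr_ge0// => i _; exact: sqr_ge0.
have tau2 : tau ^+ 2 = 16 * (n * M).+1%:R.
  by rewrite exprMn sqr_sqrtr ?ler0n// -natrX.
have tau0 : 0 <= tau by rewrite mulr_ge0// sqrtr_ge0.
have sqnu (z : {ffun 'I_M -> {ffun 'I_n -> option bool}}) : \prod_l Num.sqrt (\sum_v tsign (z l v) ^+ 2) = Num.sqrt (nu z).
  rewrite /nu; elim/big_rec2 : _ => [|l y1 y2 _ ->]; first by rewrite sqrtr1.
  by rewrite sqrtrM// sumr_ge0// => v _; exact: sqr_ge0.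
have bad d : exists z, tau * Num.sqrt (nu z) < `|X d z|.
  apply: contrapT => /forallNP Hd; apply: (H d) => z.
  by rewrite sqnu leNgt; apply/negP; exact: Hd.
(* The optimal parameter: it maximises [kp * tau * sqrt nu - 2 * kp ^ 2 * nu]. As
   [tau ^ 2 = 16 (n M + 1)], a violation contributes at least [E ^ 2], while the average over [d]
   for one [z] is at most [2 E]. *)
pose kp z := tau / (4 * Num.sqrt (nu z)).
pose E := expR (2 * (n * M).+1%:R) : R.
have E0 : 0 < E by exact: expR_gt0.
have lower d : E ^+ 2 <= \sum_z (expR (kp z * X d z) + expR (- kp z * X d z)).
  have [z hz] := bad d.
  have nup : 0 < nu z.
    rewrite lt_def nu0 andbT; apply/eqP => nuz0.
    move: hz; rewrite nuz0 sqrtr0 mulr0 normr_gt0 => /eqP; apply.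
    have s0 : \sum_(i : {ffun 'I_M -> 'I_n}) (\prod_l tsign (z l (i l))) ^+ 2 <= 0.
      by rewrite -nuE nuz0.
    apply: big1 => i _; have := sum_le0_eq0 (fun i => sqr_ge0 _) s0.
    by move=> /= /(_ i isT)/eqP; rewrite sqrf_eq0 => /eqP ->; rewrite mulr0.
  rewrite (bigD1 z)//= ler_wpDr//.
    by apply: sumr_ge0 => ? _; rewrite addr_ge0// expR_ge0.
  have snu : 0 < Num.sqrt (nu z) by rewrite sqrtr_gt0.
  have kX : E ^+ 2 <= expR (kp z * `|X d z|).
    rewrite /E -expRM_natl ler_expR.
    apply: (@le_trans _ _ (kp z * (tau * Num.sqrt (nu z)))).
      rewrite /kp; have -> : tau / (4 * Num.sqrt (nu z)) * (tau * Num.sqrt (nu z)) = tau ^+ 2 / 4.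
        by field; rewrite gt_eqF.
      by rewrite tau2; lra.
    apply: ler_wpM2l (ltW hz); apply: divr_ge0 => //; apply: mulr_ge0 => //; exact: ltW.
  apply: le_trans kX _; case: (ger0P (X d z)) => _; rewrite ?mulrN -?mulNr.
  - by rewrite lerDl expR_ge0.
  - by rewrite lerDr expR_ge0.
have upper z : \sum_d (expR (kp z * X d z) + expR (- kp z * X d z)) <=
    2 * 2 ^+ #|{ffun 'I_M -> 'I_n}| * E.
  rewrite big_split /= -mulrA mulr_natl mulr2n.
  have h (e : R) : e ^+ 2 = kp z ^+ 2 -> \sum_d expR (e * X d z) <= 2 ^+ #|{ffun 'I_M -> 'I_n}| * E.
    move=> e2; apply: le_trans (sum_expR_signs _ _) _.
    rewrite ler_wpM2l ?exprn_ge0// ler_expR e2 -nuE.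
    have [->|nun0] := eqVneq (nu z) 0; first by rewrite mulr0 mulr_ge0.
    have nup : 0 < nu z by rewrite lt_def nun0 nu0.
    have snu : Num.sqrt (nu z) != 0 by rewrite gt_eqF ?sqrtr_gt0.
    rewrite -mulrA ler_wpM2l// -(sqr_sqrtr (nu0 z)) /kp.
    have -> : (tau / (4 * Num.sqrt (nu z))) ^+ 2 * Num.sqrt (nu z) ^+ 2 = tau ^+ 2 / 16.
      by field.
    by rewrite tau2; lra.
  by apply: lerD; apply: h; rewrite ?sqrrN.
have : \sum_(d : {ffun {ffun 'I_M -> 'I_n} -> bool}) E ^+ 2 <=
   \sum_(z : {ffun 'I_M -> {ffun 'I_n -> option bool}}) 2 * 2 ^+ #|{ffun 'I_M -> 'I_n}| * E.
  apply: le_trans (ler_sum _ (fun d _ => lower d)) _.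
  by rewrite exchange_big; apply: ler_sum => z _; exact: upper.
rewrite [leLHS]sumr_const [leRHS]sumr_const -[leLHS]mulr_natl -[leRHS]mulr_natl.
rewrite !card_ffun card_option card_bool !card_ord.
set N : R := 2 ^+ (n ^ M)%N; have N0 : 0 < N by rewrite exprn_gt0.
rewrite -expnM [in leLHS]natrX -/N [in leRHS]natrX => h.
have : E <= 2 * 3 ^+ (n * M).
  rewrite -(ler_pM2r E0) -(ler_pM2l N0) -expr2; apply: le_trans h _.
  by rewrite le_eqVlt; apply/orP; left; apply/eqP; ring.
apply/negP; rewrite -ltNge.
(* The [+ 1] in [tau] yields one factor 3 more than there are families, which beats the 2 coming
   from the absolute value; [exp 2 >= 3] does the rest. *)
apply: (@lt_le_trans _ _ (3 ^+ (n * M).+1)).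
  by rewrite exprS ltr_pM2r ?exprn_gt0// ltr_nat.
rewrite /E mulrC expRM_natl lerXn2r ?nnegrE ?expR_ge0//.
by have := expR_ge1Dx (2 : R); lra.
Qed.

End random_signs.

(** * From sign vectors to Euclidean balls *)

Section injective_norm.
Context {R : realType} {k : scalar_kind}.
Local Notation K := (scalar_field R k).
Local Notation mo := (@modulus R k).
Local Notation rk := (@of_real R k).

Definition harmonic_sum (n : nat) : R := \sum_(i < n) i.+1%:R^-1.

Lemma harmonic_sum_ge0 n : 0 <= harmonic_sum n.
Proof. by apply: sumr_ge0 => i _; rewrite invr_ge0. Qed.

(* The smallest entry over a set [S] is at most the average, hence at most [D / sqrt #|S|]. *)
Lemma sum_sqr_le (V : finType) (c : V -> R) (D : R) (S : {set V}) :
  (forall v, 0 <= c v) -> 0 <= D ->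
  (forall S : {set V}, \sum_(v in S) c v <= D * Num.sqrt #|S|%:R) ->
  \sum_(v in S) c v ^+ 2 <= D ^+ 2 * harmonic_sum #|S|.
Proof.
move=> c0 D0 H; move: {2}#|S| (erefl #|S|) => N; elim: N S => [|N IH] S SN.
  by move/eqP: SN; rewrite cards_eq0 => /eqP ->; rewrite big_set0 mulr_ge0 ?sqr_ge0 ?harmonic_sum_ge0.
have [v0 v0S] : exists v, v \in S by apply/set0Pn; rewrite -card_gt0 SN.
case: (@Order.TotalTheory.arg_minP _ R V v0 (mem S) c) => // v vS vmin; have {}vS : v \in S := vS.
rewrite (big_setD1 v)//=.
have SD : #|S :\ v| = N by move: SN; rewrite (cardsD1 v S) vS => -[].
have := IH _ SD; rewrite SD SN /harmonic_sum big_ord_recr /= => h.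
rewrite mulrDr addrC lerD//.
have cv : N.+1%:R * c v <= D * Num.sqrt N.+1%:R.
  rewrite -SN; apply: le_trans (H S); rewrite mulr_natl -sumr_const.
  by apply: ler_sum => u uS; exact: vmin.
have s0 : 0 < Num.sqrt (N.+1%:R : R) by rewrite sqrtr_gt0 ltr0n.
have cvs : Num.sqrt N.+1%:R * c v <= D.
  rewrite -(ler_pM2r s0) mulrAC; apply: le_trans cv.
  by rewrite -expr2 sqr_sqrtr ?ler0n.
rewrite ler_pdivlMr ?ltr0n//.
rewrite -[N.+1%:R](@sqr_sqrtr _ N.+1%:R) ?ler0n// -exprMn mulrC.
rewrite lerXn2r ?nnegrE//; last by rewrite mulr_ge0// ltW.
Qed.

(** The test vector is the sign pattern of the real, then of the imaginary part of [c] on [S], and 0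
    off [S]; the two parts account for the factor 2. *)
Lemma sum_sign_part (V : finType) (c : V -> K) (D : R) (S : {set V}) : 0 <= D ->
  (forall z : {ffun V -> option bool},
     mo (\sum_v rk (tsign (z v)) * c v) <= D * Num.sqrt (\sum_v tsign (z v) ^+ 2 : R)) ->
  \sum_(v in S) mo (c v) <= 2 * D * Num.sqrt #|S|%:R.
Proof.
move=> D0 H.
have Hp b : \sum_(v in S) `|part b (c v)| <= D * Num.sqrt #|S|%:R.
  pose z := [ffun v => if v \in S then Some (0 <= part b (c v)) else None].
  have zE v : tsign (z v) ^+ 2 = (v \in S)%:R :> R.
    by rewrite ffunE; case: ifP => _ /=; rewrite ?rsign_sqr ?expr0n.
  have := H z; rewrite (eq_bigr _ (fun v _ => zE v)).
  have -> : \sum_v (v \in S)%:R = #|S|%:R :> R.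
    by rewrite -sumr_const [RHS]big_mkcond; apply: eq_bigr => v _; case: (v \in S).
  apply: le_trans.
  have -> : \sum_(v in S) `|part b (c v)| = part b (\sum_v rk (tsign (z v)) * c v).
    rewrite part_sum [LHS]big_mkcond /=; apply: eq_bigr => v _.
    rewrite partZ ffunE; case: ifP => _ /=; last by rewrite mul0r.
    by rewrite /rsign; case: ger0P => _; rewrite ?mul1r ?mulN1r.
  rewrite (le_trans (ler_norm _))// -(ler_sqr) ?nnegrE ?modulus_ge0// modulus_sqr.
  rewrite real_normK ?num_real// (bigD1 b)//= lerDl.
  by apply: sumr_ge0 => ? _; exact: sqr_ge0.
apply: (@le_trans _ _ (\sum_(v in S) (`|part true (c v)| + `|part false (c v)|))).
  apply: ler_sum => v _; rewrite -ler_sqr ?nnegrE ?modulus_ge0 ?addr_ge0//.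
  rewrite modulus_sqr big_bool -!(real_normK (num_real (part _ _))) sqrrD.
  rewrite -addrA lerD2l lerDr mulrn_wge0// mulr_ge0//.
rewrite big_split /=; have := Hp true; have := Hp false; lra.
Qed.

(** The hypothesis is a weak [l_2] estimate: the [i]-th largest coefficient is at most
    [2 D / sqrt i]. Summing squares gives the harmonic sum, and Cauchy-Schwarz finishes. *)
Lemma functional_l2 n (c : 'I_n -> K) (D : R) (x : 'I_n -> K) : 0 <= D ->
  (forall z : {ffun 'I_n -> option bool},
     mo (\sum_v rk (tsign (z v)) * c v) <= D * Num.sqrt (\sum_v tsign (z v) ^+ 2 : R)) ->
  \sum_v mo (x v) ^+ 2 <= 1 ->
  mo (\sum_v x v * c v) <= D * (2 * Num.sqrt (harmonic_sum n)).
Proof.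
move=> D0 H x1.
have := @sum_sqr_le _ (fun v => mo (c v)) (2 * D) [set: 'I_n] (fun v => modulus_ge0 _) _
  (fun S => sum_sign_part S D0 H).
rewrite mulr_ge0// cardsT card_ord => /(_ erefl).
rewrite (eq_bigl predT) => [|v]; last by rewrite inE.
move=> c2; apply: le_trans (modulus_sum _ _ _) _.
under eq_bigr do rewrite modulusM.
have D20 : 0 <= D * (2 * Num.sqrt (harmonic_sum n)).
  by rewrite !mulr_ge0// sqrtr_ge0.
rewrite -ler_sqr ?nnegrE//; last by apply: sumr_ge0 => v _; rewrite mulr_ge0 ?modulus_ge0.
apply: le_trans (cauchy_schwarz _ _) _.
rewrite mulrA [D * 2]mulrC exprMn sqr_sqrtr ?harmonic_sum_ge0// -[leRHS]mul1r.
apply: ler_pM => //; apply: sumr_ge0 => v _; exact: sqr_ge0.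
Qed.

Variables (M n : nat).

Definition updx (x : 'I_M -> 'I_n -> K) l (y : 'I_n -> K) : 'I_M -> 'I_n -> K :=
  fun j => if j == l then y else x j.

Definition slice (b : {ffun 'I_M -> 'I_n} -> K) (x : 'I_M -> 'I_n -> K) l v : K :=
  \sum_(i : {ffun 'I_M -> 'I_n} | i l == v) (\prod_(j | j != l) x j (i j)) * b i.

Lemma form_slice (b : {ffun 'I_M -> 'I_n} -> K) (x : 'I_M -> 'I_n -> K) l y :
  \sum_(i : {ffun 'I_M -> 'I_n}) (\prod_j updx x l y j (i j)) * b i =
  \sum_v y v * slice b x l v.
Proof.
rewrite (partition_big (fun i : {ffun 'I_M -> 'I_n} => i l) predT)//=.
apply: eq_bigr => v _; rewrite /slice mulr_sumr; apply: eq_bigr => i /eqP il.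
rewrite (bigD1 l)//= /updx eqxx il -mulrA; congr (_ * (_ * _)).
by apply: eq_bigr => j /negbTE ->.
Qed.

(** Sign vectors are replaced by arbitrary vectors of the ball one variable at a time, each
    replacement costing one factor from [functional_l2]. In the induction [s] lists the variables
    already replaced. *)
Lemma signed_form_bound (b : {ffun 'I_M -> 'I_n} -> K) (tau : R) : 0 <= tau ->
  (forall z : {ffun 'I_M -> {ffun 'I_n -> option bool}},
     mo (\sum_(i : {ffun 'I_M -> 'I_n}) (\prod_l rk (tsign (z l (i l)))) * b i)
     <= tau * \prod_l Num.sqrt (\sum_v tsign (z l v) ^+ 2 : R)) ->
  forall x : 'I_M -> 'I_n -> K, (forall l, \sum_v mo (x l v) ^+ 2 <= 1) ->
  mo (\sum_(i : {ffun 'I_M -> 'I_n}) (\prod_l x l (i l)) * b i) <=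
    tau * (2 * Num.sqrt (harmonic_sum n)) ^+ M.
Proof.
move=> tau0 H x x1.
pose F := 2 * Num.sqrt (harmonic_sum n); have F0 : 0 <= F by rewrite mulr_ge0 ?sqrtr_ge0.
pose nz (z : {ffun 'I_M -> {ffun 'I_n -> option bool}}) l := Num.sqrt (\sum_v tsign (z l v) ^+ 2 : R).
suff : forall (s : seq 'I_M) (z : {ffun 'I_M -> {ffun 'I_n -> option bool}}), uniq s ->
    mo (\sum_(i : {ffun 'I_M -> 'I_n})
      (\prod_l (if l \in s then x l (i l) else rk (tsign (z l (i l))))) * b i) <=
    tau * F ^+ size s * \prod_(l | l \notin s) nz z l.
  move=> /(_ (index_enum 'I_M) [ffun _ => [ffun _ => None]] (index_enum_uniq _)).
  rewrite big_pred0 ?mulr1 => [|l]; last by rewrite mem_index_enum.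
  rewrite (_ : size _ = M); last by rewrite -[RHS]card_ord cardT enumT.
  rewrite (eq_bigr (fun i : {ffun 'I_M -> 'I_n} => (\prod_l x l (i l)) * b i))// => i _.
  by congr (_ * _); apply: eq_bigr => l _; rewrite mem_index_enum.
elim=> [|l s IH] z /=; first by rewrite expr0 mulr1; move=> _; exact: H.
move=> /andP[ls us].
pose y j v : K := if j \in s then x j v else rk (tsign (z j v)).
pose D := tau * F ^+ size s * \prod_(j | j \notin l :: s) nz z j.
have D0 : 0 <= D.
  by rewrite !mulr_ge0 ?exprn_ge0// prodr_ge0// => j _; exact: sqrtr_ge0.
have := @functional_l2 n (slice b y l) D (x l) D0 _ (x1 l).
rewrite -form_slice.
have -> : \sum_(i : {ffun 'I_M -> 'I_n}) (\prod_j updx y l (x l) j (i j)) * b i =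
   \sum_(i : {ffun 'I_M -> 'I_n})
      (\prod_j (if j \in l :: s then x j (i j) else rk (tsign (z j (i j))))) * b i.
  apply: eq_bigr => i _; congr (_ * _); apply: eq_bigr => j _.
  by rewrite /updx inE; case: eqP => [->|].
move=> h; apply: le_trans (h _) _ => [w|]; last first.
  by rewrite -/F /D exprS le_eqVlt; apply/orP; left; apply/eqP; ring.
rewrite -form_slice.
pose z' := [ffun j => if j == l then w else z j].
have -> : \sum_(i : {ffun 'I_M -> 'I_n})
    (\prod_j updx y l (fun v => rk (tsign (w v))) j (i j)) * b i =
   \sum_(i : {ffun 'I_M -> 'I_n})
      (\prod_j (if j \in s then x j (i j) else rk (tsign (z' j (i j))))) * b i.
  apply: eq_bigr => i _; congr (_ * _); apply: eq_bigr => j _.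
  by rewrite /updx /y ffunE; case: eqP => [->|//]; rewrite (negbTE ls).
apply: le_trans (IH z' us) _.
rewrite (bigD1 l)//= /D -!mulrA ler_wpM2l// ler_wpM2l ?exprn_ge0// mulrC.
rewrite [nz z' l]/nz /z' ffunE eqxx ler_wpM2r ?sqrtr_ge0//.
rewrite le_eqVlt; apply/orP; left; apply/eqP; apply: eq_big => [j|j /andP[_ /negbTE jl]].
  by rewrite inE negb_or andbC.
by rewrite /nz ffunE jl.
Qed.

(* A Kahane--Salem--Zygmund tensor, up to a logarithmic factor. *)
Lemma small_signed_tensor : exists d : {ffun {ffun 'I_M -> 'I_n} -> bool},
  forall x : 'I_M -> 'I_n -> K, (forall l, \sum_v mo (x l v) ^+ 2 <= 1) ->
  mo (\sum_(i : {ffun 'I_M -> 'I_n}) (\prod_l x l (i l)) * rk (rsign (d i))) <=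
    4 * Num.sqrt (n * M).+1%:R * (2 * Num.sqrt (harmonic_sum n)) ^+ M.
Proof.
have [d H] := @signed_tensor_exists R M n; exists d; apply: signed_form_bound.
  by rewrite mulr_ge0// sqrtr_ge0.
move=> z; apply: le_trans (H z).
rewrite -[leRHS](@modulus_rk R k) rk_sum le_eqVlt; apply/orP; left; apply/eqP.
by congr mo; apply: eq_bigr => i _; rewrite of_realM rk_prod mulrC.
Qed.

End injective_norm.

(** * Comparison of powers of n *)

Section growth.
Context {R : realType}.

Lemma harmonic_sum_ln n : harmonic_sum n.+1 <= 1 + ln n.+1%:R :> R.
Proof.
elim: n => [|n IH]; first by rewrite /harmonic_sum big_ord1 invr1 ln1 addr0.
rewrite /harmonic_sum big_ord_recr /= (le_trans (lerD IH (lexx _)))// -addrA lerD2l.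
rewrite -lerBrDl -opprB lerNr -ln_div ?posrE ?ltr0n//.
have -> : n.+1%:R / n.+2%:R = 1 + (- n.+2%:R^-1) :> R.
  have e2 : n.+1%:R = n.+2%:R - 1 :> R by rewrite -(natr1 n.+1) addrK.
  by rewrite e2 mulrBl divff ?pnatr_eq0// mul1r.
apply: le_ln1Dx; rewrite ltrN2 invf_lt1 ?ltr0n// ltr1n//.
Qed.

Lemma ln_le_powR (d : R) n : 0 < d -> ln n.+1%:R <= n.+1%:R `^ d / d.
Proof.
move=> d0; rewrite ler_pdivlMr// mulrC -ln_powR.
by apply/ltW/ln_sublinear; rewrite powR_gt0// ltr0n.
Qed.

Lemma natr1_ge1 n : 1 <= n.+1%:R :> R.
Proof. by rewrite ler1n. Qed.

Lemma powRn_ge1 n (e : R) : 0 <= e -> 1 <= n.+1%:R `^ e.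
Proof. by move=> e0; rewrite -[leLHS](powRr0 n.+1%:R); apply: ler_powR => //; exact: natr1_ge1. Qed.

Lemma harmonic_sum_powR (d : R) : 0 < d ->
  exists2 C : R, 0 < C & forall n, harmonic_sum n.+1 <= C * n.+1%:R `^ d.
Proof.
move=> d0; exists (1 + d^-1); first by rewrite addr_gt0// invr_gt0.
move=> n; apply: le_trans (harmonic_sum_ln n) _; rewrite mulrDl mul1r lerD//.
  by rewrite powRn_ge1// ltW.
by rewrite mulrC ln_le_powR.
Qed.

Definition tensor_norm_bound (M n : nat) : R :=
  4 * Num.sqrt (n * M).+1%:R * (2 * Num.sqrt (harmonic_sum n)) ^+ M.

Lemma tensor_norm_bound_ge0 M n : 0 <= tensor_norm_bound M n.
Proof. by rewrite !mulr_ge0 ?exprn_ge0 ?mulr_ge0 ?sqrtr_ge0. Qed.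

Lemma tensor_norm_growth M (e : R) : (0 < M)%N -> 0 < e -> exists2 C : R, 0 < C &
  forall n, tensor_norm_bound M n.+1 <= C * n.+1%:R `^ (2^-1 + e).
Proof.
(* Each of the [M] roots of harmonic sums may grow like [n ^ (d / 2)], which adds up to [n ^ e]. *)
move=> M0 e0; pose d := 2 * e / M%:R.
have Mp : 0 < M%:R :> R by rewrite ltr0n.
have d0 : 0 < d by rewrite divr_gt0// mulr_gt0.
have [C0 C0p HC] := harmonic_sum_powR d0.
exists (4 * Num.sqrt M.+1%:R * (2 * Num.sqrt C0) ^+ M).
  by rewrite !mulr_gt0 ?exprn_gt0 ?mulr_gt0 ?sqrtr_gt0 ?ltr0n.
move=> n; set N : R := n.+1%:R; have N0 : 0 < N by rewrite ltr0n.
have -> : 4 * Num.sqrt M.+1%:R * (2 * Num.sqrt C0) ^+ M * N `^ (2^-1 + e) =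
   (4 * (Num.sqrt M.+1%:R * N `^ 2^-1)) * ((2 * Num.sqrt C0) ^+ M * N `^ e).
  by rewrite -(powRDgt0 _ _ N0); ring.
rewrite /tensor_norm_bound; apply: ler_pM.
- by rewrite mulr_ge0 ?sqrtr_ge0.
- by rewrite exprn_ge0// mulr_ge0 ?sqrtr_ge0.
- rewrite ler_wpM2l// powR12_sqrt ?(ltW N0)// -sqrtrM ?ler0n// ler_wsqrtr//.
  by rewrite /N -natrM ler_nat [in leqRHS]mulSn [(n.+1 * M)%N]mulnC -add1n leq_add2r.
have -> : N `^ e = (N `^ (d / 2)) ^+ M.
  rewrite -powR_mulrn ?powR_ge0// -powRrM; congr (_ `^ _); rewrite /d; field.
  by rewrite gt_eqF.
rewrite -exprMn lerXn2r ?nnegrE ?mulr_ge0 ?sqrtr_ge0 ?powR_ge0//.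
rewrite -mulrA ler_wpM2l// powRrM powR12_sqrt ?powR_ge0// -sqrtrM ?(ltW C0p)//.
by rewrite ler_wsqrtr.
Qed.

Lemma le_of_growth (a b : R) :
  (forall e, 0 < e -> exists C : R, forall n, n.+1%:R `^ a <= C * n.+1%:R `^ (b + e)) ->
  a <= b.
Proof.
move=> H; rewrite leNgt; apply/negP => ba; pose e := (a - b) / 2.
have e0 : 0 < e by rewrite divr_gt0// subr_gt0.
have [C HC] := H e e0.
have HC' n : n.+1%:R `^ e <= C.
  have N0 : 0 < n.+1%:R :> R by rewrite ltr0n.
  rewrite -(ler_pM2r (powR_gt0 (b + e) N0)) powRDgt0// (_ : e + _ = a)//.
  by rewrite /e; lra.
have C0 : 0 <= C by apply: le_trans (HC' 0%N); exact: powR_ge0.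
pose n := (Num.trunc (C `^ e^-1)).+1.
have nC : C `^ e^-1 < n%:R by rewrite truncnS_gt.
have : C < n%:R `^ e.
  have CE : (C `^ e^-1) `^ e = C by rewrite -powRrM mulVf ?lt0r_neq0// powRr1.
  by rewrite -[ltLHS]CE gt0_ltr_powR// nnegrE ?powR_ge0.
by rewrite ltNge HC'.
Qed.

End growth.

(** * Finite-rank operators *)

Lemma nonexpansive_continuous (K : numFieldType) (V W : normedModType K) (f : V -> W) :
  (forall x y, `|f x - f y| <= `|x - y|) -> continuous f.
Proof.
move=> H x; apply/cvgrPdist_le => e e0; near=> y.
apply: le_trans (H x y) _; near: y.
exact: (@cvgr_dist_le _ _ _ (nbhs x) _ id x (fun A => id) e e0).
Unshelve. all: by end_near. Qed.

Lemma prod_continuous (K : numFieldType) (T : topologicalType) (I : Type) (r : seq I)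
    (F : I -> T -> K) :
  (forall i, continuous (F i)) -> continuous (fun x => \prod_(i <- r) F i x : K).
Proof.
move=> H; elim: r => [|i r IH].
  rewrite (_ : (fun x => _) = fun=> 1); first by move=> x; exact: cvg_cst.
  by apply/funext => x; rewrite big_nil.
rewrite (_ : (fun x => _) = fun x => F i x * \prod_(j <- r) F j x).
  by move=> x; apply: cvgM; [exact: H|exact: IH].
by apply/funext => x; rewrite big_cons.
Qed.

Lemma sum_continuous (K : numFieldType) (V : normedModType K) (T : topologicalType)
    (I : Type) (r : seq I) (F : I -> T -> V) :
  (forall i, continuous (F i)) -> continuous (fun x => \sum_(i <- r) F i x : V).
Proof.
move=> H; elim: r => [|i r IH].
  rewrite (_ : (fun x => _) = fun=> 0); first by move=> x; exact: cvg_cst.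
  by apply/funext => x; rewrite big_nil.
rewrite (_ : (fun x => _) = fun x => F i x + \sum_(j <- r) F j x).
  by move=> x; apply: cvgD; [exact: H|exact: IH].
by apply/funext => x; rewrite big_cons.
Qed.

Lemma scale_cst_continuous (K : numFieldType) (V : normedModType K) (T : topologicalType)
    (F : T -> K) (v : V) : continuous F -> continuous (fun x => F x *: v : V).
Proof. by move=> H x; apply: cvgZl; exact: H. Qed.

Section coordinates.
Context {R : realType} {k : scalar_kind}.
Local Notation K := (scalar_field R k).
Local Notation mo := (@modulus R k).
Local Notation rk := (@of_real R k).

Lemma modulus_le_lp_norm (p : \bar R) (p1 : (1 <= p)%E) (x : nat -> K) j :
  ((mo (x j))%:E <= lp_norm p x)%E.
Proof.
have [[r [r1 ->]]|->] := ge1_cases p1; last first.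
  rewrite lp_normyE; move: j; apply: ae_counting.
  exact: (ess_sup_ge counting (EFin \o (@modulus R k \o x))).
have r0 : 0 < r := lt_le_trans ltr01 r1.
apply: le_trans (qnorm_le_lp_norm x j.+1 r0); rewrite lee_fin.
rewrite /qnorm big_ord_recr /= -[leLHS]powRr1 ?modulus_ge0//.
rewrite -[in leLHS](mulfV (lt0r_neq0 r0)) powRrM.
rewrite ler_powR2 ?invr_ge0 ?(ltW r0) ?powR_ge0// lerDr sumr_ge0// => i _.
exact: powR_ge0.
Qed.

Variables (p : \bar R) (p1 : (1 <= p)%E).

Lemma coordinate_continuous j : continuous (fun x : Xp k p1 => x j : K).
Proof.
apply: (@nonexpansive_continuous K (Xp k p1) K) => x y.
rewrite -[x j - y j]/((x - y) j) normr_modulus ler_of_real.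
by rewrite -lee_fin fineK ?Xp_norm_fin_num// modulus_le_lp_norm.
Qed.

Lemma ball_dominated n (x : Xp k p1) : `|x| <= 1 ->
  exists h : 'I_n -> R, mass1 h /\ forall v : 'I_n, mo (x v) <= h v `^ fine p^-1.
Proof.
rewrite Xp_norm_le1 => x1; have [[r [r1 pr]]|py] := ge1_cases p1; last first.
  (* The exponent is 0 here, and [0 ^ 0 = 1] lets the zero weight dominate the unit ball. *)
  exists (fun=> 0); split; first by split=> //; rewrite big1.
  move=> v; rewrite [in leRHS]py invey powRr0 -lee_fin.
  exact: le_trans (modulus_le_lp_norm p1 x v) x1.
have r0 : 0 < r := lt_le_trans ltr01 r1.
exists (fun v => mo (x v) `^ r); split; last first.
  by move=> v; rewrite [X in fine X^-1]pr inver gt_eqF//= -powRrM divff ?gt_eqF// powRr1 ?modulus_ge0.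
split=> [v|]; first exact: powR_ge0.
have := qnorm_le_lp_norm x n r0; rewrite -[X in lp_norm X]pr => /le_trans/(_ x1).
rewrite lee_fin => h; have := ler_powR2 (qnorm_ge0 _ _) h (ltW r0).
rewrite pow1R /qnorm -powRrM mulVf ?gt_eqF// powRr1// sumr_ge0// => v _.
exact: powR_ge0.
Qed.

End coordinates.

Section operators.
Context {R : realType} {k : scalar_kind}.
Local Notation K := (scalar_field R k).
Local Notation mo := (@modulus R k).
Variables (m n : nat) (p : 'I_m -> \bar R) (p1 : forall j, (1 <= p j)%E).
Variables (s : \bar R) (s1 : (1 <= s)%E).
Variables (I : finType) (pi : 'I_m -> I -> 'I_n) (a : I -> 'I_n -> K).

(** The index type [I] with its projections [pi] covers diagonal maps, where [I] is ['I_n] and every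
    [pi l] is the identity, as well as full arrays indexed by functions. *)
Definition tensor_form (x : 'I_m -> 'I_n -> K) (j : 'I_n) : K :=
  \sum_i (\prod_l x l (pi l i)) * a i j.

Definition tensor_op (x : forall l, Xp k (p1 l)) : Xp k s1 :=
  fvec s1 (tensor_form (fun l v => x l v)).

Lemma tensor_op_multilinear : multilinear tensor_op.
Proof.
move=> x l c u v; apply/val_inj/funext => j.
rewrite -[RHS]/(c * tensor_op (dfwith x l u) j + tensor_op (dfwith x l v) j).
rewrite -[LHS]/(tensor_op (dfwith x l (c *: u + v)) j) /tensor_op.
have [jn|nj] := ltnP j n; last by rewrite !fvec_out// mulr0 addr0.
rewrite -[j]/(val (Ordinal jn)) !fvec_ord /tensor_form mulr_sumr -big_split /=.
apply: eq_bigr => i _.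
have E w : \prod_j (dfwith x l w j) (pi j i) =
    w (pi l i) * \prod_(j | j != l) x j (pi j i) :> K.
  rewrite (bigD1 l)//= dfwithin; congr (_ * _).
  by apply: eq_bigr => j0 jl; rewrite dfwithout// eq_sym.
by rewrite !E Xp_seqD Xp_seqZ mulrDl mulrDl !mulrA.
Qed.

Lemma tensor_op_continuous :
  continuous (tensor_op : prod_topology (fun j => Xp k (p1 j)) -> Xp k s1).
Proof.
pose T := prod_topology (fun j => Xp k (p1 j)).
have ccoord l (v : nat) : continuous (fun x : T => x l v : K).
  move=> x; apply: (@continuous_comp T (Xp k (p1 l)) K (fun x => x l) (fun y => y v)).
    exact: (@proj_continuous _ (fun j => Xp k (p1 j)) l).
  exact: coordinate_continuous.
apply: sum_continuous => v; apply: scale_cst_continuous.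
apply: (@sum_continuous K K) => i; apply: (@scale_cst_continuous K K).
by apply: prod_continuous => l; exact: ccoord.
Qed.

Lemma tensor_op_norm (r C : R) : s = r%:E ->
  (forall (h : 'I_m -> 'I_n -> R) (x : 'I_m -> 'I_n -> K), (forall l, mass1 (h l)) ->
     (forall l v, mo (x l v) <= h l v `^ fine (p l)^-1) ->
     qnorm r (tensor_form x) <= C) ->
  (operator_norm tensor_op <= C%:E)%E.
Proof.
move=> sr H; apply: ge_ereal_sup => _ [x /= x1 <-]; rewrite lee_fin modulus_Xp_norm.
rewrite (lp_norm_fvec s1 _ sr) /=.
have /choice[h hP] : forall l, exists h : 'I_n -> R,
    mass1 h /\ forall v : 'I_n, mo (x l v) <= h v `^ fine (p l)^-1.
  by move=> l; exact: ball_dominated (x1 l).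
by apply: (H h) => l; case: (hP l).
Qed.

Lemma tensor_op_unit (u : I) : (forall i, (forall l, pi l i = pi l u) -> i = u) ->
  tensor_op (fun l => unit_vector k (p1 l) (pi l u)) = fvec s1 (a u).
Proof.
move=> uP; rewrite /tensor_op; congr fvec; apply/funext => j.
rewrite /tensor_form (bigD1 u)//= big1 ?mul1r => [|l _]; last first.
  by rewrite /unit_seq eqxx.
rewrite big1 ?addr0// => i iu.
have [l /eqP il] : exists l, pi l i <> pi l u.
  by apply/existsNP => E; move/eqP: iu; apply; exact: uP.
by rewrite (bigD1 l)//= /unit_seq val_eqE (negbTE il) !mul0r.
Qed.

End operators.

(** * Lower bounds for mixed norms *)

Section lower.
Context {R : realType}.
Local Open Scope ereal_scope.

Lemma mixed_norm_ge_one (t : seq R) (a : seq nat -> \bar R) w : all (fun x => 0 < x)%R t ->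
  (forall w, 0 <= a w) -> size w = size t -> a w <= mixed_norm t a.
Proof.
elim: t a w => [|t1 t IH] a [|i w]//= /andP[t10 tp] a0 [sw].
have h := IH (fun w => a (i :: w)) w tp (fun w => a0 _) sw.
apply: (le_trans h).
have F0 j : 0 <= mixed_norm t (fun w => a (j :: w)) `^ t1 by exact: poweR_ge0.
have {1}-> : mixed_norm t (fun w => a (i :: w)) =
    (mixed_norm t (fun w => a (i :: w)) `^ t1) `^ t1^-1.
  by rewrite -poweRrM divff ?gt_eqF// poweRe1// mixed_norm_ge0.
apply: gt0_ler_poweR.
- by rewrite invr_ge0 ltW.
- by rewrite in_itv /= leey F0.
- by rewrite in_itv /= leey andbT; apply: nneseries_ge0 => *; exact: F0.
rewrite (nneseriesD1 (n := i))//.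
by rewrite leeDl// nneseries_ge0.
Qed.

Lemma nneseries_ge_const (F : nat -> \bar R) (c : R) n : (0 <= c)%R -> (forall i, 0 <= F i) ->
  (forall i, (i < n)%N -> c%:E <= F i) -> (n%:R * c)%:E <= \sum_(0 <= i <oo) F i.
Proof.
move=> c0 F0 Fc; apply: le_trans (nneseries_lim_ge n (fun i _ _ => F0 i)).
rewrite big_mkord mulr_natl -[in leLHS](card_ord n) -sumr_const -sumEFin.
by apply: lee_sum => i _; exact: Fc.
Qed.

Lemma le_poweR_EFin (x : \bar R) (c e : R) : (0 <= c)%R -> (0 <= e)%R -> c%:E <= x ->
  (c `^ e)%:E <= x `^ e.
Proof.
move=> c0 e0 cx; rewrite -poweR_EFin; apply: gt0_ler_poweR => //.
- by rewrite in_itv /= leey lee_fin c0.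
- by rewrite in_itv /= leey (le_trans _ cx)// lee_fin.
Qed.

Lemma mixed_norm_ge_cube (t : seq R) (a : seq nat -> \bar R) (c : R) n :
  all (fun x => 0 < x)%R t -> (forall w, 0 <= a w) -> (0 <= c)%R -> (0 < n)%N ->
  (forall w, size w = size t -> all (fun i => (i < n)%N) w -> c%:E <= a w) ->
  (c * n%:R `^ (\sum_(x <- t) x^-1))%:E <= mixed_norm t a.
Proof.
move=> + + c0 n0; have N0 : (0 < n%:R :> R)%R by rewrite ltr0n.
elim: t a => [|t1 t IH] a /= => [_ _ H|/andP[t10 tp] a0 H].
  by rewrite big_nil powRr0 mulr1; apply: H.
rewrite big_cons; set S := (\sum_(x <- t) x^-1)%R.
have -> : (c * n%:R `^ (t1^-1 + S) = (n%:R * (c * n%:R `^ S) `^ t1) `^ t1^-1)%R.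
  rewrite powRM ?powR_ge0 ?(ltW N0)// -[((_ * _) `^ t1 `^ _)%R]powRrM divff ?gt_eqF//.
  by rewrite powRr1 ?mulr_ge0 ?powR_ge0// mulrCA powRDgt0.
have F0 j : 0 <= mixed_norm t (fun w => a (j :: w)) `^ t1 by exact: poweR_ge0.
apply: le_poweR_EFin.
- by rewrite mulr_ge0 ?powR_ge0 ?(ltW N0).
- by rewrite invr_ge0 ltW.
apply: nneseries_ge_const => // [|i ilt]; first exact: powR_ge0.
apply: le_poweR_EFin; [by rewrite mulr_ge0 ?powR_ge0|exact: ltW|].
by apply: IH => // w sw wn; apply: H; rewrite /= ?sw ?ilt.
Qed.

(** The outermost sum keeps [n] terms, and each inner norm dominates its one entry on the
    diagonal. *)
Lemma mixed_norm_ge_diag m (t : R) (a : seq nat -> \bar R) (c : R) n : (0 < m)%N ->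
  (0 < t)%R -> (forall w, 0 <= a w) -> (0 <= c)%R ->
  (forall i, (i < n)%N -> c%:E <= a (nseq m i)) ->
  (c * n%:R `^ t^-1)%:E <= mixed_norm (nseq m t) a.
Proof.
case: m => // m _ t0 a0 c0 H /=.
have -> : (c * n%:R `^ t^-1 = (n%:R * c `^ t) `^ t^-1)%R.
  rewrite powRM ?powR_ge0 ?ler0n// -powRrM divff ?gt_eqF// powRr1// mulrC//.
have F0 j : 0 <= mixed_norm (nseq m t) (fun w => a (j :: w)) `^ t by exact: poweR_ge0.
apply: le_poweR_EFin.
- by rewrite mulr_ge0 ?powR_ge0 ?ler0n.
- by rewrite invr_ge0 ltW.
apply: nneseries_ge_const => // [|i ilt]; first exact: powR_ge0.
apply: le_poweR_EFin => //; first exact: ltW.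
apply: le_trans (H i ilt) _.
apply: (@mixed_norm_ge_one _ (fun w => a (i :: w)) (nseq m i)) => //.
  by rewrite all_nseq t0 orbT.
by rewrite !size_nseq.
Qed.

End lower.

(** * Optimality *)

Lemma powR_prod_exp {R : realType} (J : Type) (s : seq J) (x : R) (e : J -> R) : 0 < x ->
  \prod_(l <- s) x `^ e l = x `^ (\sum_(l <- s) e l).
Proof.
move=> x0; elim: s => [|l s IH]; first by rewrite !big_nil powRr0.
by rewrite !big_cons IH powRDgt0.
Qed.

Section bounds.
Context {R : realType} {k : scalar_kind}.
Local Notation K := (scalar_field R k).
Local Notation mo := (@modulus R k).
Local Notation rk := (@of_real R k).

Lemma tensor_norm_bound_gt0 M n : (0 < n)%N -> 0 < tensor_norm_bound M n :> R.
Proof.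
move=> n0; rewrite !mulr_gt0 ?exprn_gt0 ?mulr_gt0 ?sqrtr_gt0 ?ltr0n//.
rewrite -(prednK n0) /harmonic_sum big_ord_recl ltr_wpDr ?invr_gt0 ?ltr0n//.
by apply: sumr_ge0 => i _; rewrite invr_ge0.
Qed.

Lemma mass1_0 n : mass1 (fun _ : 'I_n => 0 : R).
Proof. by split=> //; rewrite big1. Qed.

Section l2.
Variables (n : nat) (n0 : (0 < n)%N).

Let nR0 : 0 < n%:R :> R. Proof. by rewrite ltr0n. Qed.

Lemma prod_l2_le (J : finType) (h : J -> 'I_n -> R) (e : J -> R) (x : J -> 'I_n -> K) :
  (forall l, mass1 (h l)) -> (forall l, 0 <= e l) -> \sum_l e l <= 2^-1 ->
  (forall l v, mo (x l v) <= h l v `^ e l) ->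
  \sum_v mo (\prod_l x l v) ^+ 2 <= (n%:R `^ (2^-1 - \sum_l e l)) ^+ 2.
Proof.
move=> hm e0 e2 xh.
have E2 : \sum_l 2 * e l <= 1 by rewrite -mulr_sumr; lra.
have := @holder_prod R 'I_n J (fun l => 2 * e l) h _ E2 (fun l => (hm l).1) (fun l => (hm l).2).
rewrite card_ord => /(_ _ n0) H.
apply: (@le_trans _ _ (\sum_v \prod_l h l v `^ (2 * e l))).
  apply: ler_sum => v _; rewrite modulus_prod -prodrXl.
  apply: ler_prod => l _; rewrite sqr_ge0/= mulrC powRrM powR_mulrn ?powR_ge0//.
  by rewrite lerXn2r ?nnegrE ?modulus_ge0 ?powR_ge0.
apply: le_trans (H _) _ => [l|]; first by rewrite mulr_ge0.
rewrite -powR_mulrn ?powR_ge0// -powRrM -mulr_sumr.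
by rewrite le_eqVlt; apply/orP; left; apply/eqP; congr (_ `^ _); field.
Qed.

Lemma single_l2_le (h : 'I_n -> R) (e : R) (x : 'I_n -> K) :
  mass1 h -> 0 <= e <= 2^-1 -> (forall v, mo (x v) <= h v `^ e) ->
  \sum_v mo (x v) ^+ 2 <= (n%:R `^ (2^-1 - e)) ^+ 2.
Proof.
move=> hm /andP[e0 e2] xh.
have := @prod_l2_le 'I_1 (fun _ => h) (fun _ => e) (fun _ => x).
rewrite big_ord1 => /(_ (fun _ => hm) (fun _ => e0) e2 (fun _ => xh)).
by congr (_ <= _); apply: eq_bigr => v _; rewrite big_ord1.
Qed.

Lemma qnorm_prod_le (r : R) (J : finType) (h : J -> 'I_n -> R) (e : J -> R)
    (x : 'I_n -> K) (b : R) :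
  0 < r -> 0 <= b -> (forall l, mass1 (h l)) -> (forall l, 0 <= e l) ->
  \sum_l e l <= r^-1 ->
  (forall v, mo (x v) <= b * \prod_l h l v `^ e l) ->
  qnorm r x <= b * n%:R `^ (r^-1 - \sum_l e l).
Proof.
move=> r0 b0 hm e0 e1 xh.
have E1 : \sum_l r * e l <= 1 by rewrite -mulr_sumr -ler_pdivlMl// mulr1.
have := @holder_prod R 'I_n J (fun l => r * e l) h _ E1 (fun l => (hm l).1) (fun l => (hm l).2).
rewrite card_ord => /(_ _ n0) H.
have S : \sum_v mo (x v) `^ r <= b `^ r * n%:R `^ (1 - \sum_l r * e l).
  apply: (@le_trans _ _ (\sum_v b `^ r * \prod_l h l v `^ (r * e l))).
    apply: ler_sum => v _.
    apply: le_trans (ler_powR2 (modulus_ge0 _) (xh v) (ltW r0)) _.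
    rewrite powRM//; last by apply: prodr_ge0 => l _; exact: powR_ge0.
    rewrite ler_wpM2l ?powR_ge0// powR_prod => [|l]; last exact: powR_ge0.
    rewrite le_eqVlt; apply/orP; left; apply/eqP; apply: eq_bigr => l _.
    by rewrite -powRrM mulrC.
  rewrite -mulr_sumr ler_wpM2l ?powR_ge0//; apply: H => l.
  by rewrite mulr_ge0// ltW.
rewrite /qnorm; apply: le_trans (ler_powR2 _ S _) _.
- by apply: sumr_ge0 => v _; exact: powR_ge0.
- by rewrite invr_ge0 ltW.
rewrite powRM ?powR_ge0// -powRrM divff ?gt_eqF// powRr1// -powRrM.
rewrite le_eqVlt; apply/orP; left; apply/eqP; congr (_ * _ `^ _).
by rewrite -mulr_sumr; field; rewrite gt_eqF.
Qed.

Lemma qnorm_of_l2 (r : R) (h : 'I_n -> R) (e : R) (g B : 'I_n -> K) (b : R) :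
  0 < r -> 0 < b -> mass1 h -> 0 <= e -> 2^-1 + e <= r^-1 ->
  (forall v, mo (g v) <= h v `^ e) -> \sum_v mo (B v) ^+ 2 <= b ^+ 2 ->
  qnorm r (fun v => g v * B v) <= b * n%:R `^ (r^-1 - 2^-1 - e).
Proof.
move=> r0 b0 hm e0 er gh HB.
(* The Euclidean bound on [B] is recast as one more weight, of mass at most 1 and exponent
   [1 / 2]. *)
pose h' (z : bool) v := if z then h v else mo (B v) ^+ 2 / b ^+ 2.
pose e' (z : bool) := if z then e else 2^-1.
have S : \sum_z e' z = 2^-1 + e by rewrite big_bool addrC.
have -> : r^-1 - 2^-1 - e = r^-1 - \sum_z e' z by rewrite S; ring.
apply: (@qnorm_prod_le r _ h' e') => //; rewrite ?S ?(ltW b0)//.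
- case=> //; split=> [v|]; first by rewrite divr_ge0// sqr_ge0.
  by rewrite -mulr_suml ler_pdivrMr ?exprn_gt0// mul1r.
- by case=> //; rewrite /e' invr_ge0.
move=> v; rewrite big_bool /= modulusM mulrCA ler_pM ?modulus_ge0//.
rewrite powR12_sqrt ?divr_ge0 ?sqr_ge0// -expr_div_n sqrtr_sqr ger0_norm; last first.
  by rewrite divr_ge0 ?modulus_ge0// ltW.
by rewrite mulrC divfK// gt_eqF.
Qed.

(** Self-duality of [l_2]: variable [ord0] receives the normalised conjugate phases of the output,
    and the other arguments are rescaled by their radii [rho]. *)
Lemma signed_dual N (d : {ffun {ffun 'I_N.+1 -> 'I_n} -> bool}) (kp : R) : 0 <= kp ->
  (forall x : 'I_N.+1 -> 'I_n -> K, (forall l, \sum_v mo (x l v) ^+ 2 <= 1) ->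
     mo (\sum_(i : {ffun 'I_N.+1 -> 'I_n}) (\prod_l x l (i l)) * rk (rsign (d i))) <= kp) ->
  forall (rho : 'I_N -> R) (x : 'I_N -> 'I_n -> K), (forall l, 0 < rho l) ->
    (forall l, \sum_v mo (x l v) ^+ 2 <= rho l ^+ 2) ->
  \sum_j mo (\sum_(i : {ffun 'I_N -> 'I_n}) (\prod_l x l (i l)) * rk (rsign (d (fcons j i)))) ^+ 2
    <= (kp * \prod_l rho l) ^+ 2.
Proof.
move=> kp0 H rho x rho0 xr; pose P := \prod_l rho l.
have P0 : 0 < P by apply: prodr_gt0.
pose B j := \sum_(i : {ffun 'I_N -> 'I_n}) (\prod_l x l (i l)) * rk (rsign (d (fcons j i))).
rewrite -/P; pose S := \sum_j mo (B j) ^+ 2; rewrite -/S.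
have S0 : 0 <= S by apply: sumr_ge0 => j _; exact: sqr_ge0.
have [->|Sn0] := eqVneq S 0; first exact: sqr_ge0.
have Sp : 0 < Num.sqrt S by rewrite sqrtr_gt0 lt_def Sn0.
rewrite -(sqr_sqrtr S0) lerXn2r ?nnegrE ?(ltW Sp) ?mulr_ge0 ?(ltW P0)//.
pose y j : K := phase (B j) * rk (mo (B j) / Num.sqrt S).
pose X (l : 'I_N.+1) : 'I_n -> K :=
  if unlift ord0 l is Some l' then fun v => rk (rho l')^-1 * x l' v else y.
have X0 : X ord0 = y by rewrite /X unlift_none.
have XS l : X (lift ord0 l) = fun v => rk (rho l)^-1 * x l v by rewrite /X liftK.
have X1 l : \sum_v mo (X l v) ^+ 2 <= 1.
  case: (unliftP ord0 l) => [l' ->|->]; rewrite ?XS ?X0.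
    under eq_bigr do rewrite modulusM modulus_rk ger0_norm ?invr_ge0 ?(ltW (rho0 _))// exprMn.
    rewrite -mulr_sumr exprVn ler_pdivrMl ?exprn_gt0// mulr1.
    exact: xr.
  under eq_bigr => j _ do rewrite modulusM modulus_phase mul1r modulus_rk
    ger0_norm ?divr_ge0 ?modulus_ge0 ?sqrtr_ge0// exprMn exprVn sqr_sqrtr//.
  by rewrite -mulr_suml divff.
have := H X X1; rewrite sum_ffun_ordS.
have -> : \sum_u \sum_(g : {ffun 'I_N -> 'I_n})
     (\prod_l X l (fcons u g l)) * rk (rsign (d (fcons u g))) = rk (Num.sqrt S / P).
  transitivity (\sum_u y u * (rk P^-1 * B u)).
    apply: eq_bigr => u _; rewrite /B !mulr_sumr; apply: eq_bigr => g _.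
    rewrite big_ord_recl fcons0 X0 -mulrA; congr (_ * _); rewrite mulrA; congr (_ * _).
    rewrite (eq_bigr (fun l => rk (rho l)^-1 * x l (g l))) => [|l _]; last by rewrite XS fconsS.
    by rewrite big_split /= -rk_prod prodfV.
  transitivity (\sum_u rk (P^-1 * (mo (B u) ^+ 2 / Num.sqrt S))).
    apply: eq_bigr => u _; rewrite /y.
    have -> : phase (B u) * rk (mo (B u) / Num.sqrt S) * (rk P^-1 * B u) =
       rk P^-1 * (rk (mo (B u) / Num.sqrt S) * (phase (B u) * B u)) by ring.
    by rewrite phaseM -!of_realM; congr rk; ring.
  rewrite -rk_sum; congr rk; rewrite -mulr_sumr -mulr_suml -/S mulrC.
  by rewrite -{1}(sqr_sqrtr S0) expr2 mulfK ?gt_eqF.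
rewrite modulus_rk ger0_norm; last by rewrite divr_ge0// ltW.
by rewrite ler_pdivrMr.
Qed.

End l2.
End bounds.

Section examples.
Context {R : realType} {k : scalar_kind}.
Local Notation K := (scalar_field R k).
Local Notation mo := (@modulus R k).
Local Notation rk := (@of_real R k).
Variables (m n : nat) (n0 : (0 < n)%N).

Definition diag_array (i j : 'I_n) : K := (i == j)%:R.

Lemma diag_form (x : 'I_m -> 'I_n -> K) j :
  tensor_form (fun _ => id) diag_array x j = \prod_l x l j.
Proof.
rewrite /tensor_form (bigD1 j)//= [X in _ + X]big1 => [|i /negbTE ij].
  by rewrite addr0 /diag_array eqxx mulr1.
by rewrite /diag_array ij mulr0.
Qed.

(** The signs spread each diagonal value over all [n] outputs, so that its [l_q] norm is
    [n ^ (1 / q)]; this is the test for [q <= 2]. *)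
Definition diag_sign_array (d : {ffun {ffun 'I_2 -> 'I_n} -> bool}) (i j : 'I_n) : K :=
  rk (rsign (d (fcons j [ffun _ => i]))).

Definition sign_array (d : {ffun {ffun 'I_m.+1 -> 'I_n} -> bool})
  (i : {ffun 'I_m -> 'I_n}) (j : 'I_n) : K := rk (rsign (d (fcons j i))).

Lemma modulus_diag_sign d i j : mo (diag_sign_array d i j) = 1.
Proof. by rewrite modulus_rk normr_rsign. Qed.

Lemma modulus_sign d i j : mo (sign_array d i j) = 1.
Proof. by rewrite modulus_rk normr_rsign. Qed.

Variables (h : 'I_m -> 'I_n -> R) (e : 'I_m -> R) (x : 'I_m -> 'I_n -> K).
Hypotheses (hm : forall l, mass1 (h l)) (e0 : forall l, 0 <= e l)
  (xh : forall l v, mo (x l v) <= h l v `^ e l).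

Lemma diag_bound (r : R) : 0 < r -> \sum_l e l <= r^-1 ->
  qnorm r (tensor_form (fun _ => id) diag_array x) <= n%:R `^ (r^-1 - \sum_l e l).
Proof.
move=> r0 e1; rewrite -[leRHS]mul1r; apply: (@qnorm_prod_le _ _ _ _ _ _ h e) => // v.
rewrite mul1r diag_form modulus_prod; apply: ler_prod => l _.
by rewrite modulus_ge0 xh.
Qed.

End examples.

Section example_bounds.
Context {R : realType} {k : scalar_kind}.
Local Notation K := (scalar_field R k).
Local Notation mo := (@modulus R k).
Local Notation rk := (@of_real R k).
Variables (n : nat) (n0 : (0 < n)%N).

Definition dominated m (h : 'I_m -> 'I_n -> R) (e : 'I_m -> R) (x : 'I_m -> 'I_n -> K) :=
  (forall l, mass1 (h l)) /\ (forall l v, mo (x l v) <= h l v `^ e l).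

Let nR0 : 0 < n%:R :> R. Proof. by rewrite ltr0n. Qed.

(** Three maps in a row: the pointwise product lands in the [l_2] ball of radius
    [n ^ (1 / 2 - sum e)], which needs [sum e <= 1 / 2]; a random sign matrix acts on [l_2]; and
    [l_2] embeds into [l_r] at the cost [n ^ (1 / r - 1 / 2)]. *)
Lemma diag_sign_bound m (e : 'I_m -> R) (r : R) : 0 < r -> (forall l, 0 <= e l) ->
  \sum_l e l <= 2^-1 -> 2^-1 <= r^-1 ->
  exists d, forall h x, dominated h e x ->
    qnorm r (tensor_form (fun _ => id) (diag_sign_array d) x) <=
    tensor_norm_bound 2 n * n%:R `^ (r^-1 - \sum_l e l).
Proof.
move=> r0 e0 e2 r2; have [d H] := @small_signed_tensor R k 2 n; exists d => h x [hm xh].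
have T0 := @tensor_norm_bound_gt0 R 2 n n0.
pose z v : K := \prod_l x l v.
pose P : R := n%:R `^ (2^-1 - \sum_l e l); have P0 : 0 < P by exact: powR_gt0.
have zP : \sum_v mo (z v) ^+ 2 <= P ^+ 2 by exact: (prod_l2_le n0 hm e0 e2 xh).
have := signed_dual (ltW T0) H (rho := fun _ => P) (x := fun _ => z) (fun _ => P0) (fun _ => zP).
rewrite big_ord1.
set B := fun j => \sum_(i : {ffun 'I_1 -> 'I_n}) (\prod_l z (i l)) * rk (rsign (d (fcons j i))).
rewrite -[X in X <= _ -> _]/(\sum_j mo (B j) ^+ 2) => HB.
have BE j : tensor_form (fun _ => id) (diag_sign_array d) x j = B j.
  rewrite /B sum_ffun_ordS /tensor_form; apply: eq_bigr => v _.
  have g : {ffun 'I_0 -> 'I_n} by apply: finfun => -[].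
  rewrite (sum_ffun_ord0 _ g) big_ord1 fcons0 /diag_sign_array; congr (_ * rk (rsign (d (fcons j _)))).
  by apply/ffunP => l; rewrite ffunE (ord1 l) fcons0.
have TP0 : 0 < tensor_norm_bound 2 n * P by rewrite mulr_gt0.
have := @qnorm_of_l2 R k n n0 r (fun _ => 0) 0 (fun _ => 1) B _ r0 TP0 (mass1_0 n) (lexx _).
rewrite addr0 => /(_ r2 _ HB) h1.
have -> : qnorm r (tensor_form (fun _ => id) (diag_sign_array d) x) = qnorm r (fun v => 1 * B v).
  by congr qnorm; apply/funext => j; rewrite BE mul1r.
apply: le_trans (h1 _) _ => [v|]; first by rewrite modulus1 powRr0.
rewrite subr0 -mulrA /P powRDgt0//.
by rewrite le_eqVlt; apply/orP; left; apply/eqP; congr (_ * _ `^ _); ring.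
Qed.

Lemma sum_half_sub m (e : 'I_m -> R) : \sum_l (2^-1 - e l) = m%:R / 2 - \sum_l e l.
Proof. by rewrite big_split /= sumr_const card_ord sumrN -[_ *+ m]mulr_natl. Qed.

Lemma signed_l2 m (d : {ffun {ffun 'I_m.+1 -> 'I_n} -> bool}) (e : 'I_m -> R)
    (h : 'I_m -> 'I_n -> R) (x : 'I_m -> 'I_n -> K) :
  (forall x : 'I_m.+1 -> 'I_n -> K, (forall l, \sum_v mo (x l v) ^+ 2 <= 1) ->
     mo (\sum_(i : {ffun 'I_m.+1 -> 'I_n}) (\prod_l x l (i l)) * rk (rsign (d i)))
       <= tensor_norm_bound m.+1 n) ->
  (forall l, 0 <= e l <= 2^-1) -> dominated h e x ->
  \sum_j mo (\sum_(i : {ffun 'I_m -> 'I_n}) (\prod_l x l (i l)) * rk (rsign (d (fcons j i)))) ^+ 2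
    <= (tensor_norm_bound m.+1 n * n%:R `^ (m%:R / 2 - \sum_l e l)) ^+ 2.
Proof.
move=> H e2 [hm xh]; rewrite -sum_half_sub -powR_prod_exp//.
apply: signed_dual => //; first exact: tensor_norm_bound_ge0.
  by move=> l; exact: powR_gt0.
by move=> l; exact: (single_l2_le n0 (hm l) (e2 l) (xh l)).
Qed.

(** Each [l_p] ball lies in an [l_2] ball of radius [n ^ (1 / 2 - e l)], the sign tensor maps these
    to [l_2], and the embedding into [l_r] costs [n ^ (1 / r - 1 / 2)]. *)
Lemma sign_bound m (e : 'I_m -> R) (r : R) : 0 < r -> (forall l, 0 <= e l <= 2^-1) ->
  2^-1 <= r^-1 ->
  exists d, forall h x, dominated h e x ->
    qnorm r (tensor_form (fun l (i : {ffun 'I_m -> 'I_n}) => i l) (sign_array d) x) <=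
    tensor_norm_bound m.+1 n * n%:R `^ (m%:R / 2 - \sum_l e l + r^-1 - 2^-1).
Proof.
move=> r0 e2 r2; have [d H] := @small_signed_tensor R k m.+1 n; exists d => h x hx.
have HB := signed_l2 H e2 hx.
set B := fun j => \sum_(i : {ffun 'I_m -> 'I_n}) (\prod_l x l (i l)) * rk (rsign (d (fcons j i))).
have TP0 : 0 < tensor_norm_bound m.+1 n * n%:R `^ (m%:R / 2 - \sum_l e l).
  by rewrite mulr_gt0 ?tensor_norm_bound_gt0// powR_gt0.
have := @qnorm_of_l2 R k n n0 r (fun _ => 0) 0 (fun _ => 1) B _ r0 TP0 (mass1_0 n) (lexx _).
rewrite addr0 => /(_ r2 _ HB) h1.
have -> : qnorm r (tensor_form (fun l (i : {ffun 'I_m -> 'I_n}) => i l) (sign_array d) x) =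
    qnorm r (fun v => 1 * B v).
  by congr qnorm; apply/funext => j; rewrite mul1r.
apply: le_trans (h1 _) _ => [v|]; first by rewrite modulus1 powRr0.
rewrite subr0 -mulrA powRDgt0//.
by rewrite le_eqVlt; apply/orP; left; apply/eqP; congr (_ * _ `^ _); ring.
Qed.

(* The output index is tied to the first variable: for [q >= 2] spreading the values over
   all outputs, as in [sign_array], would lose the factor [n ^ (1 / 2 - 1 / q)]. *)
Definition tied_sign_array m (d : {ffun {ffun 'I_m.+1 -> 'I_n} -> bool})
  (i : {ffun 'I_m.+1 -> 'I_n}) (j : 'I_n) : K :=
  if i ord0 == j then rk (rsign (d i)) else 0.

(** The output is [x ord0] times the [l_2]-valued signed form of the other variables, so Hoelder
    from [l_(p_0)] and [l_2] into [l_r] applies under [2^-1 + e ord0 <= r^-1]. *)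
Lemma tied_sign_bound m (e : 'I_m.+1 -> R) (r : R) : 0 < r -> (forall l, 0 <= e l <= 2^-1) ->
  2^-1 + e ord0 <= r^-1 ->
  exists d, forall h x, dominated h e x ->
    qnorm r (tensor_form (fun l (i : {ffun 'I_m.+1 -> 'I_n}) => i l) (tied_sign_array d) x) <=
    tensor_norm_bound m.+1 n * n%:R `^ (m%:R / 2 - \sum_l e l + r^-1 - 2^-1).
Proof.
move=> r0 e2 r2; have [d H] := @small_signed_tensor R k m.+1 n; exists d => h x [hm xh].
pose h' l := h (lift ord0 l); pose e' l := e (lift ord0 l).
pose x' (l : 'I_m) := x (lift ord0 l).
have HB : _ := signed_l2 H (e := e') (h := h') (x := x') (fun l => e2 _)
  (conj (fun l => hm _) (fun l => xh _)).
set B := fun j => \sum_(i : {ffun 'I_m -> 'I_n}) (\prod_l x' l (i l)) * rk (rsign (d (fcons j i))).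
have TP0 : 0 < tensor_norm_bound m.+1 n * n%:R `^ (m%:R / 2 - \sum_l e' l).
  by rewrite mulr_gt0 ?tensor_norm_bound_gt0// powR_gt0.
have /andP[e00 _] := e2 ord0.
have h1 := @qnorm_of_l2 R k n n0 r (h ord0) (e ord0) (x ord0) B _ r0 TP0 (hm _) e00 r2 (xh _) HB.
have -> : qnorm r (tensor_form (fun l (i : {ffun 'I_m.+1 -> 'I_n}) => i l) (tied_sign_array d) x)
    = qnorm r (fun v => x ord0 v * B v).
  congr qnorm; apply/funext => j; rewrite /tensor_form sum_ffun_ordS (bigD1 j)//=.
  rewrite [X in _ + X]big1 ?addr0 => [|u /negbTE uj]; last first.
    by rewrite big1// => g _; rewrite /tied_sign_array fcons0 uj mulr0.
  rewrite /B mulr_sumr; apply: eq_bigr => g _.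
  rewrite /tied_sign_array fcons0 eqxx big_ord_recl fcons0 -mulrA; congr (_ * (_ * _)).
  by apply: eq_bigr => l _; rewrite fconsS.
apply: le_trans h1 _; rewrite -mulrA powRDgt0// big_ord_recl.
by rewrite le_eqVlt; apply/orP; left; apply/eqP; congr (_ * _ `^ _); rewrite /e'; ring.
Qed.

End example_bounds.

(** * Inequalities that (HL) forces on test maps *)

Section test.
Context {R : realType} {k : scalar_kind}.
Local Notation K := (scalar_field R k).
Local Notation mo := (@modulus R k).
Variables (m : nat) (p : 'I_m -> \bar R) (p1 : forall j, (1 <= p j)%E).
Variables (s : \bar R) (s1 : (1 <= s)%E) (r : R) (sr : s = r%:E) (q : \bar R).

Definition norm_at_most n (I : finType) (pi : 'I_m -> I -> 'I_n) (a : I -> 'I_n -> K) (V : R) :=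
  forall h x, dominated h (fun l => fine (p l)^-1) x -> qnorm r (tensor_form pi a x) <= V.

Lemma HL_tensor (t : m.-tuple R) : HL k p1 s1 q t ->
  exists2 C : R, 0 < C & forall n (I : finType) (pi : 'I_m -> I -> 'I_n) a V,
    norm_at_most pi a V ->
    (mixed_norm t (fun i : seq nat => lp_norm q
       (tensor_op s1 pi a (fun j => unit_vector k (p1 j) (nth 0%N i j)))) <= (C * V)%:E)%E.
Proof.
move=> [C C0 H]; exists C => // n I pi a V HV.
have lin : multilinear (tensor_op s1 pi a : (forall j, Xp k (p1 j)) -> Xp k s1).
  exact: tensor_op_multilinear.
apply: (le_trans (H _ lin (@tensor_op_continuous _ _ _ _ _ p1 _ s1 _ pi a))).
rewrite EFinM lee_pmul2l ?lte_fin//.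
by apply: tensor_op_norm; [exact: sr|] => h x hm xh; apply: HV; split.
Qed.

Lemma HL_cube (t : m.-tuple R) : all (fun y => 0 < y) t -> HL k p1 s1 q t ->
  exists2 C : R, 0 < C & forall n (a : {ffun 'I_m -> 'I_n} -> 'I_n -> K) V c, (0 < n)%N ->
    norm_at_most (fun l (i : {ffun 'I_m -> 'I_n}) => i l) a V -> 0 <= c ->
    (forall i, c%:E <= lp_norm q (fvec s1 (a i)))%E ->
    c * n%:R `^ (\sum_j (tnth t j)^-1) <= C * V.
Proof.
move=> tp /HL_tensor[C C0 H]; exists C => // n a V c n0 HV c0 ca.
rewrite -lee_fin; apply: le_trans (H n _ _ a V HV).
rewrite -(big_tuple _ _ t predT (fun y => y^-1)).
apply: mixed_norm_ge_cube => // [w|w]; first exact: lp_norm_ge0.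
rewrite size_tuple => sw wn; have [f fw] := fseq_surj sw wn.
have -> : (fun j => unit_vector k (p1 j) (nth 0%N w j)) = (fun l => unit_vector k (p1 l) (f l)).
  by apply/functional_extensionality_dep => l; rewrite -fw nth_fseq.
rewrite (tensor_op_unit p1 s1 a (pi := fun l (i : {ffun 'I_m -> 'I_n}) => i l)); first exact: ca.
by move=> i il; apply/ffunP.
Qed.

Lemma HL_diag (t : R) : (0 < m)%N -> 0 < t -> HL k p1 s1 q (nseq_tuple m t) ->
  exists2 C : R, 0 < C & forall n (a : 'I_n -> 'I_n -> K) V c,
    norm_at_most (fun _ i => i) a V -> 0 <= c ->
    (forall i, c%:E <= lp_norm q (fvec s1 (a i)))%E ->
    c * n%:R `^ t^-1 <= C * V.
Proof.
move=> m0 t0 /HL_tensor[C C0 H]; exists C => // n a V c HV c0 ca.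
rewrite -lee_fin; apply: le_trans (H n _ _ a V HV).
apply: mixed_norm_ge_diag => // [w|i ilt]; first exact: lp_norm_ge0.
have -> : (fun j : 'I_m => unit_vector k (p1 j) (nth 0%N (nseq m i) j)) =
   (fun l => unit_vector k (p1 l) (Ordinal ilt)).
  by apply/functional_extensionality_dep => l; rewrite nth_nseq ltn_ord.
rewrite (tensor_op_unit p1 s1 a (pi := fun _ (i : 'I_n) => i)); first exact: ca.
by move=> j /(_ (Ordinal m0)).
Qed.

End test.

Section optimality.
Context {R : realType} (k : scalar_kind).
Local Notation K := (scalar_field R k).
Local Notation mo := (@modulus R k).

Lemma le_of_tensor_growth (M : nat) (a b C : R) : (0 < M)%N -> 0 < C ->
  (forall n, n.+1%:R `^ a <= C * (tensor_norm_bound M n.+1 * n.+1%:R `^ b)) ->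
  a <= 2^-1 + b.
Proof.
move=> M0 C0 H; apply: le_of_growth => e e0.
have [C' C'0 HC'] := tensor_norm_growth M0 e0.
exists (C * C') => n; apply: (le_trans (H n)).
have N0 : 0 < n.+1%:R :> R by rewrite ltr0n.
have -> : 2^-1 + b + e = 2^-1 + e + b by ring.
rewrite -mulrA ler_wpM2l ?(ltW C0)// -(powRDgt0 _ _ N0) mulrA.
by rewrite ler_wpM2r ?powR_ge0.
Qed.

Lemma le_of_growth0 (a b C : R) : 0 < C ->
  (forall n, n.+1%:R `^ a <= C * n.+1%:R `^ b) -> a <= b.
Proof.
move=> C0 H; apply: le_of_growth => e e0; exists C => n.
apply: le_trans (H n) _; rewrite ler_wpM2l ?(ltW C0)// ler_powR ?natr1_ge1//.
by rewrite lerDl ltW.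
Qed.

Lemma lp_norm_unimodular (s : \bar R) (s1 : (1 <= s)%E) (q : R) n (a : 'I_n -> K) :
  1 <= q -> (forall j, mo (a j) = 1) ->
  ((n%:R `^ q^-1)%:E <= lp_norm q%:E (fvec s1 a))%E.
Proof.
move=> q1 a1; have q0 : 0 < q := lt_le_trans ltr01 q1.
apply: le_trans (qnorm_le_lp_norm (fvec s1 a) n q0); rewrite lee_fin /qnorm.
under [in leRHS]eq_bigr do rewrite fvec_ord a1 pow1R.
by rewrite sumr_const card_ord.
Qed.

Lemma lp_norm_coordinate (s q : \bar R) (s1 : (1 <= s)%E) n (a : 'I_n -> K) j :
  (1 <= q)%E -> mo (a j) = 1 -> (1%:E <= lp_norm q (fvec s1 a))%E.
Proof.
move=> q1 aj; apply: le_trans (modulus_le_lp_norm q1 (fvec s1 a) j).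
by rewrite fvec_ord aj.
Qed.

(** [lambda < 2] forces the sum of the [1 / p_j] below [1 / s - 1 / qm <= 1 / 2]; hence [s <= 2] and
    every [l_p] ball embeds as the sign tensors require. The test is the full sign array for
    [q <= 2] and the tied one otherwise. *)
Lemma exponent_condition_of_HL m (m1 : (1 <= m)%N) (p : 'I_m -> \bar R)
    (p1 : forall j, (1 <= p j)%E) (s q : \bar R) (s1 : (1 <= s)%E) (sq : (s <= q)%E)
    (hp : (inv_sum p < 2^-1%:E + s^-1 - (mine q 2%:E)^-1)%E) (t : m.-tuple R) :
  (lambda p s q < 2%:E)%E -> (forall j, (1 <= (tnth t j)%:E)%E) ->
  HL k p1 s1 q t -> exponent_condition p s q t.
Proof.
case: m m1 p p1 hp t => [//|m] _ p p1 hp t.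
have [r [qm [l [[sr r1 qmE l0] [lE lV ME /andP[qm1 qm2]]]]]] := exponents_real p1 s1 sq hp.
rewrite lE lte_fin => l2 t1 HLt.
have r0 : 0 < r := lt_le_trans ltr01 r1.
have qm0 : 0 < qm := lt_le_trans ltr01 qm1.
pose e j := fine (p j)^-1; pose P := \sum_j e j.
have e0 j : 0 <= e j by exact: (fine_inv_ge0 p1).
have eP j : e j <= P by rewrite /P (bigD1 j)//= lerDl sumr_ge0.
have lV2 : 2^-1 < l^-1 by rewrite ltf_pV2 ?posrE.
have P0 : 0 <= P by exact: sumr_ge0.
have rV1 : r^-1 <= 1 by rewrite invf_le1.
have qV2 : 2^-1 <= qm^-1 by rewrite lef_pV2 ?posrE.
rewrite -/P in lV.
have eh j : 0 <= e j <= 2^-1 by rewrite e0 (le_trans (eP j))//; lra.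
have rV2 : 2^-1 <= r^-1 by lra.
have r2 : r <= 2 by rewrite -lef_pV2 ?posrE.
rewrite (@exponent_conditionE _ _ p s q t l 2)//; last first.
  by rewrite ME (max_r r2) max_r// ltW.
have tp : all (fun y => 0 < y) t.
  by apply/allP => y /tnthP[j ->]; have := t1 j; rewrite lee_fin; exact: lt_le_trans ltr01.
set S := \sum_j (tnth t j)^-1.
have q1 : (1 <= q)%E := le_trans s1 sq.
have [C C0 H] := HL_cube sr tp HLt.
have [[q' [qE q'2]]|qm2E] : (exists q', q = q'%:E /\ q' <= 2) \/ qm = 2.
  move: qmE; case: (q) q1 => [q' _| |//] qmE; last by right.
  have [q'2|q'2] := leP q' 2; first by left; exists q'.
  by right; rewrite qmE min_r// ltW.
- have qmq : qm = q' by rewrite qmE qE min_l.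
  suff : qm^-1 + S <= 2^-1 + (m.+1%:R / 2 - P + r^-1 - 2^-1).
    by rewrite lV -(natr1 m) /=; lra.
  apply: (@le_of_tensor_growth m.+2 _ _ C) => // n.
  have [d Hd] := @sign_bound R k n.+1 (ltn0Sn n) m.+1 e r r0 eh rV2.
  have := H n.+1 (sign_array d) _ (n.+1%:R `^ qm^-1) (ltn0Sn n) Hd (powR_ge0 _ _) _.
  rewrite powRDgt0 ?ltr0n//; apply => i.
  rewrite qE qmq; apply: lp_norm_unimodular; first by rewrite -qmq.
  by move=> j; exact: modulus_sign.
suff : S <= 2^-1 + (m%:R / 2 - P + r^-1 - 2^-1) by rewrite lV qm2E /=; lra.
apply: (@le_of_tensor_growth m.+1 _ _ C) => // n.
(* For [qm = 2] the inverse of [lambda] is [1 / r - P], so [lambda < 2] is exactly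
   [1 / 2 + P < 1 / r]. *)
have e2 : 2^-1 + e ord0 <= r^-1 by have := eP ord0; rewrite qm2E in lV; lra.
have [d Hd] := @tied_sign_bound R k n.+1 (ltn0Sn n) m e r r0 eh e2.
have := H n.+1 (tied_sign_array d) _ 1 (ltn0Sn n) Hd ler01 _.
rewrite mul1r; apply => i; apply: (@lp_norm_coordinate _ _ _ _ _ (i ord0)) => //.
by rewrite /tied_sign_array eqxx modulus_rk normr_rsign.
Qed.

(** Here [lambda] is itself the maximum, so the condition reads [m / t <= m / lambda] and diagonal
    maps suffice. For [q <= 2] the excluded case supplies the bound [1 / 2] on the sum of the
    [1 / p_j] that [diag_sign_bound] asks for. *)
Lemma constant_exponent_of_HL m (m1 : (1 <= m)%N) (p : 'I_m -> \bar R)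
    (p1 : forall j, (1 <= p j)%E) (s q : \bar R) (s1 : (1 <= s)%E) (sq : (s <= q)%E)
    (hp : (inv_sum p < 2^-1%:E + s^-1 - (mine q 2%:E)^-1)%E) (t : R) :
  ~ ((q <= 2%:E)%E /\ (2^-1%:E < inv_sum p)%E) ->
  (2%:E <= lambda p s q)%E -> (1 <= t%:E)%E ->
  HL k p1 s1 q (nseq_tuple m t) ->
  exponent_condition p s q (nseq_tuple m t) /\ (lambda p s q <= t%:E)%E.
Proof.
move=> nqp.
have [r [qm [l [[sr r1 qmE l0] [lE lV ME /andP[qm1 qm2]]]]]] := exponents_real p1 s1 sq hp.
rewrite lE !lee_fin => l2 t1 HLt.
have r0 : 0 < r := lt_le_trans ltr01 r1.
have t0 : 0 < t := lt_le_trans ltr01 t1.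
have qm0 : 0 < qm := lt_le_trans ltr01 qm1.
pose e j := fine (p j)^-1; pose P := \sum_j e j; rewrite -/P in lV.
have e0 j : 0 <= e j by exact: (fine_inv_ge0 p1).
have P0 : 0 <= P by exact: sumr_ge0.
have q1 : (1 <= q)%E := le_trans s1 sq.
have [C C0 H] := HL_diag sr m1 t0 HLt.
suff [rl tl] : r <= l /\ t^-1 <= l^-1.
  split; last by rewrite -lef_pV2 ?posrE.
  rewrite (@exponent_conditionE _ _ p s q _ l l)//; last first.
    by rewrite ME max_l// ge_max rl.
  under eq_bigr do rewrite tnth_nseq.
  rewrite sumr_const card_ord -[_ *+ m]mulr_natl -{1}(prednK m1) -natr1 mulrDl mul1r addrC.
  by rewrite lerD// ler_wpM2l.
have [[q' [qE q'2]]|qm2E] : (exists q', q = q'%:E /\ q' <= 2) \/ qm = 2.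
  move: qmE; case: (q) q1 => [q' _| |//] qmE; last by right.
  have [q'2|q'2] := leP q' 2; first by left; exists q'.
  by right; rewrite qmE min_r// ltW.
- have qmq : qm = q' by rewrite qmE qE min_l.
  have rq : r <= qm by move: sq; rewrite sr qE lee_fin qmq.
  have r2 : r <= 2 := le_trans rq qm2.
  split; first exact: le_trans r2 l2.
  have rV2 : 2^-1 <= r^-1 by rewrite lef_pV2 ?posrE.
  have P2 : P <= 2^-1.
    rewrite leNgt; apply/negP => P2; apply: nqp; split; first by rewrite qE lee_fin.
    by rewrite (inv_sumE p1) lte_fin.
  suff : qm^-1 + t^-1 <= 2^-1 + (r^-1 - P) by rewrite lV; lra.
  apply: (@le_of_tensor_growth 2 _ _ C) => // n.
  have [d Hd] := @diag_sign_bound R k n.+1 (ltn0Sn n) m e r r0 e0 P2 rV2.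
  have := H n.+1 (diag_sign_array d) _ (n.+1%:R `^ qm^-1) Hd (powR_ge0 _ _) _.
  rewrite powRDgt0 ?ltr0n//; apply => i.
  rewrite qE qmq; apply: lp_norm_unimodular; first by rewrite -qmq.
  by move=> j; exact: modulus_diag_sign.
have lV' : l^-1 = r^-1 - P by rewrite lV qm2E; ring.
have lVp : 0 < l^-1 by rewrite invr_gt0.
have Pr : P <= r^-1 by lra.
split; first by rewrite -lef_pV2 ?posrE//; lra.
rewrite lV'; apply: (@le_of_growth0 _ _ C) => // n.
have Hd : norm_at_most p r (fun _ (i : 'I_n.+1) => i) (@diag_array R k n.+1)
    (n.+1%:R `^ (r^-1 - P)).
  by move=> h x [hm xh]; exact: (diag_bound (ltn0Sn n) hm e0 xh r0 Pr).
have := H n.+1 (@diag_array R k n.+1) _ 1 Hd ler01 _.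
rewrite mul1r; apply => i; apply: (@lp_norm_coordinate _ _ _ _ _ i) => //.
by rewrite /diag_array eqxx modulus1.
Qed.

End optimality.

Local Open Scope ereal_scope.

Theorem theorem1p3 (R : realType) (k : scalar_kind)
    (m : nat) (m1 : (1 <= m)%N)
    (p : 'I_m -> \bar R) (p1 : forall j, 1 <= p j)
    (s q : \bar R) (s1 : 1 <= s) (sq : s <= q)
    (hp : inv_sum p < 2^-1%:E + s^-1 - (mine q 2%:E)^-1) :
  (forall t : m.-tuple R,
     (forall j, 1 <= (tnth t j)%:E) ->
     (forall j, lambda p s q <= (tnth t j)%:E <= lambda_max p s q) ->
     exponent_condition p s q t ->
     HL k p1 s1 q t)
  /\
  (~ (q <= 2%:E /\ 2^-1%:E < inv_sum p) ->
     (lambda p s q < 2%:E ->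
        forall t : m.-tuple R,
          (forall j, 1 <= (tnth t j)%:E) ->
          HL k p1 s1 q t ->
          exponent_condition p s q t)
     /\
     (2%:E <= lambda p s q ->
        forall t : R, 1 <= t%:E ->
          HL k p1 s1 q (nseq_tuple m t) ->
          exponent_condition p s q (nseq_tuple m t)
          /\ lambda p s q <= t%:E)).
Proof.
split=> [t _|nqp]; first exact: HL_of_exponents.
split=> [l2 t|l2 t]; first exact: exponent_condition_of_HL.
exact: constant_exponent_of_HL.
Qed.
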